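(* Let $f(x)=x^3+ax^2+bx+c$ with $a,b,c\in\mathbb{Z}$ be a polynomial without repeated roots, let $g=g(t)$ be a nonconstant polynomial over $\mathbb{Z}$, and let $E_g: y^2=x^3+ag(t)x^2+bg(t)^2x+cg(t)^3$ (the quadratic twist of $y^2=f(x)$ by $g$). Let $t_0\in\mathbb{Q}$ be such that the specialization $E_g(t_0)$ is well defined (an elliptic curve over $\mathbb{Q}$), and let $\sigma_{t_0}:E_g(\mathbb{Q}(t))\to E_g(t_0)(\mathbb{Q})$ be the specialization homomorphism. (i) Assume $c=0$ and that $x^2+ax+b=(x-\theta)(x-\bar\theta)$ is irreducible over $\mathbb{Q}$, with splitting field $K$ of class number $1$. Write $a^2-4b=e^2d$ with $e,d\in\mathbb{Z}$, $d$ square-free, and let $D$ be the discriminant of $K$. Assume $t_0$ satisfies: (A1) for each nonconstant square-free divisor $h$ of $bg$ in $\mathbb{Z}[t]$, $h(t_0)$ is not a square in $\mathbb{Q}$; (A2) for each nonconstant square-free divisor $h$ of $eg$ in $\mathbb{Z}[t]$ and each square-free divisor $d'$ of $D$ in $\mathbb{Z}$, $d'\cdot h(t_0)$ is not a square in $\mathbb{Q}$. Then $\sigma_{t_0}$ is injective. (ii) Assume $f(x)=(x-\theta_1)(x-\theta_2)(x-\theta_3)$ is irreducible over $\mathbb{Q}$ with cyclic Galois group, and its splitting field $K$ (with ring of integers $\mathcal{O}_K$) has class number $1$. Set $e:=\sqrt{D}$, where $D$ is the discriminant of $f$. Let $\mathcal{G}$ be the set of prime factors of $eg$ in $\mathbb{Z}[t]$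 that split in $\mathcal{O}_K[t]$. Assume $t_0$ satisfies: (B) whenever, for each element of $\mathcal{G}$, one chooses either none or two of its prime factors in $\mathcal{O}_K[t]$, and $h$ denotes the product of all chosen prime factors, then for each such nonconstant $h$ and each unit $\epsilon$ of $\mathcal{O}_K$, $\epsilon h(t_0)$ is not a square in $K$. Then $\sigma_{t_0}$ is injective.
   Context: The specialization homomorphism $\sigma_{t_0}$ sends a point of $E_g(\mathbb{Q}(t))$ to the point obtained by evaluating its projective coordinates at $t=t_0$. In case (ii), since the Galois group is cyclic, $D$ is a rational square, so $e\in\mathbb{Z}$; a prime (irreducible) element $H$ of $\mathbb{Z}[t]$ splits in $\mathcal{O}_K[t]$ if $H=\pm\mathcal{P}\mathcal{P}^\tau\mathcal{P}^{\tau^2}$ with $\mathcal{P}$ irreducible in $\mathcal{O}_K[t]$, $\tau$ a generator of $\mathrm{Gal}(K/\mathbb{Q})$, and $\mathcal{P},\mathcal{P}^\tau$ non-associate; its prime factors in $\mathcal{O}_K[t]$ are then $\mathcal{P},\mathcal{P}^\tau,\mathcal{P}^{\tau^2}$. *)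

(* Defs.v *)
From HB Require Import structures.
From mathcomp Require Import all_boot all_order all_algebra all_field.
Set Implicit Arguments. Unset Strict Implicit. Unset Printing Implicit Defensive.
Import Order.TTheory GRing.Theory Num.Theory.
Local Open Scope ring_scope.

Notation Qt := {fraction {poly rat}}.
Definition toQt (p : {poly rat}) : Qt := FracField.tofrac p.

Definition polyZQ (p : {poly int}) : {poly rat} := map_poly (fun z : int => z%:~R) p.

(* divisibility in Z[t] (genuine divisibility, not pseudo-divisibility) *)
Definition dvdZt (p q : {poly int}) : Prop := exists r : {poly int}, q = p * r.

Definition unitZt (p : {poly int}) : Prop := p = 1 \/ p = -1.

Definition sqfreeZt (h : {poly int}) : Prop :=
  h <> 0 /\ forall p : {poly int}, dvdZt (p * p) h -> unitZt p.

(* prime (= irreducible, Z[t] being a UFD) element of Z[t] *)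
Definition primeZt (H : {poly int}) : Prop :=
  H <> 0 /\ ~ unitZt H /\
  forall q r : {poly int}, H = q * r -> unitZt q \/ unitZt r.

Definition sqfreeZ (d : int) : Prop :=
  d <> 0 /\ forall p : int, (p * p %| d)%Z -> `|p| = 1.

Definition is_square_Q (q : rat) : Prop := exists r : rat, r ^+ 2 = q.

Definition cubicQ (a b c : rat) : {poly rat} := 'X^3 + a *: 'X^2 + b *: 'X + c%:P.

Definition no_repeated_roots (p : {poly rat}) : Prop :=
  forall z : algC, ~ (('X - z%:P) ^+ 2 %| map_poly ratr p).

(* E_g : y^2 = x^3 + a g x^2 + b g^2 x + c g^3, points of E_g(Q(t));
   None is the point at infinity *)
Definition on_Eg (a b c : int) (g : {poly int}) (P : option (Qt * Qt)) : Prop :=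
  match P with
  | None => True
  | Some (x, y) =>
      let G := toQt (polyZQ g) in
      y ^+ 2 = x ^+ 3 + a%:~R * G * x ^+ 2 + b%:~R * G ^+ 2 * x + c%:~R * G ^+ 3
  end.

Definition evals_to (t0 : rat) (x : Qt) (u : rat) : Prop :=
  exists p q : {poly rat}, q.[t0] != 0 /\ x = toQt p / toQt q /\ u = p.[t0] / q.[t0].

Definition regular_at (t0 : rat) (x : Qt) : Prop := exists u, evals_to t0 x u.

(* graph of the specialization map sigma_{t0} : E_g(Q(t)) -> E_g(t0)(Q):
   evaluate the projective coordinates at t0; an affine point (x,y) whose
   x-coordinate has a pole at t0 goes to the point at infinity *)
Definition specializes (t0 : rat) (P : option (Qt * Qt)) (R : option (rat * rat)) : Prop :=
  match P, R with
  | None, None => True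
  | None, Some _ => False
  | Some (x, _), None => ~ regular_at t0 x
  | Some (x, y), Some (u, v) => evals_to t0 x u /\ evals_to t0 y v
  end.

Definition sigma_injective (a b c : int) (g : {poly int}) (t0 : rat) : Prop :=
  forall (P Q : option (Qt * Qt)) (R : option (rat * rat)),
    on_Eg a b c g P -> on_Eg a b c g Q ->
    specializes t0 P R -> specializes t0 Q R -> P = Q.

Definition subfield_closed (S : algC -> Prop) : Prop :=
  S 0 /\ S 1 /\ (forall x y, S x -> S y -> S (x + y)) /\ (forall x, S x -> S (- x)) /\
  (forall x y, S x -> S y -> S (x * y)) /\ (forall x, S x -> x != 0 -> S x^-1).

Definition inK (rs : seq algC) (z : algC) : Prop :=
  forall S : algC -> Prop, subfield_closed S -> (forall r, r \in rs -> S r) -> S z.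

Definition inOK (rs : seq algC) (z : algC) : Prop := inK rs z /\ z \in Aint.

Definition unitOK (rs : seq algC) (z : algC) : Prop :=
  inOK rs z /\ exists w, inOK rs w /\ z * w = 1.

Definition idealOK (rs : seq algC) (I : algC -> Prop) : Prop :=
  (forall z, I z -> inOK rs z) /\ I 0 /\ (forall x y, I x -> I y -> I (x + y)) /\
  (forall r x, inOK rs r -> I x -> I (r * x)).

Definition class_number_one (rs : seq algC) : Prop :=
  forall I, idealOK rs I ->
    exists al, inOK rs al /\ forall z, I z <-> exists be, inOK rs be /\ z = al * be.

(* field automorphisms of K (these automatically fix Q) *)
Definition field_aut (rs : seq algC) (tau : algC -> algC) : Prop :=
  (forall x y, inK rs x -> inK rs y -> tau (x + y) = tau x + tau y) /\
  (forall x y, inK rs x -> inK rs y -> tau (x * y) = tau x * tau y) /\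
  tau 1 = 1 /\ (forall x, inK rs x -> inK rs (tau x)) /\
  (forall y, inK rs y -> exists x, inK rs x /\ tau x = y).

Definition gal_generator (rs : seq algC) (tau : algC -> algC) : Prop :=
  field_aut rs tau /\
  forall s, field_aut rs s -> exists k : nat, forall x, inK rs x -> s x = iter k tau x.

(* discriminant of a quadratic field K: (det [sigma_i(w_j)])^2 for an
   integral basis (w1, w2) of O_K, the embeddings being id and the
   nontrivial automorphism tau *)
Definition quad_field_disc (rs : seq algC) (D : int) : Prop :=
  exists (w1 w2 : algC) (tau : algC -> algC),
    inOK rs w1 /\ inOK rs w2 /\
    (forall z, inOK rs z <-> exists m1 m2 : int, z = m1%:~R * w1 + m2%:~R * w2) /\
    (forall m1 m2 : int, m1%:~R * w1 + m2%:~R * w2 = 0 -> m1 = 0 /\ m2 = 0) /\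
    field_aut rs tau /\ (exists x, inK rs x /\ tau x != x) /\
    D%:~R = (w1 * tau w2 - tau w1 * w2) ^+ 2.

Definition polyOK (rs : seq algC) (P : {poly algC}) : Prop :=
  forall i, inOK rs P`_i.

Definition unitOKt (rs : seq algC) (P : {poly algC}) : Prop :=
  polyOK rs P /\ exists Q, polyOK rs Q /\ P * Q = 1.

Definition irredOKt (rs : seq algC) (P : {poly algC}) : Prop :=
  polyOK rs P /\ P <> 0 /\ ~ unitOKt rs P /\
  forall Q R, polyOK rs Q -> polyOK rs R -> P = Q * R -> unitOKt rs Q \/ unitOKt rs R.

Definition associateOKt (rs : seq algC) (P Q : {poly algC}) : Prop :=
  exists u, unitOKt rs u /\ P = u * Q.

Definition polyZC (p : {poly int}) : {poly algC} := map_poly (fun z : int => z%:~R) p.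

Definition splits_as (rs : seq algC) (tau : algC -> algC) (H : {poly int}) (P : {poly algC}) : Prop :=
  primeZt H /\ irredOKt rs P /\
  (polyZC H = P * map_poly tau P * map_poly (tau \o tau) P \/
   polyZC H = - (P * map_poly tau P * map_poly (tau \o tau) P)) /\
  ~ associateOKt rs P (map_poly tau P).

Definition choose_factors (tau : algC -> algC) (s : 'I_4) (P : {poly algC}) : {poly algC} :=
  match val s with
  | 0 => 1
  | 1 => P * map_poly tau P
  | 2 => P * map_poly (tau \o tau) P
  | _ => map_poly tau P * map_poly (tau \o tau) P
  end.

(* Main.v *)
Require Import Defs.
From HB Require Import structures.
From mathcomp Require Import all_boot all_order all_algebra all_field.
From mathcomp Require Import ring.
From Stdlib Require Import Classical ClassicalEpsilon.
Set Implicit Arguments. Unset Strict Implicit. Unset Printing Implicit Defensive.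
Import Order.TTheory GRing.Theory Num.Theory.
Local Open Scope ring_scope.


(** Specialization at [t0] is compatible with subtraction, so it is enough to show that
   no affine point [S = (x, y)] of [E_g(Q(t))] reduces to the origin. Write
   [x = p / q^2] in lowest terms over [Z[t]]; then [q(t0) = 0] and [p(t0)] is a nonzero
   rational square. A 2-descent shows that [p - theta g q^2] is a square for every root
   [theta] of [f]: the square-free part is made of primes dividing [b g] or [e g], its
   value at [t0] is a square, and the hypothesis on [t0] makes it constant. Hence
   [S = 2 S1] with [S1] over [Q(t)], and the signs of the square roots can be chosen so
   that [S1] again reduces to the origin. In the coordinate [X = x / g] duplication is a
   rational map of degree 4 with constant coefficients, so the denominator of [X(S1)] has
   smaller degree than that of [X(S)]: infinite descent.

   When [f] has the rational root 0, put [n^2 = p^2 + a g p q^2 + b g^2 q^4] and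
   [m = 2p + a g q^2 + 2n]: then [p - theta g q^2] is [m] times a square of [K(t)] and
   [m (m - 4n) = e^2 d g^2 q^4], so that everything takes place in [Z[t]]. When [f] is
   cyclic, unique factorization in [O_K[t]] is used: [p - theta g q^2] has square norm,
   hence each prime of [Z[t]] that contributes to its square-free part splits and
   contributes exactly two of its three factors. *)

(** * Unique factorization *)

(** The element [m] comes from halving. If [p - theta_i g q^2 = s_i^2] for the three roots, a half
    of [S] has abscissa [(p + s1 s2 + s1 s3 + s2 s3) / q^2]. When [theta_1 = 0], the roots [s2] and
    [s3] may be conjugate, so only [n = s2 s3] and [s2 + s3] have to lie in Q(t), and
    [m = (s2 + s3)^2]. Its cofactor [m - 4n = (s2 - s3)^2] measures the difference of the two roots,
    whence [e^2 d]. The obstacle here is the prime 2: a bad prime dividing both [m] and [m - 4n]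
    divides [q] and then [4p], so coprimality of [p] and [q] leaves 2 alone to be excluded. The
    signs matter because a half reduces to the origin exactly when all [s_i] agree at [t0]: its
    numerator is then [4 p(t0)], and with any other signs it vanishes there. In the cyclic case
    agreement is automatic, since [s1(t0)] is rational and the other two are its conjugates. No
    group law is constructed. A chord formula for the difference of two points and the duplication
    formula suffice. Class number one enters as the Bezout property of [O_K], from which Gauss's
    lemma passes to [O_K[t]]. *)

Section Divides.
Variable A : idomainType.
Implicit Types a b c p r s x y z w : A.

Definition divides a b := exists c, b = a * c.

Definition prime_elt p :=
  [/\ p != 0, p \isn't a GRing.unit &
      forall a b, divides p (a * b) -> divides p a \/ divides p b].

Definition sqfree s := forall p, prime_elt p -> ~ divides (p * p) s.

(* The measure [mu] replaces the number of prime factors. *)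
Definition ufd := exists mu : A -> nat,
  [/\ forall a b, a * b != 0 -> (mu a <= mu (a * b)%R)%N,
      forall a b, a * b != 0 -> b \isn't a GRing.unit -> (mu a < mu (a * b)%R)%N &
      forall a, a != 0 -> a \isn't a GRing.unit ->
        exists2 p, prime_elt p & divides p a].

Lemma divides_refl a : divides a a.
Proof. by exists 1; rewrite mulr1. Qed.

Lemma divides_trans b a c : divides a b -> divides b c -> divides a c.
Proof. by move=> [u ->] [v ->]; exists (u * v); rewrite mulrA. Qed.

Lemma divides_mull a b c : divides a b -> divides a (c * b).
Proof. by move=> [u ->]; exists (c * u); rewrite mulrCA. Qed.

Lemma divides_mulr a b c : divides a b -> divides a (b * c).
Proof. by move=> [u ->]; exists (u * c); rewrite mulrA. Qed.

Lemma divides_add a b c : divides a b -> divides a c -> divides a (b + c).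
Proof. by move=> [u ->] [v ->]; exists (u + v); rewrite mulrDr. Qed.

Lemma divides_sub a b c : divides a b -> divides a c -> divides a (b - c).
Proof. by move=> [u ->] [v ->]; exists (u - v); rewrite mulrBr. Qed.

Lemma divides_pmul2l a b c : a != 0 -> divides (a * b) (a * c) -> divides b c.
Proof. by move=> a0 [u]; rewrite -mulrA => /(mulfI a0) ->; exists u. Qed.

Lemma divides_unit a u : u \is a GRing.unit -> divides a u -> a \is a GRing.unit.
Proof. by move=> uu [c e]; move: uu; rewrite e unitrM => /andP[]. Qed.

Lemma unit_divides u a : u \is a GRing.unit -> divides u a.
Proof. by move=> uu; exists (u^-1 * a); rewrite mulrA divrr // mul1r. Qed.

Lemma prime_exp p a n : prime_elt p -> divides p (a ^+ n) -> divides p a.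
Proof.
move=> pp; elim: n => [|n IH]; last by rewrite exprS => /(let: And3 _ _ P := pp in P)[].
rewrite expr0 => /divides_unit -/(_ (unitr1 _)) pu.
by case: pp => _; rewrite pu.
Qed.

Lemma prime_unit p u : prime_elt p -> u \is a GRing.unit -> ~ divides p u.
Proof. by move=> [_ pu _] uu /(divides_unit uu); rewrite (negPf pu). Qed.

Lemma prime_assoc p r : prime_elt p -> prime_elt r -> divides p r -> divides r p.
Proof.
move=> pp [r0 ru rP] [c e]; have [|[d Hd]|[d Hd]] := rP p c.
- by exists 1; rewrite mulr1.
- by exists d.
have : r * 1 = r * (p * d) by rewrite mulr1 {1}e Hd; ring.
move=> /(mulfI r0) e1; case: pp => _ /negP[]; apply: (divides_unit (unitr1 A)).
by exists d.
Qed.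

Lemma prime_mulN p a b : prime_elt p -> ~ divides p a -> ~ divides p b -> ~ divides p (a * b).
Proof. by move=> [_ _ P] na nb /P[]. Qed.

Lemma sqfree_divides s t : sqfree t -> divides s t -> sqfree s.
Proof. by move=> st d p pp dp; apply: (st p pp); apply: divides_trans dp d. Qed.

Hypothesis ufdA : ufd.

(** Factorizations into primes are never written down: the arguments below peel off one prime at a
    time, and [mu] bounds the recursion. *)
Lemma ufd_ind (P : A -> Prop) :
  (forall u, u \is a GRing.unit -> P u) ->
  (forall p a, prime_elt p -> a != 0 -> P a -> P (p * a)) ->
  forall a, a != 0 -> P a.
Proof.
move=> Hu Hp a; have [mu [_ mu2 mu3]] := ufdA.
have [n] := ubnP (mu a); elim: n a => // n IH a lt a0.
have [/Hu//|nu] := boolP (a \is a GRing.unit).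
have [p pp [c e]] := mu3 _ a0 nu.
have c0 : c != 0 by move: a0; rewrite e mulf_eq0 negb_or => /andP[].
rewrite e; apply: Hp => //; apply: IH => //; rewrite e mulrC in lt a0.
by apply: leq_trans (mu2 _ _ a0 _) _ => //; case: pp.
Qed.

Lemma ufd_prime_divisor a : a != 0 -> a \isn't a GRing.unit ->
  exists2 p, prime_elt p & divides p a.
Proof. by have [mu [_ _]] := ufdA; apply. Qed.

(** A prime of [u] divides [w ^+ 2], hence [w], and cancels on both sides. This is integral
    closedness in the form used throughout: a square root found in the fraction field lies in the
    ring. *)
Lemma sqr_cancel u z w : u != 0 -> u ^+ 2 * z = w ^+ 2 ->
  exists2 v, w = u * v & z = v ^+ 2.
Proof.
move=> u0 E; suff [v e] : exists v, w = u * v.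
  exists v => //; move: E; rewrite e exprMn => /mulfI; apply.
  by rewrite expf_eq0.
elim/ufd_ind: u / u0 w E => [u uu w _|p a pp a0 IH w E].
  by exists (u^-1 * w); rewrite mulrA divrr // mul1r.
have [|w' ew] := @prime_exp p w 2 pp.
  by rewrite -E; exists (p * a ^+ 2 * z); ring.
have p0 : p ^+ 2 != 0 by rewrite expf_eq0; case: pp.
have [|v ev] := IH w'; last by exists v; rewrite ew ev mulrA.
by apply: (mulfI p0); rewrite -exprMn -ew -E; ring.
Qed.

Definition no_common_prime a b := forall p, prime_elt p -> divides p a -> ~ divides p b.

Lemma reduce_common a b : b != 0 ->
  exists c a' b', [/\ a = c * a', b = c * b' & no_common_prime a' b'].
Proof.
move=> b0; elim/ufd_ind: b / b0 a => [u uu a|p b pp b0 IH a].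
  exists 1, a, u; rewrite !mul1r; split=> // p pp _; exact: prime_unit.
have [[a0 ->]|nd] := classic (divides p a).
  have [c [a' [b' [-> -> N]]]] := IH a0.
  by exists (p * c), a', b'; rewrite !mulrA.
have [c [a' [b' [ea -> N]]]] := IH a.
exists c, a', (p * b'); split=> //; first by rewrite mulrCA.
move=> r pr ra rb; have [_ _ /(_ _ _ rb)[rp|]] := pr; last exact: N.
apply: nd; rewrite ea; apply: divides_mull; apply: divides_trans ra.
exact: prime_assoc.
Qed.

(** A new prime joins [s] unless [s] already contains it, in which case the pair moves to [r]. Units
    count as square-free, so the sign of [a] stays in [s]. *)
Lemma sqfree_part a : a != 0 -> exists s r, a = s * r ^+ 2 /\ sqfree s.
Proof.
move=> a0; elim/ufd_ind: a / a0 => [u uu|p a pp a0 [s [r [-> sf]]]].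
  exists u, 1; rewrite expr1n mulr1; split=> // p pp /(divides_trans _) h.
  by apply: (prime_unit pp uu); apply: h; exists p.
have p0 : p != 0 by case: pp.
have [[s' es]|nd] := classic (divides p s).
  exists s', (p * r); split; first by rewrite es; ring.
  by apply: sqfree_divides sf _; exists p; rewrite es mulrC.
exists (p * s), r; split; first by rewrite mulrA.
(* As [s] is square-free, a prime [q] whose square divides [p * s] divides [p]; being associate to
   [p], it would force [p] to divide [s]. *)
move=> q pq [c e]; have [q0 _ qP] := pq.
have qp : divides q p.
  have [|//|[s1 es]] := qP p s; first by rewrite e -mulrA; exists (q * c).
  have [|//|[s2 es2]] := qP p s1.
    exists c; apply: (mulfI q0); rewrite mulrCA -es e; ring.
  by case: (sf q pq); exists s2; rewrite es es2 mulrA.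
have [u eu] := prime_assoc pq pp qp.
apply: nd; apply: (divides_trans (b := q)); first by exists u.
exists (u * c); apply: (mulfI p0); rewrite e {2}eu; ring.
Qed.

Lemma sqfree_dividesP s x : s != 0 -> sqfree s ->
  (forall p, prime_elt p -> divides p s -> divides p x) -> divides s x.
Proof.
move=> s0; elim/ufd_ind: s / s0 x => [u uu x _ _|p s pp s0 IH x sf H].
  exact: unit_divides.
have [|x' ex] := H p pp; first by exists s.
have [||c ec] := IH x'; last by exists c; rewrite ex ec mulrA.
  by apply: sqfree_divides sf _; exists p; rewrite mulrC.
move=> q pq qs; have [|qp|//] := (let: And3 _ _ P := pq in P) p x'.
  by rewrite -ex; apply: H => //; apply: divides_mull.
have [c ec] := divides_trans (prime_assoc pq pp qp) qs.
by case: (sf p pp); exists c; rewrite ec mulrA.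
Qed.

Lemma sqfree_split s x y : s != 0 -> sqfree s ->
  (forall p, prime_elt p -> divides p s -> divides p x \/ divides p y) ->
  exists s1 s2, [/\ s = s1 * s2, divides s1 x & divides s2 y].
Proof.
(* The induction carries divisibility prime by prime; [sqfree_dividesP] then recovers it for [s1]
   and [s2] themselves. *)
move=> s0 sf H; suff [s1 [s2 [e H1 H2]]] : exists s1 s2, [/\ s = s1 * s2,
   forall p, prime_elt p -> divides p s1 -> divides p x &
   forall p, prime_elt p -> divides p s2 -> divides p y].
  have [s10 s20] : s1 != 0 /\ s2 != 0.
    by move: s0; rewrite e mulf_eq0 negb_or => /andP[].
  exists s1, s2; split=> //; apply: sqfree_dividesP => //.
    by apply: sqfree_divides sf _; exists s2.
  by apply: sqfree_divides sf _; exists s1; rewrite mulrC.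
elim/ufd_ind: s / s0 sf H => [u uu _ _|p s pp s0 IH sf H].
  exists u, 1; rewrite mulr1; split=> // p pp /prime_unit; case=> //.
  exact: unitr1.
have [||s1 [s2 [e H1 H2]]] := IH.
- by apply: sqfree_divides sf _; exists p; rewrite mulrC.
- by move=> q pq qs; apply: H => //; apply: divides_mull.
have [|px|py] := H p pp; first by exists s.
- exists (p * s1), s2; split=> //; first by rewrite e mulrA.
  move=> q pq /(let: And3 _ _ P := pq in P)[qp|]; last exact: H1.
  exact: divides_trans qp px.
- exists s1, (p * s2); split=> //; first by rewrite e mulrCA.
  move=> q pq /(let: And3 _ _ P := pq in P)[qp|]; last exact: H2.
  exact: divides_trans qp py.
Qed.

Lemma prime_valuation p a : prime_elt p -> a != 0 ->
  exists k a', a = p ^+ k * a' /\ ~ divides p a'.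
Proof.
move=> pp a0; elim/ufd_ind: a / a0 => [u uu|q a pq a0 [k [a' [-> nd]]]].
  by exists 0%N, u; rewrite mul1r; split=> //; apply: prime_unit.
have [[u eu]|nq] := classic (divides p q); last first.
  by exists k, (q * a'); rewrite mulrCA; split=> //; apply: prime_mulN.
exists k.+1, (u * a'); split; first by rewrite eu exprS; ring.
apply: prime_mulN => // -[c e].
case: (prime_assoc pp pq _) => [|d ed]; first by exists u.
have p0 : p != 0 by case: pp.
have : p * 1 = p * (p * c * d) by rewrite mulr1 {1}ed eu e; ring.
move=> /(mulfI p0) e1; apply: (prime_unit pp (unitr1 A)).
by exists (c * d); rewrite e1; ring.
Qed.

Lemma prime_exp_inj p i j x y : prime_elt p -> ~ divides p x -> ~ divides p y ->
  p ^+ i * x = p ^+ j * y -> i = j.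
Proof.
move=> pp nx ny; have p0 : p != 0 by case: pp.
elim: i j => [|i IH] [|j] //.
- by rewrite expr0 mul1r => e; case: nx; exists (p ^+ j * y); rewrite e exprS mulrA.
- by rewrite expr0 mul1r => e; case: ny; exists (p ^+ i * x); rewrite -e exprS mulrA.
by rewrite !exprS -!mulrA => /(mulfI p0) /IH ->.
Qed.

(** Otherwise [p] has an odd exponent on the left, once from [h] and evenly from [s ^+ 2], and an
    even one on the right. *)
Lemma sqfree_parity p h s k d w : prime_elt p -> sqfree h -> divides p h ->
  s != 0 -> w != 0 -> h * s ^+ 2 * k = d * w ^+ 2 -> divides p k \/ divides p d.
Proof.
move=> pp sf [h' eh] s0 w0 E; apply: NNPP => /not_or_and[nk nd].
have nh : ~ divides p h' by move=> [c ec]; apply: (sf p pp); exists c; rewrite eh ec mulrA.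
have [i [s' [es ns]]] := prime_valuation pp s0.
have [j [w' [ew nw]]] := prime_valuation pp w0.
suff : (i.*2.+1 = j.*2)%N by move/(congr1 odd); rewrite /= !odd_double.
apply: (@prime_exp_inj p _ _ (h' * s' ^+ 2 * k) (d * w' ^+ 2)) => //.
- by do !apply: prime_mulN => //; move/(prime_exp pp).
- by apply: prime_mulN => //; move/(prime_exp pp).
rewrite -!addnn exprS !exprD; transitivity (h * s ^+ 2 * k); first by rewrite eh es; ring.
by rewrite E ew; ring.
Qed.

Lemma sqfree_sqr_divides p h s : prime_elt p -> sqfree h ->
  divides (p * p) (h * s ^+ 2) -> divides p s.
Proof.
move=> pp sf D; have [p0 _ P] := pp.
have [[h' eh]|nh] := classic (divides p h); last first.
  have [|//|/(prime_exp pp)//] := P h (s ^+ 2).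
  by apply: divides_trans D; exists p.
have [|/= |/(prime_exp pp)//] := P h' (s ^+ 2).
  by apply: (@divides_pmul2l p) => //; rewrite mulrA -eh.
by move=> [c ec]; case: (sf p pp); exists c; rewrite eh ec mulrA.
Qed.

End Divides.

(** * Gauss's lemma: polynomial rings over a factorial ring *)

Section UfdPoly.
Variable R : idomainType.
Hypothesis ufdR : ufd R.

Lemma divides_polyC_MX (p : R) (u : {poly R}) :
  divides p%:P (u * 'X) -> divides p%:P u.
Proof.
move=> [c e]; exists (\poly_(i < size c) c`_i.+1).
apply/polyP => i; have := congr1 (fun q : {poly R} => q`_i.+1) e.
rewrite coefMX /= coefCM => ->; rewrite coefCM coef_poly.
case: ltnP => // h; by rewrite nth_default // ltnW.
Qed.

Lemma divides_polyC_cons (p a : R) (u : {poly R}) :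
  divides p a -> divides p%:P u -> divides p%:P (u * 'X + a%:P).
Proof.
move=> [b ->] [v ->]; exists (v * 'X + b%:P).
by rewrite polyCM mulrDr mulrA.
Qed.

(** Induction on the Horner form of both factors: [p] divides one of the constant coefficients, and
    removing that multiple of [p] leaves a product divisible by ['X], to which the induction
    hypothesis applies. *)
Lemma prime_polyC (p : R) : prime_elt p -> prime_elt p%:P.
Proof.
move=> [p0 pu pP]; split; first by rewrite polyC_eq0.
  by rewrite poly_unitE size_polyC p0 /= coefC.
elim/poly_ind => [|u a IHu] v; first by left; exists 0; rewrite mulr0.
elim/poly_ind: v => [|v b IHv]; first by right; exists 0; rewrite mulr0.
move=> D; have [c ec] := D.
have [|[a' ea]|[b' eb]] := pP a b.
- exists c`_0; have := congr1 (fun q : {poly R} => q`_0) ec.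
  by rewrite coefCM coef0M !coefD !coefMX !coefC /= !add0r.
- have [|pu'|pv'] := IHu (v * 'X + b%:P); last by right.
  + apply: divides_polyC_MX; rewrite mulrAC.
    have -> : u * 'X * (v * 'X + b%:P) = (u * 'X + a%:P) * (v * 'X + b%:P)
       - p%:P * (a'%:P * (v * 'X + b%:P)) by rewrite ea polyCM; ring.
    by apply: divides_sub => //; exists (a'%:P * (v * 'X + b%:P)).
  + by left; apply: divides_polyC_cons => //; exists a'.
- have [|pu'|pv'] := IHv.
  + apply: divides_polyC_MX; rewrite -mulrA.
    have -> : (u * 'X + a%:P) * (v * 'X) = (u * 'X + a%:P) * (v * 'X + b%:P)
       - p%:P * (b'%:P * (u * 'X + a%:P)) by rewrite eb polyCM; ring.
    by apply: divides_sub => //; exists (b'%:P * (u * 'X + a%:P)).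
  + by left.
  + by right; apply: divides_polyC_cons => //; exists b'.
Qed.

Definition primitive_elt (f : {poly R}) := forall p, prime_elt p -> ~ divides p%:P f.

(** Turns pseudo-division into division: each prime of [c] divides [f * w] but not [f], so by
    [prime_polyC] it divides [w] and cancels. *)
Lemma primitive_divides (f v w : {poly R}) (c : R) : primitive_elt f -> c != 0 ->
  c *: v = f * w -> divides f v.
Proof.
move=> pf c0; elim/ufd_ind: c / c0 w => // [u uu|p c pp c0 IH] w E.
  by exists (u^-1 *: w); rewrite -scalerAr -E scalerA mulVr // scale1r.
have [_ _ /(_ f w)[|/(pf p pp)//|[w' ew]]] := prime_polyC pp.
  by exists (c *: v); rewrite -E -scalerA mul_polyC.
apply: (IH w'); have p0 : p%:P != 0 by rewrite polyC_eq0; case: pp.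
apply: (mulfI p0).
by rewrite mul_polyC scalerA E ew mulrCA.
Qed.

Lemma primitive_part (f : {poly R}) : f != 0 ->
  exists c f0, [/\ c != 0, f = c *: f0 & primitive_elt f0].
Proof.
have [mu [_ mu2 _]] := ufdR.
have [n] := ubnP (mu (lead_coef f)); elim: n f => // n IH f lt f0.
have [[p [pp [f1 e]]]|N] := classic (exists p, prime_elt p /\ divides p%:P f); last first.
  by exists 1, f; rewrite scale1r oner_neq0; split=> // p pp d; apply: N; exists p.
have f10 : f1 != 0 by move: f0; rewrite e mulf_eq0 negb_or => /andP[].
have [p0 pu _] := pp.
have [|//|c [f2 [c0 e2 P]]] := IH f1.
  move: lt; rewrite e lead_coefM lead_coefC mulrC ltnS; apply: leq_trans; apply: mu2 => //.
  by rewrite mulf_neq0 // lead_coef_eq0.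
exists (p * c), f2; split=> //; first by rewrite mulf_neq0.
by rewrite e e2 mul_polyC scalerA.
Qed.

(** A nonconstant factor that admits no smaller one is prime: the primitive part of its gcd with [u]
    is either constant, so that it divides the other factor [v], or of full size, so that it divides
    [u]. *)
Lemma primitive_prime_divisor (f : {poly R}) : f != 0 -> primitive_elt f ->
  (1 < size f)%N -> exists2 p, prime_elt p & divides p f.
Proof.
have [n] := ubnP (size f); elim: n f => // n IH f lt f0 pf sf.
have [[g [h [e sg1 sg2]]]|N] := classic (exists g h, [/\ f = g * h, (1 < size g)%N &
  (size g < size f)%N]).
  have g0 : g != 0 by move: f0; rewrite e mulf_eq0 negb_or => /andP[].
  have [||//|//|p pp pg] := IH g.
  - by apply: leq_trans sg2 _.
  - exact: g0.
  - by move=> p pp d; apply: (pf p pp); rewrite e; apply: divides_mulr.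
  by exists p => //; rewrite e; apply: divides_mulr.
exists f; last exact: divides_refl.
split=> //; first by rewrite poly_unitE (gtn_eqF sf).
have pd x : f %| x -> divides f x.
  move=> /Pdiv.Idomain.dvdpP [[c w] /= c0 E]; apply: (primitive_divides pf c0 (w := w)).
  by rewrite E mulrC.
move=> u v [w ew]; have fuv : f %| u * v by rewrite ew dvdp_mulr.
have d0 : gcdp f u != 0 by rewrite gcdp_eq0 negb_and f0.
have [c [d [c0 ed pd0]]] := primitive_part d0.
have df : divides d f.
  have /Pdiv.Idomain.dvdpP [[k w'] /= k0 E] := dvdp_gcdl f u.
  apply: (primitive_divides pd0 k0 (w := c *: w')).
  by rewrite E ed -!scalerAr mulrC.
have sd : size (gcdp f u) = size d by rewrite ed size_scale.
have [h eh] := df; have dn0 : d != 0 by move: f0; rewrite eh mulf_eq0 negb_or => /andP[].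
have ledf : (size d <= size f)%N by rewrite -sd dvdp_leq // dvdp_gcdl.
have [lt1|le1] := ltnP 1 (size d); last first.
  right; apply: pd; move: fuv; rewrite Gauss_dvdpr // /coprimep sd.
  by rewrite eqn_leq le1 lt0n size_poly_eq0.
left; apply: pd; have : size d = size f.
  apply/eqP; rewrite eqn_leq ledf leqNgt; apply/negP => lt2; apply: N.
  by exists d, h.
move/eqP; rewrite -sd dvdp_size_eqp ?dvdp_gcdl // => /eqp_dvdl <-.
exact: dvdp_gcdr.
Qed.

Lemma ufd_poly : ufd {poly R}.
Proof.
have [mu [mu1 mu2 mu3]] := ufdR.
(* A nonunit factor raises the size, or is constant and raises the measure of the leading
   coefficient. *)
exists (fun f : {poly R} => size f + mu (lead_coef f))%N; split.
- move=> a b ab; have [a0 b0] : a != 0 /\ b != 0 by move: ab; rewrite mulf_eq0 negb_or => /andP[].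
  apply: leq_add; last by rewrite lead_coefM mu1 // -lead_coefM lead_coef_eq0.
  rewrite size_mul //; move: (size_poly_eq0 b); rewrite (negPf b0).
  by case: (size b) => // k _; rewrite addnS leq_addr.
- move=> a b ab; have [a0 b0] : a != 0 /\ b != 0 by move: ab; rewrite mulf_eq0 negb_or => /andP[].
  have l0 : lead_coef a * lead_coef b != 0 by rewrite -lead_coefM lead_coef_eq0.
  rewrite poly_unitE size_mul // lead_coefM; move: (size_poly_eq0 b); rewrite (negPf b0).
  case E: (size b) => [|[|k]] //= _ nu.
    rewrite addn1 /= ltn_add2l; apply: mu2 => //.
    by rewrite lead_coefE E.
  by rewrite !addnS /= -addSn leq_add ?mu1 // ltnS leq_addr.
move=> f f0 nu; have [[p [pp d]]|N] := classic (exists p, prime_elt p /\ divides p%:P f).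
  by exists p%:P => //; apply: prime_polyC.
have pf : primitive_elt f by move=> p pp d; apply: N; exists p.
apply: primitive_prime_divisor => //; rewrite ltnNge; apply/negP => /size1_polyC e.
have c0 : f`_0 != 0 by apply: contra f0; rewrite {2}e => /eqP ->.
have [|p pp [c ec]] := mu3 _ c0; last by apply: (pf p pp); exists c%:P; rewrite e ec polyCM.
by move: nu; rewrite poly_unitE {1}e size_polyC c0.
Qed.

End UfdPoly.

Lemma dividesz (m n : int) : (m %| n)%Z <-> divides m n.
Proof.
split; first by move/dvdzP => [q ->]; exists q; rewrite mulrC.
by move=> [q ->]; apply: dvdz_mulr.
Qed.

Lemma ufd_int : ufd int.
Proof.
exists absz; split=> [a b ab|a b ab nb|a a0 nu].
- by rewrite abszM; move: ab; rewrite -absz_gt0 abszM muln_gt0 => /andP[_ h]; exact: leq_pmulr.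
- move: ab; rewrite -absz_gt0 abszM muln_gt0 => /andP[ha h].
  rewrite -[X in (X < _)%N]muln1 ltn_pmul2l // ltn_neqAle h andbT eq_sym.
  by apply: contra nb; case: b h => [[|[|]]|[|]].
have a1 : (1 < `|a|)%N.
  by rewrite ltn_neqAle eq_sym absz_gt0 a0 andbT; apply: contra nu; case: (a) => [[|[|]]|[|]].
exists (pdiv `|a| : int); last by apply/dividesz; rewrite dvdzE /= pdiv_dvd.
have pp := pdiv_prime a1; split.
- by rewrite -absz_gt0 /= prime_gt0.
- by case: (pdiv _) pp => [|[|[]]].
move=> x y /dividesz; rewrite dvdzE /= abszM Euclid_dvdM // => /orP[h|h];
  [left|right]; by apply/dividesz; rewrite dvdzE.
Qed.


(** * Halving with one rational root *)

Definition ufd_Zt : ufd {poly int} := ufd_poly ufd_int.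

Lemma unitZtP (p : {poly int}) : p \is a GRing.unit <-> unitZt p.
Proof.
split; last by case=> ->; rewrite ?unitrN unitr1.
rewrite poly_unitE => /andP[/eqP s u].
have [e|e] : p`_0 = 1 \/ p`_0 = -1.
  by move: u; rewrite /GRing.unit /= => /orP[/eqP|/eqP]; [left|right].
- by left; rewrite (size1_polyC (p := p)) ?s // e.
- by right; rewrite (size1_polyC (p := p)) ?s // e polyCN.
Qed.

Lemma sqfreeZtP (h : {poly int}) : h != 0 -> sqfree h -> sqfreeZt h.
Proof.
move=> h0 sf; split; first exact/eqP.
move=> p D; apply/unitZtP; apply: contraT => nu.
have p0 : p != 0.
  by apply: contraNneq h0 => p0; case: D => r ->; rewrite p0 !mul0r.
have [q pq [c ec]] := ufd_prime_divisor ufd_Zt p0 nu.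
case: (sf q pq); apply: divides_trans D; exists (c * c); rewrite ec; ring.
Qed.

Lemma int_rat_sqr (c : int) (r : rat) : r ^+ 2 = c%:~R -> exists k : int, c = k ^+ 2.
Proof.
move=> E; have d0 : denq r != 0 by rewrite denq_eq0.
have [|v _ ->] := @sqr_cancel _ ufd_int (denq r) c (numq r) d0; last by exists v.
apply: (@intr_inj rat); rewrite rmorphM !rmorphXn /= -E -exprMn numqE.
by rewrite mulrC.
Qed.

Lemma two_prime : prime_elt (2 : {poly int}).
Proof.
have -> : (2 : {poly int}) = (2 : int)%:P by rewrite -polyC_natr.
apply: prime_polyC; split=> // x y /dividesz; rewrite dvdzE abszM Euclid_dvdM // => /orP[h|h];
  [left|right]; by apply/dividesz; rewrite dvdzE.
Qed.

Section EvalConst.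
Variable ev : {rmorphism {poly int} -> rat}.

Lemma ev_polyC (c : int) : ev c%:P = c%:~R.
Proof.
have -> : c%:P = c%:~R :> {poly int} by rewrite -{1}[c]intz rmorph_int.
exact: rmorph_int.
Qed.

(** Once a square-free part is known to be constant, its value at [t0] settles the sign and the
    remaining integer factor as well. *)
Lemma const_sqr (h : {poly int}) : (size h <= 1)%N -> is_square_Q (ev h) ->
  exists k : int, h = (k%:P) ^+ 2.
Proof.
move=> /size1_polyC -> [r]; rewrite ev_polyC => /int_rat_sqr [k ->].
by exists k; rewrite rmorphXn.
Qed.

Lemma sqr_sign (x y : {poly int}) : ev x ^+ 2 = ev y ^+ 2 ->
  exists2 x', x' ^+ 2 = x ^+ 2 & ev x' = ev y.
Proof.
move=> /eqP; rewrite eqf_sqr => /orP[/eqP e|/eqP e]; first by exists x.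
by exists (- x); rewrite ?sqrrN // rmorphN e opprK.
Qed.

End EvalConst.

(** By parity, a prime of [h] outside [d] and [e g] divides [mm], hence [q], and then [4 p] since
    [m + mm = 4 p + 2 A]; not dividing [p], it can only be 2. In that case 4 divides [m] and [mm],
    and parity applied to the quotients makes their difference [n] even, whereas [n] is odd because
    [p] is. *)
Lemma sqfree_m_primes (a d e : int) (g p q n m mm h s pi : {poly int}) :
  let A := a%:P * g * q ^+ 2 in
  e != 0 -> d != 0 -> g != 0 -> q != 0 -> no_common_prime p q ->
  (exists B', n ^+ 2 = p ^+ 2 + A * p + B' * q ^+ 2) ->
  m = 2 * p + A + 2 * n -> mm = 2 * p + A - 2 * n ->
  m * mm = d%:P * (e%:P * g * q ^+ 2) ^+ 2 ->
  m = h * s ^+ 2 -> sqfree h -> s != 0 -> prime_elt pi -> divides pi h ->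
  divides pi d%:P \/ divides pi (e%:P * g).
Proof.
move=> A e0 d0 g0 q0 cop [B' en] em emm E es sf s0 pp ph.
apply: NNPP => /not_or_and[nd neg].
have W0 : e%:P * g * q ^+ 2 != 0 by rewrite !mulf_neq0 // ?polyC_eq0 // expf_eq0.
have pm : divides pi m by rewrite es; apply: divides_mulr.
have pmm : divides pi mm.
  have [|//|//] := sqfree_parity ufd_Zt (k := mm) (d := d%:P) pp sf ph s0 W0.
  by rewrite -es.
have pq : divides pi q.
  have : divides pi (m * mm) by apply: divides_mulr.
  have [_ _ P] := pp.
  by rewrite E => /P[//|] /(prime_exp pp) /P[//|] /(prime_exp pp).
have p2 : divides pi 2.
  have [_ _ P] := pp; have : divides pi (2 ^+ 2 * p).
    have -> : 2 ^+ 2 * p = m + mm - 2 * (a%:P * g * q) * q by rewrite em emm /A; ring.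
    by apply: divides_sub; [apply: divides_add|apply: divides_mull].
  by move=> /P[/(prime_exp pp)//|pip]; case: (cop pi pp pip).
have t2 := prime_assoc pp two_prime p2.
have tp := two_prime; have [t0 _ T] := tp.
have nd2 : ~ divides 2 d%:P by move=> h2; apply: nd; apply: divides_trans h2.
have neg2 : ~ divides 2 (e%:P * g) by move=> h2; apply: neg; apply: divides_trans h2.
have th : divides 2 h by apply: divides_trans ph.
have [q' eq'] : divides 2 q by apply: divides_trans pq.
have np : ~ divides 2 p by move=> h2; apply: (cop 2 tp h2); exists q'.
have nn : ~ divides 2 n.
  move=> h2; apply: np; apply: (@prime_exp _ 2 p 2 tp).
  have -> : p ^+ 2 = n * n - 2 * (a%:P * g * q' * q * p + B' * q' * q).
    by rewrite -expr2 en /A eq'; ring.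
  by apply: divides_sub; [apply: divides_mull|exists (a%:P * g * q' * q * p + B' * q' * q)].
(* With [q = 2 * q'], these are the halves of [m] and [mm]. Their product is even and their
   difference is [2 * n], so both are even. *)
pose l1 := p + 2 * (a%:P * g * q' ^+ 2) + n.
pose l2 := p + 2 * (a%:P * g * q' ^+ 2) - n.
have el1 : m = 2 * l1 by rewrite em /A /l1 eq'; ring.
have el2 : mm = 2 * l2 by rewrite emm /A /l2 eq'; ring.
have e12 : l1 * l2 = d%:P * (2 * (e%:P * g * q' ^+ 2)) ^+ 2.
  apply: (mulfI t0); apply: (mulfI t0).
  have -> : 2 * (2 * (l1 * l2)) = (2 * l1) * (2 * l2) by ring.
  by rewrite -el1 -el2 E eq'; ring.
have ed : l1 - l2 = 2 * n by rewrite /l1 /l2; ring.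
have [[k1 ek1] [k2 ek2]] : divides 2 l1 /\ divides 2 l2.
  have [|D|D] := T l1 l2.
  - by rewrite e12; exists (2 * d%:P * (e%:P * g * q' ^+ 2) ^+ 2); ring.
  - split=> //; have -> : l2 = l1 - 2 * n by rewrite -ed; ring.
    by apply: divides_sub => //; exists n.
  - split=> //; have -> : l1 = l2 + 2 * n by rewrite -ed; ring.
    by apply: divides_add => //; exists n.
have ekn : k1 - k2 = n by apply: (mulfI t0); rewrite -ed ek1 ek2; ring.
have ek : k1 * k2 = d%:P * (e%:P * g * q' ^+ 2) ^+ 2.
  apply: (mulfI t0); apply: (mulfI t0).
  have -> : 2 * (2 * (k1 * k2)) = (2 * k1) * (2 * k2) by ring.
  by rewrite -ek1 -ek2 e12; ring.
(* Since 4 divides [h * s ^+ 2] with [h] square-free, [s] is even, and [m / 4] is again [h] times a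
   square. *)
have [s' es'] : divides 2 s.
  apply: (@sqfree_sqr_divides _ 2 h s tp sf); exists k1; rewrite -es el1 ek1; ring.
have ek1' : k1 = h * s' ^+ 2.
  by apply: (mulfI t0); apply: (mulfI t0); rewrite -ek1 -el1 es es'; ring.
have s'0 : s' != 0 by apply: contraNneq s0 => z; rewrite es' z mulr0.
have q'0 : q' != 0 by apply: contraNneq q0 => z; rewrite eq' z mulr0.
have [||D2|//] := sqfree_parity ufd_Zt (k := k2) (d := d%:P) (w := e%:P * g * q' ^+ 2) tp sf th s'0.
- by rewrite !mulf_neq0 // ?polyC_eq0 // expf_eq0.
- by rewrite -ek1'.
by apply: nn; rewrite -ekn; apply: divides_sub => //; rewrite ek1'; apply: divides_mulr.
Qed.

(** The first condition on [t0] is spent on the square-free part of [p], the second on that of [m];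
    in the latter, [d'] collects the primes coming from [d]. *)
Lemma halving_two_torsion (ev : {rmorphism {poly int} -> rat}) (a b d e : int)
    (g p q z : {poly int}) :
  let A := a%:P * g * q ^+ 2 in
  let B := b%:P * g ^+ 2 * q ^+ 4 in
  e != 0 -> sqfreeZ d -> g != 0 -> q != 0 -> no_common_prime p q ->
  a ^+ 2 - 4 * b = e ^+ 2 * d ->
  (forall h : {poly int}, (1 < size h)%N -> sqfreeZt h -> dvdZt h (b%:P * g) ->
     ~ is_square_Q (ev h)) ->
  (forall h : {poly int}, (1 < size h)%N -> sqfreeZt h -> dvdZt h (e%:P * g) ->
     forall d' : int, sqfreeZ d' -> (d' %| d)%Z -> ~ is_square_Q (d'%:~R * ev h)) ->
  ev q = 0 -> ev p != 0 -> z ^+ 2 = p ^+ 3 + A * p ^+ 2 + B * p ->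
  exists p1 z1, [/\ ev p1 != 0, z1 ^+ 2 = p1 ^+ 3 + A * p1 ^+ 2 + B * p1 &
    4 * z1 ^+ 2 * p = (p1 ^+ 2 - B) ^+ 2].
Proof.
move=> A B e0 sfd g0 q0 cop Hd A1 A2 evq evp Ez.
have d0 : d != 0 by case: sfd => /eqP.
have evA : ev A = 0 by rewrite /A rmorphM rmorphXn /= evq expr0n mulr0.
have evB : ev B = 0 by rewrite /B rmorphM (rmorphXn _ _ q) /= evq expr0n mulr0.
have p0 : p != 0 by apply: contraNneq evp => ->; rewrite rmorph0.
pose M := p ^+ 2 + A * p + B.
have EM : z ^+ 2 = p * M by rewrite Ez /M; ring.
have evl u x y : ev u = 0 -> ev (x + u * y) = ev x.
  by move=> e1; rewrite rmorphD rmorphM /= e1 mul0r addr0.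
have evz : ev z ^+ 2 = ev p ^+ 3.
  by rewrite -rmorphXn Ez !evl // rmorphXn.
have [h [r [ep sf]]] := sqfree_part ufd_Zt p0.
have [h0 r0] : h != 0 /\ r != 0.
  by move: p0; rewrite ep mulf_eq0 expf_eq0 negb_or => /andP[].
have [z' ez' hM] : exists2 z', z = r * z' & h * M = z' ^+ 2.
  by apply: (sqr_cancel ufd_Zt r0); rewrite EM [in RHS]ep; ring.
(* A prime of [h] divides [z'], so its square divides [h * M] and it divides [M], hence [B].
   Dividing [p], it cannot divide [q]. *)
have hbg : divides h (b%:P * g).
  apply: (sqfree_dividesP ufd_Zt h0 sf) => pi pp ph; have [_ _ P] := pp.
  have pip : divides pi p by rewrite ep; apply: divides_mulr.
  have piM : divides pi M.
    have [h' eh] := ph; have pi0 : pi != 0 by case: pp.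
    have [c ec] : divides pi z'.
      by apply: (@prime_exp _ pi z' 2 pp); rewrite -hM; apply: divides_mulr.
    have : divides pi (h' * M).
      by exists (c ^+ 2); apply: (mulfI pi0); rewrite mulrA -eh hM ec; ring.
    move=> /P[[h'' eh'']|//]; case: (sf pi pp); exists h''; rewrite eh eh''; ring.
  have : divides pi B.
    have -> : B = M - (p + A) * p by rewrite /M; ring.
    by apply: divides_sub => //; apply: divides_mull.
  have nq : ~ divides pi q by apply: cop.
  move=> /P[/P[h1|/(prime_exp pp) h1]|/(prime_exp pp)//].
  - exact: divides_mulr.
  - exact: divides_mull.
have evr : ev r != 0.
  by apply: contraNneq evp => evr; rewrite ep rmorphM rmorphXn /= evr expr0n mulr0.
(* Since [q] vanishes at [t0], the equation there reads [z ^+ 2 = p ^+ 3], so [p] takes the square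
   value [(z / p) ^+ 2]. *)
have evh : is_square_Q (ev h).
  exists (ev z / (ev p * ev r)); rewrite exprMn evz exprVn exprMn.
  have e1 : ev p = ev h * ev r ^+ 2 by rewrite {1}ep rmorphM rmorphXn.
  have -> : ev p ^+ 3 = ev p ^+ 2 * (ev h * ev r ^+ 2) by rewrite -e1; ring.
  by field; rewrite evp evr.
have [k ek] : exists k : int, h = (k%:P) ^+ 2.
  apply: (const_sqr (ev := ev) _ evh); rewrite leqNgt; apply/negP => sh.
  exact: (A1 h sh (sqfreeZtP h0 sf) hbg).
have k0 : k%:P != 0 :> {poly int} by apply: contraNneq h0 => e1; rewrite ek e1 expr0n.
have [n0 _ en0] : exists2 n0, z' = k%:P * n0 & M = n0 ^+ 2.
  by apply: (sqr_cancel ufd_Zt k0); rewrite -ek.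
have [rho erho] : exists rho, p = rho ^+ 2 by exists (k%:P * r); rewrite ep ek; ring.
have evM : ev M = ev p ^+ 2.
  by rewrite /M rmorphD /= evB addr0 evl // rmorphXn.
(* With the opposite sign of [n], the element [m] would vanish at [t0]. *)
have [n en evn] : exists2 n, n ^+ 2 = n0 ^+ 2 & ev n = ev p.
  by apply: sqr_sign; rewrite -evM en0 rmorphXn.
rewrite -en0 in en.
pose m := 2 * p + A + 2 * n; pose mm := 2 * p + A - 2 * n.
have Emm : m * mm = d%:P * (e%:P * g * q ^+ 2) ^+ 2.
  have Hd' : (a%:P) ^+ 2 - 4 * b%:P = (e%:P) ^+ 2 * d%:P :> {poly int}.
    rewrite -[4]polyC_natr -!rmorphXn -!rmorphM /= -rmorphB /=; congr _%:P.
    by rewrite -Hd.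
  have -> : m * mm = (2 * p + A) ^+ 2 - 4 * n ^+ 2 by rewrite /m /mm; ring.
  have -> : d%:P * (e%:P * g * q ^+ 2) ^+ 2 = (e%:P) ^+ 2 * d%:P * g ^+ 2 * q ^+ 4 by ring.
  by rewrite en -Hd' /M /A /B; ring.
have evm : ev m = (2 * ev rho) ^+ 2.
  rewrite /m rmorphD [ev (_ + A)]rmorphD evA addr0 !rmorphM /= evn erho rmorphXn /=.
  by rewrite !rmorph_nat; ring.
have evrho : ev rho != 0.
  by apply: contraNneq evp => e1; rewrite erho rmorphXn /= e1 expr0n.
have m0 : m != 0.
  apply: contraNneq evrho => m0; move/eqP: evm.
  by rewrite m0 rmorph0 eq_sym expf_eq0 /= mulf_eq0.
have [h' [s [em sf']]] := sqfree_part ufd_Zt m0.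
have [h'0 s0] : h' != 0 /\ s != 0.
  by move: m0; rewrite em mulf_eq0 expf_eq0 negb_or => /andP[].
have [d1 [h1 [eh' dd1 dh1]]] : exists d1 h1, [/\ h' = d1 * h1, divides d1 d%:P & divides h1 (e%:P * g)].
  apply: (sqfree_split ufd_Zt h'0 sf') => pi pp ph.
  apply: (sqfree_m_primes e0 d0 g0 q0 cop _ erefl erefl Emm em sf' s0 pp ph).
  by exists (b%:P * g ^+ 2 * q ^+ 2); rewrite en /M /A /B; ring.
have [d10 h10] : d1 != 0 /\ h1 != 0.
  by move: h'0; rewrite eh' mulf_eq0 negb_or => /andP[].
have [d' ed'] : exists d' : int, d1 = d'%:P.
  exists d1`_0; apply: size1_polyC; have [c ec] := dd1.
  have c0 : c != 0.
    apply: contraNneq d0 => c0; move: ec; rewrite c0 mulr0 => /eqP.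
    by rewrite polyC_eq0.
  have := congr1 (fun x : {poly int} => size x) ec.
  rewrite size_mul // size_polyC d0; move: (size_poly_eq0 c); rewrite (negPf c0).
  by case: (size c) => // l _; rewrite addnS /=; case: (size d1) => [|[|l']].
have dvd' : (d' %| d)%Z.
  case: dd1 => c ec; apply/dividesz; exists c`_0.
  have := congr1 (fun x : {poly int} => x`_0) ec.
  by rewrite ed' coefCM coefC.
have sfd' : sqfreeZ d'.
  split; first by apply/eqP; apply: contraNneq d10; rewrite ed' => ->.
  by move=> l dl; case: sfd => _; apply; apply: dvdz_trans dvd'.
have evs : ev s != 0.
  apply: contraNneq evrho => e1; move/eqP: evm.
  by rewrite em rmorphM rmorphXn /= e1 expr0n mulr0 eq_sym expf_eq0 /= mulf_eq0.
have evh' : is_square_Q (ev h').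
  exists (2 * ev rho / ev s); rewrite exprMn -evm exprVn em rmorphM rmorphXn /=.
  by field.
have [k' ek'] : exists k' : int, h' = (k'%:P) ^+ 2.
  apply: (const_sqr (ev := ev) _ evh'); rewrite leqNgt; apply/negP => sh.
  have sh1 : (1 < size h1)%N by move: sh; rewrite eh' ed' mul_polyC size_scale // -(polyC_eq0 d') -ed'.
  apply: (A2 h1 sh1 _ dh1 d' sfd' dvd').
    by apply: sqfreeZtP => //; apply: sqfree_divides sf' _; exists d1; rewrite eh' mulrC.
  by rewrite -(ev_polyC ev) -ed' -rmorphM -eh'.
have [w ew evw] : exists2 w, w ^+ 2 = (k'%:P * s) ^+ 2 & ev w = ev (2 * rho).
  apply: sqr_sign; rewrite rmorphM [in RHS]rmorphM rmorph_nat -evm em ek'.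
  by rewrite -exprMn rmorphXn rmorphM.
have {}ew : w ^+ 2 = 2 * rho ^+ 2 + A + 2 * n by rewrite ew exprMn -ek' -em /m erho.
have {}en : n ^+ 2 = rho ^+ 4 + A * rho ^+ 2 + B by rewrite en /M erho; ring.
(* The halving formula with [s1 = rho], [s2 + s3 = w] and [s2 * s3 = n]; its ordinate
   [(s1 + s2) * (s1 + s3) * (s2 + s3)] is [(p + n + rho * w) * w]. *)
exists (p + rho * w + n), ((p + rho * w + n) * w).
have eA : A = w ^+ 2 - 2 * rho ^+ 2 - 2 * n by rewrite ew; ring.
have eB : B = n ^+ 2 - rho ^+ 4 - A * rho ^+ 2 by rewrite en; ring.
split; last 1 first.
- by rewrite eB eA erho; ring.
- have -> : ev (p + rho * w + n) = 4 * ev p.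
    by rewrite !rmorphD !rmorphM /= evw evn rmorphM rmorph_nat erho rmorphXn /=; ring.
  by rewrite mulf_neq0.
- by rewrite eB eA erho; ring.
Qed.


(** * Elements of square norm in a cyclic cubic extension *)

Section CyclicNorm.
(** To be applied with [A] the ring [O_K[t]], [B] the ring Z[t], [j] the inclusion and [tau] a
    Galois generator acting on coefficients. *)
Variables (A B : idomainType) (j : {rmorphism B -> A}) (tau : {rmorphism A -> A}).
Hypotheses (ufdA : ufd A) (tau3 : forall x, tau (tau (tau x)) = x).
Hypotheses (j_inj : injective j) (tau_j : forall b, tau (j b) = j b).
Hypothesis tau_fixed : forall x, tau x = x -> exists b, x = j b.

Definition cnorm x := x * tau x * tau (tau x).

Definition associate (x y : A) := exists2 u, u \is a GRing.unit & x = u * y.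

Definition choose_conj (s : 'I_4) (x : A) : A :=
  match val s with
  | 0 => 1
  | 1 => x * tau x
  | 2 => x * tau (tau x)
  | _ => tau x * tau (tau x)
  end.

Lemma cnormM x y : cnorm (x * y) = cnorm x * cnorm y.
Proof. by rewrite /cnorm !rmorphM /=; ring. Qed.

Lemma tau_cnorm x : tau (cnorm x) = cnorm x.
Proof. by rewrite /cnorm !rmorphM /= tau3; ring. Qed.

Lemma cnorm_tau x : cnorm (tau x) = cnorm x.
Proof. by rewrite /cnorm tau3; ring. Qed.

Lemma tau_inj : injective tau.
Proof. by move=> x y e; rewrite -(tau3 x) e tau3. Qed.

Lemma tau_eq0 x : (tau x == 0) = (x == 0).
Proof. by rewrite -[RHS](inj_eq tau_inj) rmorph0. Qed.

Lemma cnorm_eq0 x : (cnorm x == 0) = (x == 0).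
Proof. by rewrite /cnorm !mulf_eq0 !tau_eq0 !orbb. Qed.

Lemma divides_tau x y : divides x y -> divides (tau x) (tau y).
Proof. by move=> [c ->]; exists (tau c); rewrite rmorphM. Qed.

Lemma divides_tauV x y : divides (tau x) (tau y) -> divides x y.
Proof. by move=> /divides_tau /divides_tau; rewrite !tau3. Qed.

Lemma unit_tauV x : tau x \is a GRing.unit -> x \is a GRing.unit.
Proof. by move=> h; rewrite -(tau3 x); do 2 apply: rmorph_unit. Qed.

Lemma prime_tau p : prime_elt p -> prime_elt (tau p).
Proof.
move=> [p0 pu pP]; split; first by rewrite tau_eq0.
  by apply: contra pu; apply: unit_tauV.
move=> a b /divides_tau /divides_tau; rewrite tau3 !rmorphM => /pP[] h; [left|right];
  by apply: divides_tauV; apply: divides_tauV; rewrite tau3.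
Qed.

Lemma sqfree_tau x : sqfree x -> sqfree (tau x).
Proof.
move=> sx p pp /divides_tau /divides_tau; rewrite tau3 !rmorphM /=.
by apply: sx; do 2 apply: prime_tau.
Qed.

Lemma assoc_divides p q : prime_elt p -> prime_elt q -> divides p q -> associate p q.
Proof.
move=> pp pq d; have [c ec] := prime_assoc pp pq d; have [c' ec'] := d.
exists c; last by rewrite mulrC.
have q0 : q != 0 by case: pq.
apply: (@divides_unit _ c 1) (unitr1 _) _; exists c'.
by apply: (mulfI q0); rewrite mulr1 mulrA -ec.
Qed.

Lemma nassoc_tau p q : prime_elt p -> ~ associate p (tau p) ->
  q \in [:: p; tau p; tau (tau p)] -> ~ divides (tau q) q /\ ~ divides q (tau q).
Proof.
move=> pp na qin; have key : ~ divides p (tau p).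
  by move=> d; apply: na; apply: assoc_divides => //; apply: prime_tau.
have key2 : ~ divides (tau p) p.
  by move=> d; apply: key; apply: (prime_assoc (prime_tau pp)).
move: qin; rewrite !inE => /or3P[] /eqP -> //; split;
  do ?[move/divides_tauV] => //; by move/divides_tauV.
Qed.

(** [j x] is fixed by [tau], so all three conjugates of [p] divide it; as pairwise non-associate
    primes they do so jointly. *)
Lemma cnorm_divides p x : prime_elt p -> ~ associate p (tau p) ->
  divides p (j x) -> divides (cnorm p) (j x).
Proof.
move=> pp na [c ec].
have p1 := prime_tau pp; have p2 := prime_tau p1.
have [|n1 m1] := nassoc_tau (q := p) pp na; first by rewrite inE eqxx.
have [|n2 m2] := nassoc_tau (q := tau p) pp na; first by rewrite !inE eqxx orbT.
have [|n3 m3] := nassoc_tau (q := tau (tau p)) pp na; first by rewrite !inE eqxx !orbT.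
rewrite tau3 in n3 m3.
have d : divides p (j x) by exists c.
have d1 : divides (tau p) (j x) by rewrite -tau_j; apply: divides_tau.
have d2 : divides (tau (tau p)) (j x) by rewrite -(tau_j x) -(tau_j x); do 2 apply: divides_tau.
have [_ _ P1] := p1; have [_ _ P2] := p2.
rewrite ec in d1 d2.
have [//|[c1 e1]] := P1 _ _ d1.
have [//|d2'] := P2 _ _ d2; rewrite e1 in d2'.
have [//|[c2 e2]] := P2 _ _ d2'.
by exists c2; rewrite ec e1 e2 /cnorm !mulrA.
Qed.

(** The quotient is fixed by [tau], hence comes from [B]. *)
Lemma cnorm_dividesj h x : h != 0 -> divides (j h) (j x) -> divides h x.
Proof.
move=> h0 [c ec]; have jh0 : j h != 0 by rewrite -(rmorph0 j) (inj_eq j_inj).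
have [|c' ec'] := @tau_fixed c.
  by apply: (mulfI jh0); rewrite -ec -{1}(tau_j h) -rmorphM -ec tau_j.
by exists c'; apply: j_inj; rewrite ec ec' rmorphM.
Qed.

Definition irreducible_elt (h : B) := [/\ h != 0, h \isn't a GRing.unit &
  forall q r, h = q * r -> q \is a GRing.unit \/ r \is a GRing.unit].

(** In a factorization of [h], the prime [p] divides one factor; then [h] divides that factor
    already in [B], and the other one is a unit. *)
Lemma cnorm_prime p h : prime_elt p -> ~ associate p (tau p) -> j h = cnorm p ->
  irreducible_elt h /\ forall x, divides p (j x) -> divides h x.
Proof.
move=> pp na eh; have [p0 pu pP] := pp.
have h0 : h != 0 by rewrite -(inj_eq j_inj) rmorph0 eh cnorm_eq0.
have H x : divides p (j x) -> divides h x.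
  by move=> d; apply: cnorm_dividesj => //; rewrite eh; apply: cnorm_divides.
split=> //; split=> //.
  apply: contra pu => /(rmorph_unit j) hu; apply: (divides_unit hu); rewrite eh.
  by exists (tau p * tau (tau p)); rewrite mulrA.
have K q r : h = q * r -> divides p (j q) -> r \is a GRing.unit.
  move=> e /H [c ec]; apply: (@divides_unit _ r 1) (unitr1 _) _; exists c.
  by apply: (mulfI h0); rewrite mulr1 {1}e ec; ring.
move=> q r e; have [|d|d] := pP (j q) (j r).
- by rewrite -rmorphM -e eh; exists (tau p * tau (tau p)); rewrite mulrA.
- by right; apply: K e d.
- by left; apply: (K r q) => //; rewrite mulrC.
Qed.

(* If [p] divides all three conjugates, it does so exactly once each, so its
   exponent in the norm is 3. *)
Lemma no_triple p x w : prime_elt p -> sqfree x -> cnorm x = w ^+ 2 ->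
  divides p x -> divides p (tau x) -> ~ divides p (tau (tau x)).
Proof.
move=> pp sx E [x1 e1] [x2 e2] [x3 e3]; have [p0 _ P] := pp.
have s1 := sqfree_tau sx; have s2 := sqfree_tau s1.
have n1 : ~ divides p x1 by move=> [c ec]; apply: (sx p pp); exists c; rewrite e1 ec mulrA.
have n2 : ~ divides p x2 by move=> [c ec]; apply: (s1 p pp); exists c; rewrite e2 ec mulrA.
have n3 : ~ divides p x3 by move=> [c ec]; apply: (s2 p pp); exists c; rewrite e3 ec mulrA.
have E1 : p ^+ 2 * (p * (x1 * x2 * x3)) = w ^+ 2 by rewrite -E /cnorm e3 e2 e1; ring.
have [v _ ev] := sqr_cancel ufdA p0 E1.
have [c ec] : divides p v by apply: (@prime_exp _ p v 2 pp); rewrite -ev; exists (x1 * x2 * x3).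
have : divides p (x1 * x2 * x3).
  by exists (c ^+ 2); apply: (mulfI p0); rewrite ev ec; ring.
by do 2 (apply: prime_mulN => //).
Qed.

Variable G : B.

Definition good_factor (y : B * A * 'I_4) :=
  [/\ irreducible_elt y.1.1, prime_elt y.1.2, ~ associate y.1.2 (tau y.1.2),
      j y.1.1 = cnorm y.1.2 & divides y.1.1 G].

Definition prod_choices (l : seq (B * A * 'I_4)) :=
  \prod_(y <- l) choose_conj y.2 y.1.2.

Fixpoint pairwise_nassoc (l : seq (B * A * 'I_4)) : Prop :=
  if l is y :: l' then
    (forall z, z \in l' -> forall u, u \is a GRing.unit -> y.1.1 <> u * z.1.1) /\ pairwise_nassoc l'
  else True.

(** Invariant of the factorization below: no conjugate of a prime already split off divides what
    remains. It keeps the norms in the list pairwise non-associate. *)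
Definition conj_divides (p x : A) :=
  [\/ divides p x, divides (tau p) x | divides (tau (tau p)) x].

Lemma conj_divides_tau p x : conj_divides p x -> conj_divides (tau p) x.
Proof. by rewrite /conj_divides tau3; case; [constructor 3|constructor 1|constructor 2]. Qed.

Lemma conj_divides_trans p q x : divides p q -> conj_divides q x -> conj_divides p x.
Proof.
move=> d; case=> h; [constructor 1|constructor 2|constructor 3];
  apply: divides_trans h => //; first exact: divides_tau.
by do 2 apply: divides_tau.
Qed.

(** As the norm is a square, a prime [p] of [x] divides a second conjugate of [x], which means that
    a conjugate [q] of [p] also divides [x]; by [no_triple] the third conjugate does not. Splitting
    off [p * q] divides the norm by the square of [cnorm p], so the recursion goes on. *)
Lemma sqfree_cnorm_factor x w : x != 0 -> sqfree x -> cnorm x = w ^+ 2 ->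
  (forall p, prime_elt p -> divides p x -> divides p (tau x) \/ divides p (tau (tau x)) ->
     divides p (j G)) ->
  exists eps l, [/\ eps \is a GRing.unit, x = eps * prod_choices l,
    forall y, y \in l -> good_factor y /\ conj_divides y.1.2 x & pairwise_nassoc l].
Proof.
have [mu [_ mu2 _]] := ufdA.
have [n] := ubnP (mu x); elim: n x w => // n IH x w lt x0 sx E HG.
have [xu|xn] := boolP (x \is a GRing.unit).
  by exists x, [::]; rewrite /prod_choices big_nil mulr1; split.
have [p pp [x1 e1]] := ufd_prime_divisor ufdA x0 xn.
have [p0 pu P] := pp.
have px : divides p x by exists x1.
have p1 := prime_tau pp; have p2 := prime_tau p1.
have np1 : ~ divides p x1 by move=> [c ec]; apply: (sx p pp); exists c; rewrite e1 ec mulrA.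
have pt : divides p (tau x) \/ divides p (tau (tau x)).
  have : divides p w by apply: (@prime_exp _ p w 2 pp); rewrite -E /cnorm e1 -!mulrA; exists (x1 * (tau (p * x1) * tau (tau (p * x1)))).
  move=> [w' ew]; have : divides p (x1 * tau x * tau (tau x)).
    exists (w' ^+ 2); apply: (mulfI p0).
    transitivity (cnorm x); first by rewrite /cnorm !mulrA -e1.
    by rewrite E ew; ring.
  by move=> /P[/P[//|]|]; [left|right].
(* Otherwise [p] would divide all three conjugates of [x]. *)
have na : ~ associate p (tau p).
  move=> [u uu e]; have tpp : divides p (tau p).
    by apply: (prime_assoc p1 pp); exists u; rewrite mulrC.
  have d1 : divides p (tau x) by apply: (divides_trans tpp); apply: divides_tau.
  have d2 : divides p (tau (tau x)) by apply: (divides_trans tpp); apply: divides_tau.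
  exact: no_triple pp sx E px d1 d2.
have [h eh] := tau_fixed (tau_cnorm p).
have [ih hG] := cnorm_prime pp na (esym eh).
have [|n1 m1] := nassoc_tau (q := p) pp na; first by rewrite inE eqxx.
have [|n2 m2] := nassoc_tau (q := tau p) pp na; first by rewrite !inE eqxx orbT.
have [|n3 m3] := nassoc_tau (q := tau (tau p)) pp na; first by rewrite !inE eqxx !orbT.
rewrite tau3 in n3 m3.
have [s [q [pq eq1 nq ex1 Nq]]] : exists (s : 'I_4) q, [/\ prime_elt q,
    choose_conj s p = p * q, q = tau p \/ q = tau (tau p), divides q x1 & cnorm q = cnorm p].
  (* If [p] divides [tau x], applying [tau] twice shows that [tau (tau p)] divides [x]; if it
     divides [tau (tau x)], applying [tau] once gives [tau p]. *)
  case: pt => d.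
    exists (inord 2), (tau (tau p)); rewrite /choose_conj /= inordK //.
    rewrite !cnorm_tau; split=> //; first by right.
    have : divides (tau (tau p)) x by move/divides_tau/divides_tau: d; rewrite tau3.
    by rewrite e1; case: p2 => _ _ PP /PP[].
  exists (inord 1), (tau p); rewrite /choose_conj /= inordK //.
  rewrite !cnorm_tau; split=> //; first by left.
  have : divides (tau p) x by move/divides_tau: d; rewrite tau3.
  by rewrite e1; case: p1 => _ _ PP /PP[].
have [x2 e2] := ex1.
have ex : x = p * q * x2 by rewrite e1 e2 mulrA.
have pq0 : p * q != 0 by rewrite mulf_neq0 //; case: pq.
have x20 : x2 != 0 by move: x0; rewrite ex mulf_eq0 negb_or => /andP[].
have [v _ ev] : exists2 v, w = cnorm p * v & cnorm x2 = v ^+ 2.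
  apply: (sqr_cancel ufdA); first by rewrite cnorm_eq0.
  by rewrite -E ex !cnormM Nq expr2.
have nqx2 : ~ divides q x2.
  move=> [c ec]; apply: (sx q pq); exists (p * c); rewrite ex ec; ring.
have npx2 : ~ divides p x2 by move=> h'; apply: np1; rewrite e2; apply: divides_mull.
have x2x y : divides y x2 -> divides y x by move=> d; rewrite ex; apply: divides_mull.
(* Neither [p] nor [q] divides [x2], so a conjugate of [p] dividing it would be the third, and all
   three would divide [x]. *)
have nconj : ~ conj_divides p x2.
  move=> C; have [d1 d2] : divides (tau p) x /\ divides (tau (tau p)) x.
    have qx : divides q x by rewrite e1; apply: divides_mull.
    case: nq => eq; rewrite eq in qx nqx2; case: C => // /x2x //.
  apply: (no_triple pp sx E px).
    by move/divides_tau: d2; rewrite tau3.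
  by move/divides_tau/divides_tau: d1; rewrite tau3.
have [|||eps [l [eu el lP lN]]] := IH x2 v _ x20 _ ev.
- rewrite -ltnS; apply: leq_trans lt; rewrite ltnS ex mulrC; apply: mu2.
    by rewrite mulrC -ex.
  by rewrite unitrM negb_and pu.
- by apply: sqfree_divides sx _; exists (p * q); rewrite ex mulrC.
- move=> r pr rx2 H; apply: HG => //; first exact: x2x.
  by case: H => H; [left|right]; rewrite ex !rmorphM /=; apply: divides_mull.
exists eps, ((h, p, s) :: l); split=> //.
- by rewrite /prod_choices big_cons /= eq1 ex el; rewrite mulrCA.
- move=> y; rewrite inE => /predU1P[->|/lP[g C]].
    split; last by constructor 1.
    split=> //=; apply: hG; exact: HG.
  by split=> //; case: C => d; [constructor 1|constructor 2|constructor 3]; apply: x2x.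
(* If some later norm were associate to [h], then [p] would divide it, hence divide a conjugate of a
   prime of [x2], against [nconj]. *)
split=> // y yl u uu /= e; have [[_ py nay ey _] C] := lP y yl.
apply: nconj; have : divides p (cnorm y.1.2).
  rewrite -ey; have : divides p (j h) by rewrite -eh /cnorm -mulrA; exists (tau p * tau (tau p)).
  rewrite e rmorphM => /P[|//] pju; case: (@prime_unit _ p (j u)) => //.
  exact: rmorph_unit.
move=> /P[/P[]|] d; apply: conj_divides_trans d _ => //; by do ?apply: conj_divides_tau.
Qed.

(** [j u] equals each of its conjugates, so if [p] divides it, the norm of [p] divides [u ^+ 3]. A
    common prime in [A] therefore produces one in [B]. *)
Lemma no_common_prime_lift p x y : ufd B -> no_common_prime x y ->
  prime_elt p -> divides p (j x) -> ~ divides p (j y).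
Proof.
move=> ufdB nc pp px py; have [p0 pu _] := pp.
have [h eh] := tau_fixed (tau_cnorm p).
have h0 : h != 0 by rewrite -(inj_eq j_inj) rmorph0 -eh cnorm_eq0.
have hnu : h \isn't a GRing.unit.
  apply: contra pu => /(rmorph_unit j) hu; apply: (divides_unit hu); rewrite -eh.
  by exists (tau p * tau (tau p)); rewrite mulrA.
have cube u : divides p (j u) -> divides h (u ^+ 3).
  move=> pju; apply: cnorm_dividesj => //; rewrite -eh rmorphXn /=.
  have [c1 e1] := pju.
  exists (c1 * tau c1 * tau (tau c1)).
  have e2 : j u = tau p * tau c1 by rewrite -rmorphM -e1 tau_j.
  have e3 : j u = tau (tau p) * tau (tau c1) by rewrite -!rmorphM -e1 !tau_j.
  by rewrite !exprS expr0 {1}e1 {1}e2 {1}e3 /cnorm; ring.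
have [r pr rh] := ufd_prime_divisor ufdB h0 hnu.
by apply: (nc r pr); apply: (@prime_exp _ r _ 3 pr); apply: (divides_trans rh); apply: cube.
Qed.

Lemma cnorm_square_factor x w : x != 0 -> cnorm x = w ^+ 2 ->
  (forall p, prime_elt p -> divides p x -> divides p (tau x) \/ divides p (tau (tau x)) ->
     divides p (j G)) ->
  exists eps l r, [/\ eps \is a GRing.unit, x = eps * prod_choices l * r ^+ 2,
    forall y, y \in l -> good_factor y & pairwise_nassoc l].
Proof.
move=> x0 E HG; have [s [r [ex sf]]] := sqfree_part ufdA x0.
have [s0 r0] : s != 0 /\ r != 0.
  by move: x0; rewrite ex mulf_eq0 expf_eq0 negb_or => /andP[].
have [v _ Es] : exists2 v, w = cnorm r * v & cnorm s = v ^+ 2.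
  apply: (sqr_cancel ufdA); first by rewrite cnorm_eq0.
  by rewrite -E ex !cnormM; ring.
have sx : divides s x by rewrite ex; apply: divides_mulr; apply: divides_refl.
have [|eps [l [eu es lP lN]]] := sqfree_cnorm_factor s0 sf Es.
  move=> p pp ps H; apply: HG => //; first exact: divides_trans sx.
  case: H => H; [left|right]; apply: divides_trans H _; first exact: divides_tau.
  by do 2 apply: divides_tau.
exists eps, l, r; split=> //; first by rewrite ex es.
by move=> y /lP[].
Qed.

End CyclicNorm.

(** The measure yields an irreducible divisor, and the Bezout relation makes irreducible elements
    prime. *)
Lemma ufd_bezout (A : idomainType) (mu : A -> nat) :
  (forall a b, a * b != 0 -> (mu a <= mu (a * b)%R)%N) ->
  (forall a b, a * b != 0 -> b \isn't a GRing.unit -> (mu a < mu (a * b)%R)%N) ->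
  (forall a b : A, exists d u v, [/\ d = u * a + v * b, divides d a & divides d b]) ->
  ufd A.
Proof.
move=> mu1 mu2 bez; exists mu; split=> // c.
have [n] := ubnP (mu c); elim: n c => // n IH c lt c0 cu.
have [[x [y [e xu yu]]]|N] := classic (exists x y, [/\ c = x * y, x \isn't a GRing.unit &
    y \isn't a GRing.unit]).
  have x0 : x != 0 by apply: contraNneq c0 => x0; rewrite e x0 mul0r.
  have [|p pp px] := IH x _ x0 xu.
    by rewrite -ltnS; apply: leq_trans lt; rewrite ltnS e; apply: mu2 => //; rewrite -e.
  by exists p => //; rewrite e; apply: divides_mulr.
exists c; last exact: divides_refl.
split=> // a b cab; have [d [u [v [ed [k ek] da]]]] := bez c a.
have [du|dn] := boolP (d \is a GRing.unit); last first.
  have ku : k \is a GRing.unit by apply: contraT => kn; case: N; exists d, k.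
  left; apply: divides_trans da; exists k^-1; by rewrite ek mulrK.
right; have -> : b = d^-1 * (u * b * c + v * (a * b)).
  by apply: (mulrI du); rewrite mulVKr // ed; ring.
by apply: divides_mull; apply: divides_add; apply: divides_mull => //; apply: divides_refl.
Qed.


(** * Specialization in Q(t) *)

Definition evalZt (t0 : rat) : {rmorphism {poly int} -> rat} :=
  horner_eval t0 \o map_poly intr.

Definition embZt : {rmorphism {poly int} -> Qt} :=
  @FracField.tofrac {poly rat} \o map_poly intr.

Lemma toQt_eq0 (p : {poly rat}) : (toQt p == 0) = (p == 0).
Proof. exact: tofrac_eq0. Qed.

Lemma toQt_inj : injective toQt.
Proof. by move=> p q /eqP; rewrite tofrac_eq => /eqP. Qed.

Lemma toQtM p q : toQt (p * q) = toQt p * toQt q. Proof. exact: tofracM. Qed.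
Lemma toQtD p q : toQt (p + q) = toQt p + toQt q. Proof. exact: tofracD. Qed.
Lemma map_poly_int_inj : injective (map_poly (intr : int -> rat)).
Proof. exact: map_inj_poly (@intr_inj rat) (mulr0z _). Qed.

Lemma embZt_inj : injective embZt.
Proof. by move=> p q /toQt_inj /map_poly_int_inj. Qed.

Lemma embZt_eq0 p : (embZt p == 0) = (p == 0).
Proof. by rewrite -(rmorph0 embZt) (inj_eq embZt_inj). Qed.

Lemma embZt_C (c : int) : embZt c%:P = c%:~R.
Proof.
have -> : c%:P = c%:~R :> {poly int} by rewrite -{1}[c]intz rmorph_int.
exact: rmorph_int.
Qed.

Lemma Qt_frac (x : Qt) : exists p q, q != 0 /\ x = toQt p / toQt q.
Proof.
elim/quotW: x => r; exists \n_r, \d_r; have d0 := denom_ratioP r; split=> //.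
apply: (canRL (mulfK _)); first by rewrite toQt_eq0.
rewrite /toQt; unlock FracField.tofrac.
rewrite -[LHS](FracField.pi_mul r (Ratio \d_r 1)).
apply/eqmodP => /=; rewrite FracField.equivfE /FracField.mulf.
by rewrite !numden_Ratio ?mulf_neq0 ?oner_neq0 // !mulr1 mulrC.
Qed.

Lemma Qt_coprime (x : Qt) : exists p q, [/\ q != 0, coprimep p q & x = toQt p / toQt q].
Proof.
have [p [q [q0 ->]]] := Qt_frac x.
have g0 : gcdp p q != 0 by rewrite gcdp_eq0 negb_and q0 orbT.
have /dvdpP[p' ep] := dvdp_gcdl p q; have /dvdpP[q' eq] := dvdp_gcdr p q.
have /coprimep_div_gcd cp : (p != 0) || (q != 0) by rewrite q0 orbT.
move: (gcdp p q) g0 ep eq cp => d d0 ep eq; rewrite ep eq !mulpK // => cp.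
have q'0 : q' != 0 by apply: contraNneq q0 => e; rewrite eq e mul0r.
exists p', q'; split=> //; rewrite !toQtM -mulf_div divff ?mulr1 //.
by rewrite toQt_eq0.
Qed.

Section Specialization.
Variable t0 : rat.

Lemma evals_unique x u v : evals_to t0 x u -> evals_to t0 x v -> u = v.
Proof.
move=> [p [q [q0 [ex ->]]]] [p' [q' [q'0 [ex' ->]]]].
have nz (r : {poly rat}) : r.[t0] != 0 -> toQt r != 0.
  by move=> r0; rewrite toQt_eq0; apply: contraNneq r0 => ->; rewrite horner0.
have E : p * q' = p' * q.
  apply: toQt_inj; rewrite !toQtM; apply/eqP; rewrite -eqr_div ?nz //.
  by rewrite -ex -ex'.
have := congr1 (horner^~ t0) E; rewrite !hornerM => E'.
by apply/eqP; rewrite eqr_div // E'.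
Qed.

Lemma evals_poly p : evals_to t0 (toQt p) p.[t0].
Proof.
by exists p, 1; rewrite hornerC oner_neq0 /toQt rmorph1 !divr1.
Qed.

Lemma evals_embZt p : evals_to t0 (embZt p) (evalZt t0 p).
Proof. exact: evals_poly. Qed.

Lemma evals_add x y u v : evals_to t0 x u -> evals_to t0 y v -> evals_to t0 (x + y) (u + v).
Proof.
move=> [p [q [q0 [-> ->]]]] [p' [q' [q'0 [-> ->]]]].
have nz (r : {poly rat}) : r.[t0] != 0 -> toQt r != 0.
  by move=> r0; rewrite toQt_eq0; apply: contraNneq r0 => ->; rewrite horner0.
exists (p * q' + p' * q), (q * q').
by rewrite hornerD !hornerM mulf_neq0 // toQtD !toQtM !addf_div ?nz.
Qed.

Lemma evals_mul x y u v : evals_to t0 x u -> evals_to t0 y v -> evals_to t0 (x * y) (u * v).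
Proof.
move=> [p [q [q0 [-> ->]]]] [p' [q' [q'0 [-> ->]]]].
exists (p * p'), (q * q').
by rewrite !hornerM mulf_neq0 // !toQtM !mulf_div.
Qed.

Lemma evals_int (c : int) : evals_to t0 c%:~R c%:~R.
Proof.
by rewrite -embZt_C -(ev_polyC (evalZt t0)); apply: evals_embZt.
Qed.

Lemma evals_opp x u : evals_to t0 x u -> evals_to t0 (- x) (- u).
Proof. by move=> h; rewrite -[- x]mulN1r -[- u]mulN1r; apply: evals_mul => //; apply: (evals_int (-1)). Qed.

Lemma evals_sub x y u v : evals_to t0 x u -> evals_to t0 y v -> evals_to t0 (x - y) (u - v).
Proof. by move=> h1 /evals_opp; apply: evals_add. Qed.

Lemma evals_exp x u n : evals_to t0 x u -> evals_to t0 (x ^+ n) (u ^+ n).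
Proof.
move=> h; elim: n => [|n IH]; first by rewrite !expr0; apply: (evals_int 1).
by rewrite !exprS; apply: evals_mul.
Qed.

Lemma pole_div n d k u : evals_to t0 n u -> u != 0 -> evals_to t0 d 0 -> d != 0 ->
  (0 < k)%N -> ~ regular_at t0 (n / d ^+ k).
Proof.
move=> en u0 ed d0 k0 [v ev]; have dk : d ^+ k != 0 by apply: expf_neq0.
have : evals_to t0 n (v * 0 ^+ k).
  by have := evals_mul ev (evals_exp k ed); rewrite (divfK dk n).
move=> /(evals_unique en) e; move: u0; rewrite e expr0n.
by case: k k0 {ev e dk} => //= k _; rewrite mulr0 eqxx.
Qed.

Lemma pole_sub x r v : ~ regular_at t0 x -> evals_to t0 r v -> ~ regular_at t0 (x - r).
Proof.
move=> nx er [u eu]; apply: nx; exists (u + v).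
by rewrite -(subrK r x); apply: evals_add.
Qed.

End Specialization.

(** * Cubics without repeated roots *)

Lemma cubic_double_root (R : comPzRingType) (x z A : R) :
  x ^+ 3 + A * x ^+ 2 + - (3 * z ^+ 2 + 2 * A * z) * x
    + - (z ^+ 3 + A * z ^+ 2 + - (3 * z ^+ 2 + 2 * A * z) * z)
  = (x + (A + 2 * z)) * (x - z) ^+ 2.
Proof. ring. Qed.

Lemma double_root_dvd (A B C z : algC) :
  z ^+ 3 + A * z ^+ 2 + B * z + C = 0 -> 3 * z ^+ 2 + 2 * A * z + B = 0 ->
  ('X - z%:P) ^+ 2 %| 'X^3 + A *: 'X^2 + B *: 'X + C%:P.
Proof.
move=> e1 e2; have eB : B = - (3 * z ^+ 2 + 2 * A * z) by apply/eqP; rewrite -addr_eq0 addrC e2.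
have eC : C = - (z ^+ 3 + A * z ^+ 2 + B * z) by apply/eqP; rewrite -addr_eq0 addrC e1.
apply/dvdpP; exists ('X + (A + 2 * z)%:P).
rewrite -!mul_polyC eC eB !(polyCN, polyCM, polyCD, polyC_exp, polyC_natr).
exact: cubic_double_root.
Qed.

Lemma cubic_simple_rootC (A B C : rat) (z : algC) : no_repeated_roots (cubicQ A B C) ->
  z ^+ 3 + ratr A * z ^+ 2 + ratr B * z + ratr C = 0 ->
  3 * z ^+ 2 + 2 * ratr A * z + ratr B != 0.
Proof.
move=> H e1; apply/eqP => e2; apply: (H z); rewrite /cubicQ.
rewrite !rmorphD /= !map_polyZ /= map_polyC !map_polyXn map_polyX /=.
exact: double_root_dvd.
Qed.

Lemma cubic_simple_root (A B C u : rat) : no_repeated_roots (cubicQ A B C) ->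
  u ^+ 3 + A * u ^+ 2 + B * u + C = 0 -> 3 * u ^+ 2 + 2 * A * u + B != 0.
Proof.
move=> H e1; have := @cubic_simple_rootC A B C (ratr u) H.
have -> : ratr u ^+ 3 + ratr A * ratr u ^+ 2 + ratr B * ratr u + ratr C = 0 :> algC.
  by rewrite -!rmorphXn -!rmorphM -!rmorphD /= e1 rmorph0.
have -> : 3 * ratr u ^+ 2 + 2 * ratr A * ratr u + ratr B = ratr (3 * u ^+ 2 + 2 * A * u + B) :> algC.
  have <- : ratr 3 = 3 :> algC by rewrite ratr_nat.
  have <- : ratr 2 = 2 :> algC by rewrite ratr_nat.
  by rewrite -rmorphXn -!rmorphM -!rmorphD.
by rewrite fmorph_eq0; apply.
Qed.

Lemma cubic_rootsC (a b c : algC) : exists t1 t2 t3,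
  [/\ a = - (t1 + t2 + t3), b = t1 * t2 + t1 * t3 + t2 * t3 & c = - (t1 * t2 * t3)].
Proof.
have [t1 e1] := @solve_monicpoly algC 3 (nth 0 [:: - c; - b; - a]) isT.
(* This quadratic is the quotient of the cubic by its linear factor at [t1]. *)
have [t2 e2] := @solve_monicpoly algC 2 (nth 0 [:: - (b + a * t1 + t1 ^+ 2); - (a + t1)]) isT.
rewrite !big_ord_recr !big_ord0 /= !add0r !expr0 !mulr1 !expr1 in e1 e2.
pose t3 := - (a + t1) - t2; exists t1, t2, t3.
have eb : b = - (t2 ^+ 2 + (a + t1) * t2 + a * t1 + t1 ^+ 2) by rewrite e2; ring.
have ec : c = - (t1 ^+ 3 + a * t1 ^+ 2 + b * t1) by rewrite e1; ring.
by split; [rewrite /t3; ring| rewrite eb /t3; ring | rewrite ec eb /t3; ring].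
Qed.

Lemma Qt_int_coprime (x : Qt) : exists P Q : {poly int},
  [/\ Q != 0, coprimep (polyZQ P) (polyZQ Q) & x = embZt P / embZt Q].
Proof.
have [p [q [q0 cop ->]]] := Qt_coprime x.
have [P [al al0 eP]] := rat_poly_scale p; have [Q [be be0 eQ]] := rat_poly_scale q.
have nz (k : int) : k != 0 -> k%:~R != 0 :> rat by rewrite intr_eq0.
have Q0 : Q != 0 by apply: contraNneq q0 => Q0; rewrite eQ Q0 map_poly0 scaler0.
exists (be%:P * P), (al%:P * Q); split.
- by rewrite mulf_neq0 // polyC_eq0.
- rewrite /polyZQ !rmorphM /= !map_polyC /= !mul_polyC.
  rewrite coprimepZl ?coprimepZr ?nz //; move: cop.
  by rewrite eP eQ coprimepZl ?coprimepZr ?invr_eq0 ?nz.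
have ce (k : int) : k != 0 -> embZt k%:P != 0 by move=> k0; rewrite embZt_eq0 polyC_eq0.
have toQtZ (k : int) (r : {poly int}) : k != 0 ->
    toQt (k%:~R^-1 *: map_poly intr r) = embZt r / embZt k%:P.
  move=> k0; apply: (canRL (mulfK (ce _ k0))).
  rewrite -[embZt k%:P]/(toQt (map_poly intr k%:P)) -toQtM map_polyC /=.
  by rewrite [_ * _%:P]mulrC mul_polyC scalerA divff ?nz // scale1r.
rewrite eP eQ !toQtZ // (rmorphM embZt be%:P P) (rmorphM embZt al%:P Q).
by rewrite invf_div mulf_div (mulrC (embZt P)).
Qed.

(** The line of slope [l] through [(x1, y1)] and [(x2, - y2)] meets the cubic a third time at
    abscissa [x3], that of the difference of the two points. Two equations replace the quotient
    defining [l], so that the tangent case is covered and either equation may serve to compute the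
    slope. *)
Lemma cubic_chord (R : comPzRingType) (A B C x1 y1 x2 y2 l : R) :
  y1 ^+ 2 = x1 ^+ 3 + A * x1 ^+ 2 + B * x1 + C ->
  y1 + y2 = l * (x1 - x2) ->
  l * (y1 - y2) = x1 ^+ 2 + x1 * x2 + x2 ^+ 2 + A * (x1 + x2) + B ->
  let x3 := l ^+ 2 - (A + x1 + x2) in
  (y1 + l * (x3 - x1)) ^+ 2 = x3 ^+ 3 + A * x3 ^+ 2 + B * x3 + C.
Proof.
move=> e1 e2 e3 x3.
have ey : y2 = l * (x1 - x2) - y1 by rewrite -e2; ring.
have eB : B = l * (y1 - y2) - (x1 ^+ 2 + x1 * x2 + x2 ^+ 2 + A * (x1 + x2)) by rewrite e3; ring.
have eC : C = y1 ^+ 2 - (x1 ^+ 3 + A * x1 ^+ 2 + B * x1) by rewrite e1; ring.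
by rewrite eC eB ey /x3; ring.
Qed.

Lemma cubic_secant (R : comPzRingType) (A B C x1 y1 x2 y2 : R) :
  y1 ^+ 2 = x1 ^+ 3 + A * x1 ^+ 2 + B * x1 + C ->
  y2 ^+ 2 = x2 ^+ 3 + A * x2 ^+ 2 + B * x2 + C ->
  (y1 + y2) * (y1 - y2) =
    (x1 ^+ 2 + x1 * x2 + x2 ^+ 2 + A * (x1 + x2) + B) * (x1 - x2).
Proof.
move=> e1 e2; have -> : (y1 + y2) * (y1 - y2) = y1 ^+ 2 - y2 ^+ 2 by ring.
by rewrite e1 e2; ring.
Qed.

Section Injectivity.
Variables (a b c : int) (g : {poly int}) (t0 : rat).
Let G := embZt g.
Let g0 := (polyZQ g).[t0].

Definition curve (x y : Qt) :=
  y ^+ 2 = x ^+ 3 + a%:~R * G * x ^+ 2 + b%:~R * G ^+ 2 * x + c%:~R * G ^+ 3.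

Hypothesis sep0 : no_repeated_roots (cubicQ (a%:~R * g0) (b%:~R * g0 ^+ 2) (c%:~R * g0 ^+ 3)).
Hypothesis ker : forall x y, curve x y -> regular_at t0 x.

Lemma evals_G : evals_to t0 G g0.
Proof. exact: evals_embZt. Qed.

Lemma pole_sqr_sub n d r u v : evals_to t0 n u -> u != 0 -> evals_to t0 d 0 -> d != 0 ->
  evals_to t0 r v -> ~ regular_at t0 ((n / d) ^+ 2 - r).
Proof.
move=> en u0 ed d0 er; apply: pole_sub er; rewrite expr_div_n.
by apply: pole_div (evals_exp 2 en) _ ed d0 _ => //; rewrite expf_eq0.
Qed.

(** If the points differed, the slope of the chord would have a pole at [t0], and so would the
    abscissa of their difference, against [ker]. The numerator of the slope takes the value [2 v]
    or, when [v = 0], the derivative of the specialized cubic at its root [u], which is nonzero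
    because that root is simple. *)
Lemma same_specialization x1 y1 x2 y2 u v : curve x1 y1 -> curve x2 y2 ->
  evals_to t0 x1 u -> evals_to t0 y1 v -> evals_to t0 x2 u -> evals_to t0 y2 v ->
  (x1, y1) = (x2, y2).
Proof.
move=> c1 c2 ex1 ey1 ex2 ey2.
have eA : evals_to t0 (a%:~R * G) (a%:~R * g0).
  by apply: evals_mul (evals_int _ _) evals_G.
have eB : evals_to t0 (b%:~R * G ^+ 2) (b%:~R * g0 ^+ 2).
  by apply: evals_mul (evals_int _ _) (evals_exp 2 evals_G).
have eC : evals_to t0 (c%:~R * G ^+ 3) (c%:~R * g0 ^+ 3).
  by apply: evals_mul (evals_int _ _) (evals_exp 3 evals_G).
have sec := cubic_secant c1 c2; have chord := cubic_chord c1.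
have ker' := ker; rewrite /curve in c1 ker'.
move: (a%:~R * G) (b%:~R * G ^+ 2) (c%:~R * G ^+ 3) eA eB eC c1 sec chord ker' => A B C.
move: (a%:~R * g0) (b%:~R * g0 ^+ 2) (c%:~R * g0 ^+ 3) sep0 => A0 B0 C0 sep.
move=> eA eB eC c1 sec chord ker'.
pose S := x1 ^+ 2 + x1 * x2 + x2 ^+ 2 + A * (x1 + x2) + B.
have eS : evals_to t0 S (3 * u ^+ 2 + 2 * A0 * u + B0).
  have -> : 3 * u ^+ 2 + 2 * A0 * u + B0 = u ^+ 2 + u * u + u ^+ 2 + A0 * (u + u) + B0 by ring.
  do !apply: evals_add => //; try exact: evals_exp; try exact: evals_mul.
  by apply: evals_mul => //; apply: evals_add.
have er : evals_to t0 (A + x1 + x2) (A0 + u + u) by do !apply: evals_add.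
have edx : evals_to t0 (x1 - x2) 0 by rewrite -(subrr u); apply: evals_sub.
have edy : evals_to t0 (y1 - y2) 0 by rewrite -(subrr v); apply: evals_sub.
have esy : evals_to t0 (y1 + y2) (v + v) by apply: evals_add.
have [v0|v0] := eqVneq v 0.
  have S0 : 3 * u ^+ 2 + 2 * A0 * u + B0 != 0.
    apply: (cubic_simple_root sep).
    apply: (@evals_unique t0 (y1 ^+ 2)); last by have := evals_exp 2 ey1; rewrite v0 expr0n.
    rewrite c1; do !apply: evals_add => //; try exact: evals_exp.
      by apply: evals_mul => //; apply: evals_exp.
    exact: evals_mul.
  have [ey|ny] := eqVneq y1 y2.
    move: sec; rewrite ey subrr mulr0 => /esym/eqP; rewrite mulf_eq0 -/S.
    have -> : (S == 0) = false.
      apply/negP => /eqP Sz; move: eS S0; rewrite Sz => /(evals_unique (evals_int t0 0)) <-.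
      by rewrite eqxx.
    by rewrite subr_eq0 => /eqP ->.
  have dy0 : y1 - y2 != 0 by rewrite subr_eq0.
  case: (pole_sqr_sub eS S0 edy dy0 er); apply: ker' (chord x2 y2 (S / (y1 - y2)) _ _).
    by apply: (mulIf dy0); rewrite sec -/S mulrAC (divfK dy0 S).
  exact: divfK dy0 S.
have [ex|nx] := eqVneq x1 x2.
  move: sec; rewrite ex subrr mulr0 => /eqP; rewrite mulf_eq0.
  have -> : (y1 + y2 == 0) = false.
    apply/negP => /eqP Sz; move: esy; rewrite Sz => /(evals_unique (evals_int t0 0)) /eqP.
    by rewrite eq_sym -mulr2n mulrn_eq0 /= (negPf v0).
  by rewrite subr_eq0 => /eqP ->.
have dx0 : x1 - x2 != 0 by rewrite subr_eq0.
have v2 : v + v != 0 by rewrite -mulr2n mulrn_eq0.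
case: (pole_sqr_sub esy v2 edx dx0 er); apply: ker' (chord x2 y2 ((y1 + y2) / (x1 - x2)) _ _).
  exact/esym/(divfK dx0).
by apply: (mulIf dx0); rewrite mulrAC (divfK dx0) sec.
Qed.

Lemma injective_of_kernel : sigma_injective a b c g t0.
Proof.
move=> [[x1 y1]|] [[x2 y2]|] [[u v]|] //=.
- by move=> c1 c2 [ex1 ey1] [ex2 ey2]; congr Some; apply: same_specialization c1 c2 _ _ _ _; eassumption.
- by move=> /ker.
- by move=> /ker.
- by move=> _ /ker.
Qed.

End Injectivity.

(** * Descent on the kernel of specialization *)

Section Duplication.
Variables (a b c : int).
Hypothesis sep : no_repeated_roots (cubicQ a%:~R b%:~R c%:~R).

Definition cubic_form (R : pzRingType) (x w : R) : R :=
  x ^+ 3 + a%:~R * x ^+ 2 * w + b%:~R * x * w ^+ 2 + c%:~R * w ^+ 3.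

(** Homogenized numerator of the abscissa of a double, the denominator being
    [4 * cubic_form x w * w]. *)
Definition dup_form (R : pzRingType) (x w : R) : R :=
  (x ^+ 2 - b%:~R * w ^+ 2) ^+ 2 - 8 * c%:~R * x * w ^+ 3 - 4 * a%:~R * c%:~R * w ^+ 4.

Definition evalC (z : algC) : {rmorphism {poly rat} -> algC} :=
  horner_eval z \o map_poly ratr.

Lemma rmorph_cubic_form (R S : pzRingType) (f : {rmorphism R -> S}) x w :
  f (cubic_form x w) = cubic_form (f x) (f w).
Proof. by rewrite /cubic_form !(rmorphD, rmorphXn, rmorphM, rmorph_int). Qed.

Lemma rmorph_dup_form (R S : pzRingType) (f : {rmorphism R -> S}) x w :
  f (dup_form x w) = dup_form (f x) (f w).
Proof.
have f4 : f 4 = 4 by apply: rmorph_nat.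
have f8 : f 8 = 8 by apply: rmorph_nat.
by rewrite /dup_form !(rmorphB, rmorphXn, rmorphM, rmorph_int) f4 f8.
Qed.

Lemma cubic_dup_no_zero (x w : algC) : (x != 0) || (w != 0) ->
  cubic_form x w * w = 0 -> dup_form x w != 0.
Proof.
move=> nz /eqP; rewrite mulf_eq0; have [w0 _|w0 /= F0] := eqVneq w 0.
  rewrite w0 eqxx orbF in nz.
  by rewrite /dup_form w0 !expr0n /= !mulr0 !subr0 !expf_eq0.
have e : x = x / w * w by rewrite divfK.
move: F0; rewrite orbF e; move: (x / w) => r F0.
have f0 : r ^+ 3 + a%:~R * r ^+ 2 + b%:~R * r + c%:~R = 0.
  have w3 : w ^+ 3 != 0 by rewrite expf_eq0.
  by apply: (mulIf w3); rewrite mul0r -(eqP F0) /cubic_form; ring.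
have := @cubic_simple_rootC _ _ _ r sep; rewrite !ratr_int => /(_ f0) f1.
(* Modulo [f(r)] the duplication form is the square of the derivative [f'(r)], so a common zero
   would be a double root. *)
have -> : dup_form (r * w) w = ((3 * r ^+ 2 + 2 * a%:~R * r + b%:~R) ^+ 2 -
   (8 * r + 4 * a%:~R) * (r ^+ 3 + a%:~R * r ^+ 2 + b%:~R * r + c%:~R)) * w ^+ 4.
  by rewrite /dup_form; ring.
by rewrite f0 mulr0 subr0 mulf_neq0 // expf_neq0.
Qed.

Lemma coprime_dup (A B : {poly rat}) : coprimep A B ->
  coprimep (cubic_form A B * B) (dup_form A B).
Proof.
rewrite -!(coprimep_map (ratr : {rmorphism rat -> algC})) => cop.
apply: Pdiv.ClosedField.root_coprimep => z /eqP.
rewrite -[(map_poly _ _).[z]]/(evalC z _) -[(map_poly _ (dup_form _ _)).[z]]/(evalC z _).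
rewrite rmorphM rmorph_cubic_form rmorph_dup_form; apply: cubic_dup_no_zero.
have [A0|//] := eqVneq (evalC z A) 0.
by apply: coprimep_root cop _; apply/eqP.
Qed.

(** Over [algC] the form is the product of the [A - t_i B]. If it were constant, so would be the
    factors for two distinct roots, and their difference is a nonzero multiple of [B]. *)
Lemma size_cubic_form (A B : {poly rat}) : (1 < size B)%N -> cubic_form A B != 0 ->
  (1 < size (cubic_form A B))%N.
Proof.
move=> sB F0; rewrite ltnNge; apply/negP => sF.
have [t1 [t2 [t3 [ea eb ec]]]] := cubic_rootsC a%:~R b%:~R c%:~R.
have t12 : t1 != t2.
  apply/eqP => t12; have := @cubic_simple_rootC _ _ _ t1 sep.
  rewrite !ratr_int ea eb ec => /(_ _) /eqP; apply; last by rewrite t12; ring.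
  by rewrite t12; ring.
pose f := map_poly (ratr : {rmorphism rat -> algC}).
have Fu : f (cubic_form A B) \is a GRing.unit.
  have sF1 : size (f (cubic_form A B)) = 1%N.
    by apply/eqP; rewrite size_map_poly eqn_leq sF lt0n size_poly_eq0.
  rewrite poly_unitE sF1 /= unitfE -lead_coef_eq0 in F0 *.
  by have := F0; rewrite -(fmorph_eq0 (ratr : {rmorphism rat -> algC})) -lead_coef_map lead_coefE sF1.
have polyC_int (k : int) : k%:~R = (k%:~R : algC)%:P by rewrite rmorph_int.
have EF : f (cubic_form A B) = (f A - t1%:P * f B) * (f A - t2%:P * f B) * (f A - t3%:P * f B).
  rewrite [LHS](rmorph_cubic_form (map_poly (ratr : {rmorphism rat -> algC}) : {rmorphism _ -> _})).
  rewrite -/f /cubic_form !polyC_int ea eb ec !(polyCN, polyCD, polyCM).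
  by ring.
have small (t : algC) : divides (f A - t%:P * f B) (f (cubic_form A B)) -> (size (f A - t%:P * f B)%R <= 1)%N.
  by move/(divides_unit Fu); rewrite poly_unitE => /andP[/eqP ->].
have s1 := small t1; have s2 := small t2.
have {s1} s1 : (size (f A - t1%:P * f B)%R <= 1)%N.
  by apply: s1; rewrite EF -mulrA; exists ((f A - t2%:P * f B) * (f A - t3%:P * f B)).
have {s2} s2 : (size (f A - t2%:P * f B)%R <= 1)%N.
  by apply: s2; exists ((f A - t1%:P * f B) * (f A - t3%:P * f B)); rewrite EF; ring.
have : (size ((t2 - t1) *: f B)%R <= 1)%N.
  have -> : (t2 - t1) *: f B = (f A - t1%:P * f B) - (f A - t2%:P * f B).
    by rewrite -mul_polyC polyCB; ring.
  by apply: leq_trans (size_polyD _ _) _; rewrite size_polyN geq_max s1 s2.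
by rewrite size_scale ?subr_eq0 1?eq_sym // size_map_poly leqNgt sB.
Qed.

(** By coprimality no cancellation occurs: [cubic_form A1 B1 * B1] divides [B], and its first factor
    is nonconstant. *)
Lemma dup_den_growth (A B A1 B1 : {poly rat}) : coprimep A1 B1 -> B != 0 ->
  (1 < size B1)%N -> 4 * cubic_form A1 B1 * B1 * A = B * dup_form A1 B1 ->
  (size B1 < size B)%N.
Proof.
move=> cop B0 sB1 E; have cop2 := coprime_dup cop.
have dB : cubic_form A1 B1 * B1 %| B.
  rewrite -(Gauss_dvdpl _ cop2) -E; apply/dvdpP; exists (4 * A); ring.
have nz : cubic_form A1 B1 * B1 != 0 by apply: contraNneq B0 => e; move: dB; rewrite e dvd0p.
have [F0 B10] : cubic_form A1 B1 != 0 /\ B1 != 0 by move: nz; rewrite mulf_eq0 negb_or => /andP[].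
apply: leq_trans (dvdp_leq B0 dB); rewrite size_mul //.
have lt_add m n : (1 < m)%N -> (n < (m + n).-1)%N.
  by case: m => [|[|m]] // _; rewrite !addSn /= ltnS leq_addl.
exact: lt_add (size_cubic_form sB1 F0).
Qed.

End Duplication.

(** * Identities for clearing denominators *)

Section FieldIdentities.
Variables (F : fieldType).
Implicit Types (A B C p q x y z w : F).

Lemma divf_common k p q : k != 0 -> (k * p) / (k * q) = p / q.
Proof. by move=> k0; rewrite -mulf_div divff // mul1r. Qed.

Lemma mul_sqr_div p q : q != 0 -> q ^+ 2 * (p / q) ^+ 2 = p ^+ 2.
Proof. by move=> q0; field. Qed.

Lemma divf_involution h p q : h * h = 1 -> p / (h * q) = (h * p) / q.
Proof.
move=> hh; have h0 : h != 0.
  by apply/eqP => e; move/eqP: hh; rewrite e mul0r eq_sym oner_eq0.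
have hV : h^-1 = h by apply: (mulfI h0); rewrite divff.
by rewrite invfM hV mulrA (mulrC p).
Qed.

Lemma divf_move w x p q : w != 0 -> x / w = p / q -> x = w * p / q.
Proof. by move=> w0 e; rewrite -mulrA -e mulrC divfK. Qed.

Lemma curve_clear_den A B C p q y : q != 0 ->
  y ^+ 2 = (p / q) ^+ 3 + A * (p / q) ^+ 2 + B * (p / q) + C ->
  (y * q ^+ 2) ^+ 2 = q * (p ^+ 3 + A * p ^+ 2 * q + B * p * q ^+ 2 + C * q ^+ 3).
Proof. by move=> q0 e; rewrite exprMn e; field. Qed.

Lemma curve_of_integral A B C p q z : q != 0 ->
  z ^+ 2 = p ^+ 3 + A * q ^+ 2 * p ^+ 2 + B * q ^+ 4 * p + C * q ^+ 6 ->
  (z / q ^+ 3) ^+ 2 = (p / q ^+ 2) ^+ 3 + A * (p / q ^+ 2) ^+ 2 + B * (p / q ^+ 2) + C.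
Proof. by move=> q0 e; rewrite expr_div_n e; field. Qed.

Lemma dup_of_integral (a b c : int) w p p1 q z : q != 0 ->
  let A := a%:~R * w in let B := b%:~R * w ^+ 2 in let C := c%:~R * w ^+ 3 in
  z ^+ 2 = p1 ^+ 3 + A * q ^+ 2 * p1 ^+ 2 + B * q ^+ 4 * p1 + C * q ^+ 6 ->
  4 * z ^+ 2 * p = (p1 ^+ 2 - B * q ^+ 4) ^+ 2 - 8 * (C * q ^+ 6) * p1
     - 4 * (A * q ^+ 2) * (C * q ^+ 6) ->
  4 * cubic_form a b c (p1 / q ^+ 2) w * (p / q ^+ 2) = dup_form a b c (p1 / q ^+ 2) w.
Proof.
move=> q0 A B C e1 e2.
have -> : cubic_form a b c (p1 / q ^+ 2) w = z ^+ 2 / q ^+ 6.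
  by rewrite e1 /cubic_form /A /B /C; field.
have -> : 4 * (z ^+ 2 / q ^+ 6) * (p / q ^+ 2) = (4 * z ^+ 2 * p) / q ^+ 8 by field.
by rewrite e2 /dup_form /A /B /C; field.
Qed.

Lemma dup_homogeneous (a b c : int) w x y p q : w != 0 -> q != 0 -> y != 0 ->
  4 * cubic_form a b c (w * p / q) w * (w * x / y) = dup_form a b c (w * p / q) w ->
  4 * cubic_form a b c p q * q * x = y * dup_form a b c p q.
Proof.
move=> w0 q0 y0.
have -> : cubic_form a b c (w * p / q) w = (w / q) ^+ 3 * cubic_form a b c p q.
  by rewrite /cubic_form; field.
have -> : dup_form a b c (w * p / q) w = (w / q) ^+ 4 * dup_form a b c p q.
  by rewrite /dup_form; field.
move: (cubic_form _ _ _ _ _) (dup_form _ _ _ _ _) => f d E.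
have k0 : (w / q) ^+ 4 != 0 by rewrite expf_neq0 // mulf_neq0 ?invr_eq0.
by apply: (mulfI k0); rewrite [RHS]mulrCA -E; field; rewrite y0 q0.
Qed.

End FieldIdentities.

Lemma embZtM p q : embZt (p * q) = embZt p * embZt q. Proof. exact: rmorphM. Qed.
Lemma embZtD p q : embZt (p + q) = embZt p + embZt q. Proof. exact: rmorphD. Qed.
Lemma embZtB p q : embZt (p - q) = embZt p - embZt q. Proof. exact: rmorphB. Qed.
Lemma embZtX p n : embZt (p ^+ n) = embZt p ^+ n. Proof. exact: rmorphXn. Qed.
Lemma embZt_nat n : embZt n%:R = n%:R. Proof. exact: rmorph_nat. Qed.

Lemma evals_embZt_div t0 p q : evalZt t0 q != 0 ->
  evals_to t0 (embZt p / embZt q) (evalZt t0 p / evalZt t0 q).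
Proof. by move=> q0; exists (polyZQ p), (polyZQ q). Qed.

(* Unfolding it makes unification compare fractions of polynomials, which blows up. *)
Opaque embZt.

(** * Points that reduce to the origin *)

Section Kernel.
Variables (a b c : int) (g : {poly int}) (t0 : rat).
Let ev := evalZt t0.
Let G := embZt g.

Hypothesis sep : no_repeated_roots (cubicQ a%:~R b%:~R c%:~R).
Hypothesis gt0 : ev g != 0.

Lemma no_common_primeNl (p q h : {poly int}) : h * h = 1 ->
  no_common_prime p q -> no_common_prime (h * p) q.
Proof.
move=> hh cop pi pp pih; apply: cop => //.
by rewrite -[p]mul1r -hh -mulrA; apply: divides_mull.
Qed.

(** For [x = p / q] in lowest terms the equation makes [q * M] a square with [M] prime to [q]. Hence
    [q] is a square up to sign, and the sign is moved to [p]. *)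
Lemma pole_representation x y : curve a b c g x y -> ~ regular_at t0 x ->
  exists p q z : {poly int}, [/\ q != 0, no_common_prime p q, ev q = 0 & ev p != 0] /\
   [/\ x = embZt p / embZt q ^+ 2 &
     z ^+ 2 = p ^+ 3 + a%:P * g * q ^+ 2 * p ^+ 2 + b%:P * g ^+ 2 * q ^+ 4 * p
              + c%:P * g ^+ 3 * q ^+ 6].
Proof.
move=> cxy nreg.
have [P0 [Q0 [Q00 cop ex0]]] := Qt_int_coprime x.
have [k [p [q [eP eQ nc]]]] := reduce_common ufd_Zt P0 Q00.
have [k0 q0] : k != 0 /\ q != 0 by move: Q00; rewrite eQ mulf_eq0 negb_or => /andP[].
have eq0 : embZt q != 0 by rewrite embZt_eq0.
have ex : x = embZt p / embZt q.
  have ek0 : embZt k != 0 by rewrite embZt_eq0.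
  by rewrite ex0 eP eQ (embZtM k p) (embZtM k q) (divf_common (embZt p) (embZt q) ek0).
have evq : ev q = 0.
  apply/eqP; apply: contraT => evq; case: nreg; exists (ev p / ev q).
  by rewrite ex; apply: evals_embZt_div.
(* [P0] and [Q0] are coprime over Q, so they cannot both vanish at [t0]. *)
have evp : ev p != 0.
  apply/negP => /eqP evp.
  have : root (polyZQ P0) t0 by rewrite /root -[_.[_]]/(ev P0) eP rmorphM evp mulr0.
  move/(coprimep_root cop); rewrite -[_.[_]]/(ev Q0) eQ rmorphM evq mulr0 eqxx.
  by [].
pose M := p ^+ 3 + a%:P * g * p ^+ 2 * q + b%:P * g ^+ 2 * p * q ^+ 2 + c%:P * g ^+ 3 * q ^+ 3.
have EM : (y * embZt q ^+ 2) ^+ 2 = embZt (q * M).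
  move: cxy; rewrite /curve ex => /(curve_clear_den eq0) ->.
  by rewrite /M !(embZtM, embZtD, embZtX, embZt_C).
(* The square of [y * q ^+ 2] lies in Z[t], so this element of Q(t) does too. *)
have [U [V [V0 _ eUV]]] := Qt_int_coprime (y * embZt q ^+ 2).
have [z _ Ez] : exists2 z, U = V * z & q * M = z ^+ 2.
  apply: (sqr_cancel ufd_Zt V0); apply: embZt_inj.
  have eV0 : embZt V != 0 by rewrite embZt_eq0.
  by rewrite (embZtM (V ^+ 2)) (embZtX V) (embZtX U) -EM eUV (mul_sqr_div (embZt U) eV0).
have [h [r [eqr sf]]] := sqfree_part ufd_Zt q0.
have [h0 r0] : h != 0 /\ r != 0.
  by move: q0; rewrite eqr mulf_eq0 expf_eq0 negb_or => /andP[].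
have [z' _ hM] : exists2 z', z = r * z' & h * M = z' ^+ 2.
  by apply: (sqr_cancel ufd_Zt r0); rewrite -Ez [in RHS]eqr; ring.
have hu : h \is a GRing.unit.
  apply: contraT => hnu; have [pi pp [h' eh]] := ufd_prime_divisor ufd_Zt h0 hnu.
  have [pi0 _ PP] := pp.
  have piq : divides pi q by rewrite eqr; apply: divides_mulr; exists h'.
  have [w ew] : divides pi z'.
    by apply: (@prime_exp _ pi z' 2 pp); rewrite -hM; apply: divides_mulr; exists h'.
  have : divides pi (h' * M).
    by exists (w ^+ 2); apply: (mulfI pi0); rewrite mulrA -eh hM ew; ring.
  case/PP => [[h'' eh'']|piM].
    by case: (sf pi pp); exists h''; rewrite eh eh''; ring.
  case: (nc pi pp _ piq); apply: (@prime_exp _ pi p 3 pp).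
  have -> : p ^+ 3 = M - (a%:P * g * p ^+ 2 + b%:P * g ^+ 2 * p * q + c%:P * g ^+ 3 * q ^+ 2) * q.
    by rewrite /M; ring.
  by apply: divides_sub => //; apply: divides_mull.
have hh : h * h = 1 by move/unitZtP: hu => [] ->; ring.
have evhr : ev h * ev h = 1 by rewrite -rmorphM hh rmorph1.
have evh : ev h != 0 by apply/eqP => e; move: evhr; rewrite e mul0r => /eqP; rewrite eq_sym oner_eq0.
exists (h * p), r, z'; split; split=> //.
- apply: no_common_primeNl => // pi pp pip pir; apply: (nc pi pp pip).
  by rewrite eqr expr2 mulrA; apply: divides_mull.
- move/eqP: evq; rewrite eqr rmorphM rmorphXn /= mulf_eq0 (negPf evh) /=.
  by rewrite expf_eq0 => /eqP.
- by rewrite rmorphM mulf_neq0.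
- have ehh : embZt h * embZt h = 1 by rewrite -embZtM hh; apply: (rmorph1 embZt).
  by rewrite ex eqr (embZtM h p) (embZtM h (r ^+ 2)) (embZtX r) (divf_involution _ _ ehh).
- rewrite -hM /M eqr.
  have [->|->] : h = 1 \/ h = -1 by apply/unitZtP.
    by ring.
  by ring.
Qed.

(** The only arithmetic input of the descent, to be supplied separately in the two cases. The
    denominator [q] is kept, so [p1 / q ^+ 2] need not be in lowest terms; [ev p1 != 0] is what
    preserves the pole. *)
Hypothesis halving : forall p q z : {poly int},
  q != 0 -> no_common_prime p q -> ev q = 0 -> ev p != 0 ->
  let A := a%:P * g * q ^+ 2 in
  let B := b%:P * g ^+ 2 * q ^+ 4 in
  let C := c%:P * g ^+ 3 * q ^+ 6 in
  z ^+ 2 = p ^+ 3 + A * p ^+ 2 + B * p + C ->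
  exists p1 z1, [/\ ev p1 != 0, z1 ^+ 2 = p1 ^+ 3 + A * p1 ^+ 2 + B * p1 + C &
    4 * z1 ^+ 2 * p = (p1 ^+ 2 - B) ^+ 2 - 8 * C * p1 - 4 * A * C].

Lemma halve_point x y : curve a b c g x y -> ~ regular_at t0 x ->
  exists x1 y1, [/\ curve a b c g x1 y1, ~ regular_at t0 x1 &
    4 * (cubic_form a b c x1 G) * x = dup_form a b c x1 G].
Proof.
move=> cxy /(pole_representation cxy) [p [q [z [[q0 nc evq evp] [-> Ez]]]]].
have [p1 [z1 [evp1 Ez1 Ed]]] := halving q0 nc evq evp Ez.
have eq0 : embZt q != 0 by rewrite embZt_eq0.
have E1 := congr1 embZt Ez1; have E2 := congr1 embZt Ed.
rewrite !(embZtM, embZtB, embZtD, embZtX, embZt_C, embZt_nat) in E1 E2.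
exists (embZt p1 / embZt q ^+ 2), (embZt z1 / embZt q ^+ 3); split.
- exact: (curve_of_integral eq0 E1).
- apply: (pole_div (evals_embZt _ _) evp1 _ eq0) => //.
  by rewrite -evq; apply: evals_embZt.
exact: (dup_of_integral eq0 E1 E2).
Qed.

Lemma kernel_trivial x y : curve a b c g x y -> regular_at t0 x.
Proof.
move=> cxy; apply: NNPP => nreg.
have [A [B [B0 _ eX]]] := Qt_coprime (x / G).
have [n] := ubnP (size B); elim: n x y cxy nreg A B B0 eX => // n IH x y cxy nreg A B B0 eX lt.
have g0 : g != 0 by apply: contraNneq gt0 => ->; rewrite rmorph0.
have G0 : G != 0 by rewrite embZt_eq0.
have [x1 [y1 [c1 nreg1 Ed]]] := halve_point cxy nreg.
have [A1 [B1 [B10 cop1 eX1]]] := Qt_coprime (x1 / G).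
have [B0' B10'] : toQt B != 0 /\ toQt B1 != 0 by rewrite !toQt_eq0.
have ex := divf_move G0 eX.
have ex1 := divf_move G0 eX1.
apply: (IH x1 y1 c1 nreg1 A1 B1 B10 eX1).
rewrite -ltnS; apply: leq_trans lt; rewrite ltnS; apply: (@dup_den_growth a b c sep A B A1 B1 cop1 B0).
  (* [G] is regular at [t0], so the pole of [x1] comes from [B1]; in particular [B1] is
     nonconstant. *)
  have rB1 : root B1 t0.
    apply/eqP; apply: NNPP => /eqP nz; apply: nreg1; rewrite ex1 -mulrA.
    by exists (ev g * (A1.[t0] / B1.[t0])); apply: evals_mul (evals_embZt _ _) _; exists A1, B1.
  exact: root_size_gt1 B10 rB1.
rewrite ex ex1 in Ed; have E := dup_homogeneous G0 B10' B0' Ed.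
apply: toQt_inj; rewrite !toQtM.
have -> : toQt 4 = 4 by apply: (rmorph_nat (@FracField.tofrac {poly rat})).
have -> : toQt (cubic_form a b c A1 B1) = cubic_form a b c (toQt A1) (toQt B1).
  exact: (rmorph_cubic_form _ _ _ (@FracField.tofrac {poly rat} : {rmorphism _ -> _})).
have -> : toQt (dup_form a b c A1 B1) = dup_form a b c (toQt A1) (toQt B1).
  exact: (rmorph_dup_form _ _ _ (@FracField.tofrac {poly rat} : {rmorphism _ -> _})).
exact: E.
Qed.

End Kernel.

(** If [g] vanished at [t0], the specialized cubic would be [x^3]. *)
Lemma curve_at_t0_nonzero (a b c : int) (g : {poly int}) (t0 : rat) :
  no_repeated_roots (cubicQ (a%:~R * (polyZQ g).[t0]) (b%:~R * (polyZQ g).[t0] ^+ 2)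
                            (c%:~R * (polyZQ g).[t0] ^+ 3)) ->
  evalZt t0 g != 0.
Proof.
move=> sep0; apply/negP => /eqP g0.
have := cubic_simple_root (u := 0) sep0; rewrite -[(polyZQ g).[t0]]/(evalZt t0 g) g0.
rewrite !expr0n /= !mulr0 !addr0 => /(_ erefl).
by rewrite eqxx.
Qed.


(** * Quadratic case *)

Section Subfield.
Variable rs : seq algC.

Lemma inK_closed : Defs.subfield_closed (inK rs).
Proof.
split; first by move=> S [S0 _] _.
split; first by move=> S [_ [S1 _]] _.
split; first by move=> x y Kx Ky S cS Srs; have [_ [_ [SD _]]] := cS; apply: SD; [apply: Kx|apply: Ky].
split; first by move=> x Kx S cS Srs; have [_ [_ [_ [SN _]]]] := cS; apply: SN; apply: Kx.
split; first by move=> x y Kx Ky S cS Srs; have [_ [_ [_ [_ [SM _]]]]] := cS; apply: SM; [apply: Kx|apply: Ky].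
by move=> x Kx x0 S cS Srs; have [_ [_ [_ [_ [_ SV]]]]] := cS; apply: SV => //; apply: Kx.
Qed.

Lemma inK_mem r : r \in rs -> inK rs r.
Proof. by move=> rrs S _; apply. Qed.

Lemma inK0 : inK rs 0. Proof. by case: inK_closed. Qed.
Lemma inK1 : inK rs 1. Proof. by case: inK_closed => _ []. Qed.
Lemma inKD x y : inK rs x -> inK rs y -> inK rs (x + y).
Proof. by case: inK_closed => _ [_ [H _]]; apply: H. Qed.
Lemma inKN x : inK rs x -> inK rs (- x).
Proof. by case: inK_closed => _ [_ [_ [H _]]]; apply: H. Qed.
Lemma inKM x y : inK rs x -> inK rs y -> inK rs (x * y).
Proof. by case: inK_closed => _ [_ [_ [_ [H _]]]]; apply: H. Qed.
Lemma inKV x : inK rs x -> inK rs x^-1.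
Proof.
have [->|x0 Kx] := eqVneq x 0; first by rewrite invr0.
by case: inK_closed => _ [_ [_ [_ [_ H]]]]; apply: H.
Qed.
Lemma inKB x y : inK rs x -> inK rs y -> inK rs (x - y).
Proof. by move=> Kx Ky; apply: inKD => //; apply: inKN. Qed.

Lemma inKX x n : inK rs x -> inK rs (x ^+ n).
Proof.
move=> Kx; elim: n => [|n IH]; first by rewrite expr0; apply: inK1.
by rewrite exprS; apply: inKM.
Qed.

Lemma inK_nat n : inK rs n%:R.
Proof. by elim: n => [|n IH]; [apply: inK0|rewrite -natr1; apply: inKD => //; apply: inK1]. Qed.

Lemma inK_int (k : int) : inK rs k%:~R.
Proof.
case: k => n; first exact: inK_nat.
by rewrite NegzE mulrNz; apply: inKN; apply: inK_nat.
Qed.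

Lemma inK_rat (q : rat) : inK rs (ratr q).
Proof. exact: inKM (inK_int _) (inKV (inK_int _)). Qed.

Variable tau : algC -> algC.
Hypothesis aut : field_aut rs tau.

Lemma autD x y : inK rs x -> inK rs y -> tau (x + y) = tau x + tau y.
Proof. by case: aut => H _; apply: H. Qed.
Lemma autM x y : inK rs x -> inK rs y -> tau (x * y) = tau x * tau y.
Proof. by case: aut => _ [H _]; apply: H. Qed.
Lemma aut1 : tau 1 = 1. Proof. by case: aut => _ [_ []]. Qed.
Lemma aut_inK x : inK rs x -> inK rs (tau x).
Proof. by case: aut => _ [_ [_ [H _]]]; apply: H. Qed.
Lemma aut0 : tau 0 = 0.
Proof. by have := autD inK0 inK0; rewrite addr0 => /eqP; rewrite -subr_eq0 opprD addrA subrr sub0r oppr_eq0 => /eqP. Qed.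
Lemma autN x : inK rs x -> tau (- x) = - tau x.
Proof.
move=> Kx; have := autD (inKN Kx) Kx; rewrite addNr aut0 => e.
by apply/eqP; rewrite -addr_eq0 -e.
Qed.
Lemma autB x y : inK rs x -> inK rs y -> tau (x - y) = tau x - tau y.
Proof. by move=> Kx Ky; rewrite autD ?autN //; apply: inKN. Qed.
Lemma autX x n : inK rs x -> tau (x ^+ n) = tau x ^+ n.
Proof.
move=> Kx; elim: n => [|n IH]; first by rewrite !expr0 aut1.
by rewrite !exprS autM ?IH //; apply: inKX.
Qed.
Lemma aut_nat n : tau n%:R = n%:R.
Proof.
elim: n => [|n IH]; first exact: aut0.
by rewrite -natr1 autD ?IH ?aut1 //; [apply: inK_nat|apply: inK1].
Qed.
Lemma aut_int (k : int) : tau k%:~R = k%:~R.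
Proof.
case: k => n; first exact: aut_nat.
by rewrite NegzE mulrNz autN ?aut_nat //; apply: inK_nat.
Qed.
Lemma aut_neq0 x : inK rs x -> x != 0 -> tau x != 0.
Proof.
move=> Kx x0; apply/eqP => tx; have := autM Kx (inKV Kx).
by rewrite divff // aut1 tx mul0r => /eqP; rewrite oner_eq0.
Qed.
Lemma autV x : inK rs x -> tau x^-1 = (tau x)^-1.
Proof.
move=> Kx; have [->|x0] := eqVneq x 0; first by rewrite invr0 aut0 invr0.
have tx0 := aut_neq0 Kx x0; apply: (mulfI tx0).
by rewrite -autM ?divff ?aut1 //; apply: inKV.
Qed.
Lemma aut_rat (q : rat) : tau (ratr q) = ratr q.
Proof.
have K1 := inK_int (numq q); have K2 := inK_int (denq q).
by rewrite /ratr (autM K1 (inKV K2)) (autV K2) !aut_int.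
Qed.
Lemma aut_inj x y : inK rs x -> inK rs y -> tau x = tau y -> x = y.
Proof.
move=> Kx Ky e; apply/eqP; rewrite -subr_eq0; apply: contraT => n0.
by have := aut_neq0 (inKB Kx Ky) n0; rewrite autB // e subrr eqxx.
Qed.

Lemma aut_fixed : (forall r, r \in rs -> tau r = r) -> forall x, inK rs x -> tau x = x.
Proof.
move=> H x Kx; suff [] : inK rs x /\ tau x = x by [].
apply: (Kx (fun x => inK rs x /\ tau x = x)); last first.
  by move=> r rrs; split; [apply: inK_mem|apply: H].
split; first by split; [apply: inK0|apply: aut0].
split; first by split; [apply: inK1|apply: aut1].
split; first by move=> u v [Ku eu] [Kv ev]; split; [apply: inKD|rewrite autD // eu ev].
split; first by move=> u [Ku eu]; split; [apply: inKN|rewrite autN // eu].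
split; first by move=> u v [Ku eu] [Kv ev]; split; [apply: inKM|rewrite autM // eu ev].
by move=> u [Ku eu] u0; split; [apply: inKV|rewrite autV // eu].
Qed.

End Subfield.

Lemma Aint_sqrt_int (s : algC) (d : int) : s ^+ 2 = d%:~R -> s \in Aint.
Proof.
move=> e; apply: (@root_monic_Aint ('X^2 - (d%:~R)%:P)).
- by rewrite rootE !hornerE e subrr.
- exact: monicXnsubC.
by rewrite (rpredB (rpredX _ (polyOverX _))) ?polyOverC ?rpred_int.
Qed.

(** As [d] is square-free, [k] is 1 or 2 up to sign, so [D] is [4 * d] or [d]. *)
Lemma quad_disc_arith (k D d : int) : sqfreeZ d -> k ^+ 2 * D = 4 * d -> (d %| D)%Z.
Proof.
move=> [d0 sf] E; have [/dvdzP[k' ek]|ko] := boolP (2 %| k)%Z.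
  have E' : k' ^+ 2 * D = d.
    apply: (@mulfI _ (4 : int)) => //; rewrite -E ek; ring.
  have k1 : `|k'| = 1 by apply: sf; rewrite -expr2 -E' dvdz_mulr.
  have k2 : k' ^+ 2 = 1 by rewrite -(real_normK (num_real k')) k1 expr1n.
  by rewrite -E' k2 mul1r.
have cop : coprimez (k ^+ 2) 4.
  rewrite -[4]/(2 ^+ 2 : int) coprimezXl // coprimezXr // coprimez_sym.
  by rewrite coprimezE; move: ko; rewrite dvdzE prime_coprime.
have kd : (k ^+ 2 %| d)%Z.
  by rewrite -(Gauss_dvdzr _ cop) -E dvdz_mulr.
have k1 : `|k| = 1 by apply: sf; rewrite -expr2.
have k2 : k ^+ 2 = 1 by rewrite -(real_normK (num_real k)) k1 expr1n.
by move: E; rewrite k2 mul1r => ->; rewrite dvdz_mull.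
Qed.

Lemma quad_vieta (a b : int) (th th' : algC) :
  ('X^2 + a%:~R *: 'X + (b%:~R)%:P : {poly algC}) = ('X - th%:P) * ('X - th'%:P) ->
  a%:~R = - (th + th') /\ b%:~R = th * th'.
Proof.
move=> E; have H x := congr1 (horner^~ x) E.
have := H 0; have := H 1; rewrite !hornerE /= => H1 H0.
move: H0; rewrite expr0n add0r mulrNN => e0.
split=> //; apply/eqP; rewrite -subr_eq0; apply/eqP.
move: H1; rewrite e0 => H1.
transitivity ((1 ^+ 2 + a%:~R + th * th') - (1 - th) * (1 - th')); first by ring.
by rewrite -H1; ring.
Qed.

(** The descent yields divisors of [d], whereas (A2) speaks of divisors of [D]. With [s] a square
    root of [d], the pair [(1, s)] has discriminant [4 * d], which is [D] times the square of its
    determinant in an integral basis. *)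
Lemma quad_field_disc_dvd (a b : int) (th th' : algC) (e d D : int) :
  ('X^2 + a%:~R *: 'X + (b%:~R)%:P : {poly algC}) = ('X - th%:P) * ('X - th'%:P) ->
  e != 0 -> a ^+ 2 - 4 * b = e ^+ 2 * d -> sqfreeZ d ->
  quad_field_disc [:: th; th'] D -> (d %| D)%Z.
Proof.
move=> /quad_vieta[ea eb] e0 Ed sfd [w1 [w2 [tau [[Kw1 _] [[Kw2 _] [basis [_ [aut [[x [Kx tx]] eD]]]]]]]]].
set rs := [:: th; th'] in Kw1 Kw2 basis aut Kx.
have Kth : inK rs th by apply: inK_mem; rewrite inE eqxx.
have Kth' : inK rs th' by apply: inK_mem; rewrite !inE eqxx orbT.
have eC0 : e%:~R != 0 :> algC by rewrite intr_eq0.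
pose s := (th - th') / e%:~R.
have es : s * e%:~R = th - th' by rewrite /s divfK.
have s2 : s ^+ 2 = d%:~R.
  have e20 : e%:~R ^+ 2 != 0 :> algC by rewrite expf_neq0.
  apply: (mulIf e20); rewrite -exprMn es mulrC -[e%:~R ^+ 2](rmorphXn intr) -intrM -Ed.
  by rewrite rmorphB rmorphXn rmorphM /= ea eb; ring.
have Ks : inK rs s := inKM (inKB Kth Kth') (inKV (inK_int _)).
have OKs : inOK rs s by split=> //; apply: Aint_sqrt_int s2.
have ts : tau s = - s.
  have : tau s ^+ 2 = s ^+ 2 by rewrite -(autX aut) // s2 (aut_int aut).
  move=> /eqP; rewrite eqf_sqr => /orP[/eqP ts|/eqP//].
  have two0 : (2 : algC) != 0 by rewrite pnatr_eq0.
  (* If [tau] fixed [s], it would fix both the sum and the difference of the roots, hence all of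
     [K]. *)
  case/eqP: tx; apply: (aut_fixed aut) => // r; rewrite !inE.
  have tb : tau (th - th') = th - th'.
    by rewrite -es (autM aut) ?ts ?(aut_int aut) //; apply: inK_int.
  have ta : tau (th + th') = th + th'.
    rewrite -[th + th']opprK -ea (autN aut) ?(aut_int aut) //; exact: inK_int.
  rewrite (autB aut) // in tb; rewrite (autD aut) // in ta.
  move=> /orP[] /eqP ->; apply: (mulfI two0).
    transitivity ((tau th + tau th') + (tau th - tau th')); first by ring.
    by rewrite ta tb; ring.
  transitivity ((tau th + tau th') - (tau th - tau th')); first by ring.
  by rewrite ta tb; ring.
have [n1 [n2 en]] : exists n1 n2 : int, 1 = n1%:~R * w1 + n2%:~R * w2.
  by apply/basis; split; [apply: inK1|apply: Aint1].
have [m1 [m2 em]] : exists m1 m2 : int, s = m1%:~R * w1 + m2%:~R * w2 by apply/basis.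
have tlin (k1 k2 : int) : tau (k1%:~R * w1 + k2%:~R * w2) = k1%:~R * tau w1 + k2%:~R * tau w2.
  have K1 : inK rs k1%:~R := inK_int _; have K2 : inK rs k2%:~R := inK_int _.
  rewrite (autD aut); [|exact: inKM|exact: inKM].
  by rewrite !(autM aut) // !(aut_int aut).
have := congr1 tau en; rewrite (aut1 aut) tlin => ten.
have := congr1 tau em; rewrite ts tlin => tem.
apply: (@quad_disc_arith (n1 * m2 - n2 * m1)) sfd _.
apply: (@intr_inj algC); rewrite rmorphM rmorphXn [RHS]rmorphM /= eD -s2.
rewrite rmorphB !rmorphM /= -exprMn.
have -> : (n1%:~R * m2%:~R - n2%:~R * m1%:~R) * (w1 * tau w2 - tau w1 * w2) =
  (n1%:~R * w1 + n2%:~R * w2) * (m1%:~R * tau w1 + m2%:~R * tau w2)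
  - (n1%:~R * tau w1 + n2%:~R * tau w2) * (m1%:~R * w1 + m2%:~R * w2) by ring.
by rewrite -en -em -ten -tem; ring.
Qed.

Lemma injective_quadratic_case (a b : int) (g : {poly int}) (t0 : rat) (th th' : algC) (e d D : int) :
  no_repeated_roots (cubicQ a%:~R b%:~R (0 : int)%:~R) ->
  (1 < size g)%N ->
  no_repeated_roots (cubicQ (a%:~R * (polyZQ g).[t0]) (b%:~R * (polyZQ g).[t0] ^+ 2)
                            ((0 : int)%:~R * (polyZQ g).[t0] ^+ 3)) ->
  ('X^2 + a%:~R *: 'X + (b%:~R)%:P : {poly algC}) = ('X - th%:P) * ('X - th'%:P) ->
  a ^+ 2 - 4 * b = e ^+ 2 * d -> sqfreeZ d ->
  quad_field_disc [:: th; th'] D ->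
  (forall h : {poly int}, (1 < size h)%N -> sqfreeZt h -> dvdZt h (b%:P * g) ->
     ~ is_square_Q (polyZQ h).[t0]) ->
  (forall h : {poly int}, (1 < size h)%N -> sqfreeZt h -> dvdZt h (e%:P * g) ->
     forall d' : int, sqfreeZ d' -> (d' %| D)%Z ->
     ~ is_square_Q (d'%:~R * (polyZQ h).[t0])) ->
  sigma_injective a b 0 g t0.
Proof.
move=> sep sg sep0 Eth Ed sfd disc A1 A2.
have gt0 := curve_at_t0_nonzero sep0.
have g0 : g != 0 by rewrite -size_poly_gt0 ltnW.
(* [e = 0] would give [th = th'], a double root of the cubic. *)
have e0 : e != 0.
  apply/negP => /eqP e0; have [ea eb] := quad_vieta Eth.
  have e2 : (th - th') ^+ 2 = 0.
    have := congr1 (intr : int -> algC) Ed; rewrite e0 expr0n mul0r rmorph0 => <-.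
    by rewrite rmorphB rmorphXn rmorphM /= ea eb; ring.
  move/eqP: e2; rewrite expf_eq0 /= subr_eq0 => /eqP eth.
  have := @cubic_simple_rootC _ _ _ th sep; rewrite !ratr_int ea eb eth => /(_ _) /eqP; apply.
    by ring.
  by ring.
have dD := quad_field_disc_dvd Eth e0 Ed sfd disc.
apply: (injective_of_kernel sep0); apply: (kernel_trivial sep gt0).
move=> p q z q0 nc evq evp A B C Ez.
have A2' (h : {poly int}) : (1 < size h)%N -> sqfreeZt h -> dvdZt h (e%:P * g) ->
    forall d' : int, sqfreeZ d' -> (d' %| d)%Z -> ~ is_square_Q (d'%:~R * evalZt t0 h).
  by move=> sh sfh dh d' sfd' dd'; apply: A2 => //; apply: dvdz_trans dD.
have Ez' : z ^+ 2 = p ^+ 3 + A * p ^+ 2 + B * p by rewrite Ez /C !mul0r addr0.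
have [p1 [z1 [evp1 E1 E2]]] :=
  @halving_two_torsion (evalZt t0) a b d e g p q z e0 sfd g0 q0 nc Ed A1 A2' evq evp Ez'.
exists p1, z1; split=> //; first by rewrite E1 /C !mul0r addr0.
by rewrite E2 /C !mul0r !mulr0 !mul0r !subr0.
Qed.


(** * Cyclic cubic fields and their rings of integers *)

(** Excluded middle makes membership boolean, so that [O_K] becomes a subtype inheriting its ring
    structure from [algC]. *)
Definition OKpred (rs : seq algC) : {pred algC} :=
  fun z => if excluded_middle_informative (inOK rs z) then true else false.

Lemma OKpredP rs z : reflect (inOK rs z) (z \in OKpred rs).
Proof.
rewrite unfold_in /OKpred; case: excluded_middle_informative => h; first exact: ReflectT.
exact: ReflectF.
Qed.

Lemma OKpred_subring rs : subring_closed (OKpred rs).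
Proof.
split=> [|x y /OKpredP[Kx Ax] /OKpredP[Ky Ay]|x y /OKpredP[Kx Ax] /OKpredP[Ky Ay]]; apply/OKpredP.
- by split; [apply: inK1|apply: Aint1].
- by split; [apply: inKB|apply: rpredB].
- by split; [apply: inKM|apply: rpredM].
Qed.

HB.instance Definition _ rs := GRing.isSubringClosed.Build algC (OKpred rs) (OKpred_subring rs).

Record OK (rs : seq algC) := MkOK { OKval :> algC; OKvalP : OKval \in OKpred rs }.

HB.instance Definition _ rs := [isSub for @OKval rs].
HB.instance Definition _ rs := [Choice of OK rs by <:].
HB.instance Definition _ rs := [SubChoice_isSubComNzRing of OK rs by <:].

Section OKring.
Variable rs : seq algC.
Local Notation OK := (OK rs).

Definition OKunit : {pred OK} := fun x => (val x != 0) && ((val x)^-1 \in OKpred rs).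
(** The default [x] makes the inverse the identity on nonunits. *)
Definition OKinv (x : OK) : OK := insubd x (val x)^-1.

Lemma OKmulVx : {in OKunit, left_inverse 1 OKinv *%R}.
Proof.
move=> x /andP[x0 Vx]; apply: val_inj; rewrite rmorphM rmorph1 /= /OKinv insubdK //.
by rewrite mulVf.
Qed.

Lemma OKunitPl (x y : OK) : y * x = 1 -> x \in OKunit.
Proof.
move=> /(congr1 val); rewrite rmorphM rmorph1 /= => e.
have x0 : val x != 0 by apply/eqP => x0; move/eqP: e; rewrite x0 mulr0 eq_sym oner_eq0.
rewrite unfold_in /OKunit x0 /=.
have -> : (val x)^-1 = val y by apply: (mulIf x0); rewrite mulVf.
exact: valP.
Qed.

Lemma OKinv_out : {in [predC OKunit], OKinv =1 id}.
Proof.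
move=> x; rewrite inE unfold_in /OKunit negb_and negbK => H; apply: val_inj; rewrite /OKinv val_insubd.
by case: ifP => // Vx; move: H; rewrite Vx orbF => /eqP ->; rewrite invr0.
Qed.

HB.instance Definition _ := GRing.ComNzRing_hasMulInverse.Build OK OKmulVx OKunitPl OKinv_out.

Lemma OKintegral (x y : OK) : x * y = 0 -> (x == 0) || (y == 0).
Proof.
move=> /(congr1 val); rewrite rmorphM rmorph0 /= => /eqP; rewrite mulf_eq0.
by move=> /orP[] /eqP h; apply/orP; [left|right]; apply/eqP; apply: val_inj; rewrite /= h.
Qed.

HB.instance Definition _ := GRing.ComUnitRing_isIntegral.Build OK OKintegral.

Lemma OKvalK (x : OK) : inOK rs (val x).
Proof. exact/OKpredP/valP. Qed.

Lemma OKlift z : inOK rs z -> exists x : OK, val x = z.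
Proof. by move=> /OKpredP zP; exists (MkOK zP). Qed.

End OKring.

(** * The field generated by a root of an irreducible polynomial *)

Section RationalGenerator.
Variables (rs : seq algC) (r : algC) (f : {poly rat}).
Hypotheses (irr : irreducible_poly f) (fr : root (map_poly ratr f) r).

Definition atr (x : algC) (P : {poly rat}) : algC := (map_poly ratr P).[x].

Lemma atrD x P Q : atr x (P + Q) = atr x P + atr x Q.
Proof. by rewrite /atr rmorphD hornerD. Qed.
Lemma atrM x P Q : atr x (P * Q) = atr x P * atr x Q.
Proof. by rewrite /atr rmorphM hornerM. Qed.
Lemma atrN x P : atr x (- P) = - atr x P.
Proof. by rewrite /atr rmorphN hornerN. Qed.
Lemma atrC x (k : rat) : atr x k%:P = ratr k.
Proof. by rewrite /atr map_polyC hornerC. Qed.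
Lemma atrX x : atr x 'X = x.
Proof. by rewrite /atr map_polyX hornerX. Qed.

Lemma inK_atr x P : inK rs x -> inK rs (atr x P).
Proof.
move=> Kx; elim/poly_ind: P => [|P k IH]; first by rewrite /atr rmorph0 horner0; apply: inK0.
rewrite atrD atrM atrX atrC; exact: inKD (inKM IH Kx) (inK_rat k).
Qed.

Lemma aut_atr tau x P : field_aut rs tau -> inK rs x -> tau (atr x P) = atr (tau x) P.
Proof.
move=> aut Kx; elim/poly_ind: P => [|P k IH]; first by rewrite /atr rmorph0 !horner0 (aut0 aut).
have KP := inK_atr P Kx.
rewrite !atrD !atrM !atrX !atrC (autD aut (inKM KP Kx) (inK_rat k)) (autM aut KP Kx) IH.
by rewrite (aut_rat aut).
Qed.

Lemma irreducible_dvd P : atr r P = 0 -> f %| P.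
Proof.
move=> P0; have [s1|s1] := eqVneq (size (gcdp f P)) 1%N.
  have /Bezout_eq1_coprimepP[[u v] /= e] : coprimep f P by rewrite /coprimep s1.
  have := congr1 (atr r) e; rewrite atrD !atrM P0 mulr0 addr0.
  have -> : atr r f = 0 by apply/eqP.
  rewrite mulr0 -[1]/(1%:P) atrC rmorph1 => /eqP; rewrite eq_sym oner_eq0.
  by [].
have /eqp_dvdl <- := irr.2 _ s1 (dvdp_gcdl f P); exact: dvdp_gcdr.
Qed.

Lemma atr_inverse P : atr r P != 0 -> exists Q, (atr r P)^-1 = atr r Q.
Proof.
move=> P0; have cop : coprimep f P.
  rewrite /coprimep; apply: contraNT P0 => s1.
  have /eqp_dvdl d := irr.2 _ s1 (dvdp_gcdl f P).
  have /dvdpP[Q ->] : f %| P by rewrite -d dvdp_gcdr.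
  rewrite atrM; have -> : atr r f = 0 by apply/eqP.
  by rewrite mulr0.
have /Bezout_eq1_coprimepP[[u v] /= e] := cop; exists v.
have := congr1 (atr r) e; rewrite atrD !atrM.
have -> : atr r f = 0 by apply/eqP.
rewrite mulr0 add0r -[1]/(1%:P) atrC rmorph1 => e1.
by apply: (mulIf P0); rewrite mulVf // e1.
Qed.

(** A relation satisfied by [r] is a multiple of [f], so it holds at every root; this makes the map
    [P(r)] to [P(x)] well defined. *)
Lemma atr_conj x P Q : root (map_poly ratr f) x -> atr r P = atr r Q -> atr x P = atr x Q.
Proof.
move=> fx e; have /dvdpP[R eR] : f %| P - Q.
  by apply: irreducible_dvd; rewrite atrD atrN e subrr.
apply/eqP; rewrite -subr_eq0 -atrN -atrD eR atrM; have -> : atr x f = 0 by apply/eqP.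
by rewrite mulr0.
Qed.

Lemma inK_generated : (forall x, x \in rs -> exists P, x = atr r P) ->
  forall z, inK rs z -> exists P, z = atr r P.
Proof.
move=> H z Kz; apply: (Kz (fun z => exists P, z = atr r P)) => //.
split; first by exists 0%:P; rewrite atrC rmorph0.
split; first by exists 1%:P; rewrite atrC rmorph1.
split; first by move=> x y [P ->] [Q ->]; exists (P + Q); rewrite atrD.
split; first by move=> x [P ->]; exists (- P); rewrite atrN.
split; first by move=> x y [P ->] [Q ->]; exists (P * Q); rewrite atrM.
by move=> x [P ->] /atr_inverse.
Qed.

End RationalGenerator.

Lemma vieta_cubic (a b c : int) (r1 r2 r3 : algC) :
  (forall x, x ^+ 3 + a%:~R * x ^+ 2 + b%:~R * x + c%:~R = (x - r1) * (x - r2) * (x - r3)) ->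
  [/\ a%:~R = - (r1 + r2 + r3), b%:~R = r1 * r2 + r1 * r3 + r2 * r3 &
      c%:~R = - (r1 * r2 * r3)].
Proof.
move=> H; have H0 := H 0; have H1 := H 1; have HN := H (-1).
have ec : c%:~R = - (r1 * r2 * r3).
  transitivity ((0 : algC) ^+ 3 + a%:~R * 0 ^+ 2 + b%:~R * 0 + c%:~R); first by ring.
  by rewrite H0; ring.
have two0 : (2 : algC) != 0 by rewrite pnatr_eq0.
have ea : a%:~R = - (r1 + r2 + r3).
  apply: (mulfI two0).
  transitivity (((1 : algC) ^+ 3 + a%:~R * 1 ^+ 2 + b%:~R * 1 + c%:~R) +
    ((-1 : algC) ^+ 3 + a%:~R * (-1) ^+ 2 + b%:~R * (-1) + c%:~R) - 2 * c%:~R); first by ring.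
  by rewrite H1 HN ec; ring.
split=> //.
transitivity (((1 : algC) ^+ 3 + a%:~R * 1 ^+ 2 + b%:~R * 1 + c%:~R) - 1 - a%:~R - c%:~R); first by ring.
by rewrite H1 ea ec; ring.
Qed.

(** * Galois action on the roots of a cyclic cubic *)

Section CyclicCubic.
Variables (a b c e : int).
Let f : {poly rat} := cubicQ a%:~R b%:~R c%:~R.
Hypothesis irr : irreducible_poly f.
Variables (rs : seq algC).

(** [rs] is tied to the roots by membership only, so that they can be renumbered while the field
    stays syntactically the same. *)
Record cubic_roots (r1 r2 r3 : algC) : Prop := CubicRoots {
  rootsP : forall x : algC, x ^+ 3 + a%:~R * x ^+ 2 + b%:~R * x + c%:~R =
             (x - r1) * (x - r2) * (x - r3);
  roots_disc : ((r1 - r2) * (r1 - r3) * (r2 - r3)) ^+ 2 = e%:~R ^+ 2;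
  roots_neq : [/\ r1 != r2, r1 != r3 & r2 != r3];
  roots_in : forall x, (x \in rs) = (x \in [:: r1; r2; r3]) }.

Lemma atr_cubic x : atr x f = x ^+ 3 + a%:~R * x ^+ 2 + b%:~R * x + c%:~R.
Proof.
rewrite /f /cubicQ !atrD atrC /atr !map_polyZ /= !map_polyXn map_polyX.
by rewrite !hornerZ !hornerXn hornerX !ratr_int.
Qed.

Lemma cubic_rootE r1 r2 r3 x : cubic_roots r1 r2 r3 ->
  root (map_poly ratr f) x = (x \in [:: r1; r2; r3]).
Proof.
move=> R; rewrite /root -/(atr x f) atr_cubic (rootsP R) !mulf_eq0 !subr_eq0 !inE orbA.
by [].
Qed.

Lemma cubic_roots_swap r1 r2 r3 : cubic_roots r1 r2 r3 -> cubic_roots r1 r3 r2.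
Proof.
move=> [H1 H2 [n12 n13 n23] H4]; split.
- by move=> x; rewrite H1; ring.
- by rewrite -H2; ring.
- by rewrite [r3 == _]eq_sym.
- by move=> x; rewrite H4 !inE [(x == r2) || _]orbC.
Qed.

Lemma cubic_roots_rot r1 r2 r3 : cubic_roots r1 r2 r3 -> cubic_roots r2 r3 r1.
Proof.
move=> [H1 H2 [n12 n13 n23] H4]; split.
- by move=> x; rewrite H1; ring.
- by rewrite -H2; ring.
- by rewrite n23 ![_ == r1]eq_sym.
- by move=> x; rewrite H4 !inE [RHS]orbA [RHS]orbC.
Qed.

Lemma cubic_vieta r1 r2 r3 : cubic_roots r1 r2 r3 ->
  [/\ a%:~R = - (r1 + r2 + r3), b%:~R = r1 * r2 + r1 * r3 + r2 * r3 &
      c%:~R = - (r1 * r2 * r3)].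
Proof. by move=> /rootsP; apply: vieta_cubic. Qed.

Lemma inK_root r1 r2 r3 : cubic_roots r1 r2 r3 -> [/\ inK rs r1, inK rs r2 & inK rs r3].
Proof. by move=> R; split; apply: inK_mem; rewrite (roots_in R) !inE eqxx ?orbT. Qed.

(** [r2 + r3] is [- a - r1], and [r2 - r3] is the rational number [e] or [- e] divided by
    [(r1 - r2) * (r1 - r3)], which is [f'(r1)]. So [r1] alone generates [K]. *)
Lemma cubic_generated r1 r2 r3 z : cubic_roots r1 r2 r3 -> inK rs z -> exists P, z = atr r1 P.
Proof.
move=> R; have [K1 K2 K3] := inK_root R; have [ea eb ec] := cubic_vieta R.
have fr : root (map_poly ratr f) r1 by rewrite (cubic_rootE _ R) inE eqxx.
apply: (inK_generated irr fr).
have [n12 n13 n23] := roots_neq R.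
have d0 : (r1 - r2) * (r1 - r3) != 0 by rewrite mulf_neq0 // subr_eq0.
have [D eD] : exists D : {poly rat}, (r1 - r2) * (r1 - r3) = atr r1 D.
  exists (3%:P * 'X * 'X + 2%:P * a%:~R%:P * 'X + b%:~R%:P).
  rewrite !atrD !atrM !atrC !atrX !ratr_int !ratr_nat ea eb; ring.
have [D' eD'] : exists D', (atr r1 D)^-1 = atr r1 D' by apply: (atr_inverse irr fr); rewrite -eD.
have [k ek] : exists k : rat, (r1 - r2) * (r1 - r3) * (r2 - r3) = ratr k.
  have := roots_disc R; move/eqP; rewrite eqf_sqr => /orP[] /eqP ->.
    by exists e%:~R; rewrite ratr_int.
  by exists (- e%:~R); rewrite rmorphN /= ratr_int.
have e23 : r2 - r3 = atr r1 (D' * k%:P).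
  rewrite atrM atrC -eD' -eD -ek mulKf //.
have two0 : (2 : algC) != 0 by rewrite pnatr_eq0.
have s23 : r2 + r3 = atr r1 (- (a%:~R)%:P - 'X).
  by rewrite atrD !atrN atrC atrX ratr_int ea; ring.
have half : ratr (2^-1) = 2^-1 :> algC by rewrite fmorphV /= ratr_nat.
move=> x; rewrite (roots_in R) !inE => /or3P[] /eqP ->.
- by exists 'X; rewrite atrX.
- exists ((2^-1)%:P * ((- (a%:~R)%:P - 'X) + D' * k%:P)).
  by rewrite atrM atrC atrD -e23 -s23 half; apply: (mulfI two0); rewrite mulVKf //; ring.
- exists ((2^-1)%:P * ((- (a%:~R)%:P - 'X) - D' * k%:P)).
  by rewrite atrM atrC atrD atrN -e23 -s23 half; apply: (mulfI two0); rewrite mulVKf //; ring.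
Qed.

Lemma exists_conj_aut r1 r2 r3 : cubic_roots r1 r2 r3 ->
  exists2 s, field_aut rs s & s r1 = r2.
Proof.
move=> R; have [K1 K2 K3] := inK_root R.
have fr1 : root (map_poly ratr f) r1 by rewrite (cubic_rootE _ R) inE eqxx.
have fr2 : root (map_poly ratr f) r2 by rewrite (cubic_rootE _ R) !inE eqxx orbT.
(* A representing polynomial is chosen, with value 0 outside [K]; [atr_conj] makes the result
   independent of the choice. *)
pose s z := match excluded_middle_informative (exists P, z = atr r1 P) with
  | left ex => atr r2 (proj1_sig (constructive_indefinite_description _ ex))
  | right _ => 0 end.
have sE P : s (atr r1 P) = atr r2 P.
  rewrite /s; case: excluded_middle_informative => [ex|[]]; last by exists P.
  case: constructive_indefinite_description => Q /= eQ; exact: (atr_conj irr fr1 fr2 (esym eQ)).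
exists s; last by rewrite -{1}[r1]atrX sE atrX.
have gen := cubic_generated R; have gen2 := cubic_generated (cubic_roots_rot R).
split; first by move=> x y /gen[P ->] /gen[Q ->]; rewrite -atrD !sE atrD.
split; first by move=> x y /gen[P ->] /gen[Q ->]; rewrite -atrM !sE atrM.
split; first by have := sE 1%:P; rewrite !atrC rmorph1.
split; first by move=> x /gen[P ->]; rewrite sE; apply: inK_atr.
by move=> y /gen2[P ->]; exists (atr r1 P); split; [apply: inK_atr|apply: sE].
Qed.

Variable tau : algC -> algC.
Hypothesis gen : gal_generator rs tau.
Let aut : field_aut rs tau := proj1 gen.

Lemma aut_root r1 r2 r3 x : cubic_roots r1 r2 r3 -> x \in [:: r1; r2; r3] ->
  tau x \in [:: r1; r2; r3].
Proof.
move=> R xin; have Kx : inK rs x by apply: inK_mem; rewrite (roots_in R).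
rewrite -(cubic_rootE _ R) /root -/(atr _ f) -(aut_atr f aut Kx).
have -> : atr x f = 0 by apply/eqP; move: xin; rewrite -(cubic_rootE _ R).
by rewrite (aut0 aut).
Qed.

(** A generator fixing [r1] would make every automorphism fix it, yet one of them sends [r1] to
    [r2]. *)
Lemma aut_moves r1 r2 r3 : cubic_roots r1 r2 r3 -> tau r1 != r1.
Proof.
move=> R; have [K1 K2 K3] := inK_root R; have [s sa s1] := exists_conj_aut R.
apply/negP => /eqP t1; have [k sk] := proj2 gen s sa.
have it n : iter n tau r1 = r1 by elim: n => //= n ->.
by have [/eqP[]] := roots_neq R; rewrite -s1 sk ?it.
Qed.

(** The only alternative exchanges [r1] and [r2] and fixes [r3]; it would change the sign of the
    square root of the discriminant, which is rational. *)
Lemma aut_cycle r1 r2 r3 : cubic_roots r1 r2 r3 -> tau r1 = r2 -> tau r2 = r3 /\ tau r3 = r1.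
Proof.
move=> R t1; have [K1 K2 K3] := inK_root R; have [n12 n13 n23] := roots_neq R.
have t2in : tau r2 \in [:: r1; r2; r3] by apply: (aut_root R); rewrite !inE eqxx orbT.
have t3in : tau r3 \in [:: r1; r2; r3] by apply: (aut_root R); rewrite !inE eqxx !orbT.
have inj := aut_inj aut.
have t2n : tau r2 != r2 by apply: contraNneq n12 => h; apply/eqP/inj; rewrite // t1 h.
have t3n : tau r3 != r2 by apply: contraNneq n13 => h; apply/eqP/inj; rewrite // t1 h.
have t32 : tau r3 != tau r2 by apply: contraNneq n23 => h; apply/eqP/inj; rewrite // h.
move: t2in t3in; rewrite !inE (negPf t2n) (negPf t3n) /= => /orP[] /eqP t2 /orP[] /eqP t3.
- by rewrite t2 t3 eqxx in t32.
- have Dn : (r1 - r2) * (r1 - r3) * (r2 - r3) != 0 by rewrite !mulf_neq0 // subr_eq0.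
  have tD : tau ((r1 - r2) * (r1 - r3) * (r2 - r3)) = (r1 - r2) * (r1 - r3) * (r2 - r3).
    have := roots_disc R; move/eqP; rewrite eqf_sqr => /orP[] /eqP ->.
      exact: aut_int aut _.
    by rewrite (autN aut (inK_int _)) (aut_int aut).
  move: tD; have KB x y : inK rs x -> inK rs y -> inK rs (x - y) by apply: inKB.
  rewrite (autM aut (inKM (KB _ _ K1 K2) (KB _ _ K1 K3)) (KB _ _ K2 K3)).
  rewrite (autM aut (KB _ _ K1 K2) (KB _ _ K1 K3)) !(autB aut) // t1 t2 t3 => h.
  have two0 : (2 : algC) != 0 by rewrite pnatr_eq0.
  case/eqP: Dn; apply: (mulfI two0); rewrite mulr0.
  rewrite -[2]/(1 + 1) mulrDl mul1r -{1}h; ring.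
- by rewrite t2 t3.
- by rewrite t2 t3 eqxx in t32.
Qed.

Lemma aut_cyclic r1 r2 r3 : cubic_roots r1 r2 r3 -> exists s1 s2 s3, cubic_roots s1 s2 s3 /\
  [/\ tau s1 = s2, tau s2 = s3 & tau s3 = s1].
Proof.
move=> R; have : tau r1 \in [:: r1; r2; r3] by apply: (aut_root R); rewrite inE eqxx.
rewrite !inE (negPf (aut_moves R)) /= => /orP[] /eqP t1.
  by have [t2 t3] := aut_cycle R t1; exists r1, r2, r3.
by have [t2 t3] := aut_cycle (cubic_roots_swap R) t1; exists r1, r3, r2; split=> //; apply: cubic_roots_swap.
Qed.

End CyclicCubic.


(** * Galois action on integers and on polynomials over them *)

Lemma Aint_sqr (x : algC) : x ^+ 2 \in Aint -> x \in Aint.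
Proof.
move=> x2; have r0 := root_minCpoly (x ^+ 2); have m0 := minCpoly_monic (x ^+ 2).
apply: (@root_monic_Aint (minCpoly (x ^+ 2) \Po 'X^2)).
- by rewrite /root horner_comp hornerXn.
- rewrite monicE lead_coef_comp ?size_polyXn // (monicP m0) mul1r lead_coefXn expr1n.
  by [].
by apply: polyOver_comp => //; rewrite rpredX // polyOverX.
Qed.

Lemma atr_int x (p : {poly int}) : atr x (map_poly intr p) = (map_poly intr p).[x].
Proof.
rewrite /atr -map_poly_comp; congr (_.[x]).
by apply: eq_map_poly => k /=; rewrite ratr_int.
Qed.

Lemma aut_Aint rs tau z : field_aut rs tau -> inK rs z -> z \in Aint -> tau z \in Aint.
Proof.
move=> aut Kz Az; have /floorpP[p ep] : minCpoly z \is a polyOver Num.int by [].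
apply: (@root_monic_Aint (minCpoly z)) => //; last exact: minCpoly_monic.
rewrite ep /root -atr_int -(aut_atr _ aut Kz) atr_int -ep.
by rewrite (rootP (root_minCpoly z)) (aut0 aut).
Qed.

Lemma aut_inOK rs tau z : field_aut rs tau -> inOK rs z -> inOK rs (tau z).
Proof. by move=> aut [Kz Az]; split; [apply: aut_inK|apply: aut_Aint aut Kz Az]. Qed.

Section TauOK.
Variables (rs : seq algC) (tau : algC -> algC) (aut : field_aut rs tau).

Definition tauO (x : OK rs) : OK rs :=
  MkOK (introT (OKpredP rs _) (aut_inOK aut (OKvalK x))).

Lemma val_tauO x : val (tauO x) = tau (val x). Proof. by []. Qed.

Lemma tauO_zmod : zmod_morphism tauO.
Proof.
move=> x y; apply: val_inj; rewrite /= (autB aut) //; last exact: (OKvalK y).1.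
exact: (OKvalK x).1.
Qed.

Lemma tauO_monoid : monoid_morphism tauO.
Proof.
split=> [|x y]; apply: val_inj; rewrite /= ?(aut1 aut) //.
by rewrite (autM aut) //; [exact: (OKvalK x).1|exact: (OKvalK y).1].
Qed.

HB.instance Definition _ := GRing.isZmodMorphism.Build (OK rs) (OK rs) tauO tauO_zmod.
HB.instance Definition _ := GRing.isMonoidMorphism.Build (OK rs) (OK rs) tauO tauO_monoid.

Definition tauP : {rmorphism {poly OK rs} -> {poly OK rs}} := map_poly tauO.
Definition jP : {rmorphism {poly int} -> {poly OK rs}} := map_poly intr.
Definition valQ : {rmorphism {poly OK rs} -> {poly algC}} := map_poly (val : OK rs -> algC).
Definition evalO (t0 : rat) : {rmorphism {poly OK rs} -> algC} := horner_eval (ratr t0) \o valQ.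

Lemma evalOE t0 P : evalO t0 P = (map_poly (val : OK rs -> algC) P).[ratr t0].
Proof. by []. Qed.

Lemma evalO_cons t0 (Q : {poly OK rs}) (l : OK rs) :
  evalO t0 (Q * 'X + l%:P) = evalO t0 Q * ratr t0 + val l.
Proof.
have eX : map_poly (val : OK rs -> algC) 'X = 'X by rewrite map_polyX.
have eC : map_poly (val : OK rs -> algC) l%:P = (val l)%:P by rewrite map_polyC.
rewrite !evalOE rmorphD rmorphM /= [map_poly _ 'X]eX [map_poly _ l%:P]eC.
by rewrite hornerD hornerM hornerX hornerC.
Qed.

Lemma OKval_int (k : int) : val (k%:~R : OK rs) = k%:~R.
Proof. exact: (rmorph_int (val : {rmorphism OK rs -> algC})). Qed.

Lemma map_tau_valQ (P : {poly OK rs}) : map_poly tau (valQ P) = valQ (tauP P).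
Proof.
apply/polyP => i; rewrite coef_map_id0 ?(aut0 aut) // !coef_map /=.
by [].
Qed.

Lemma map_tau2_valQ (P : {poly OK rs}) : map_poly (tau \o tau) (valQ P) = valQ (tauP (tauP P)).
Proof.
rewrite -!map_tau_valQ; apply/polyP => i.
by rewrite !coef_map_id0 ?(aut0 aut) //= !(aut0 aut).
Qed.

Lemma inK_evalO t0 P : inK rs (evalO t0 P).
Proof.
elim/poly_ind: P => [|P k IH]; first by rewrite rmorph0; apply: inK0.
rewrite evalO_cons; exact: inKD (inKM IH (inK_rat t0)) (OKvalK k).1.
Qed.

Lemma evalO_tau t0 P : evalO t0 (tauP P) = tau (evalO t0 P).
Proof.
elim/poly_ind: P => [|P k IH]; first by rewrite !rmorph0 (aut0 aut).
have Kk : inK rs (val k) := (OKvalK k).1; have Kt : inK rs (ratr t0) := inK_rat t0.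
have -> : tauP (P * 'X + k%:P) = tauP P * 'X + (tauO k)%:P.
  by rewrite rmorphD rmorphM /= map_polyX map_polyC.
rewrite !evalO_cons IH (autD aut (inKM (inK_evalO _ _) Kt) Kk) (autM aut (inK_evalO _ _) Kt).
by rewrite (aut_rat aut).
Qed.

Lemma evalO_jP t0 p : evalO t0 (jP p) = ratr (evalZt t0 p).
Proof.
have -> : ratr (evalZt t0 p) = (map_poly ratr (map_poly intr p)).[ratr t0] :> algC.
  by rewrite -[evalZt t0 p]/((map_poly intr p).[t0]) -horner_map.
rewrite evalOE -[jP p]/(map_poly intr p) -!map_poly_comp; congr (_.[_]).
by apply: eq_map_poly => k /=; rewrite -[OKval _]/(val _) OKval_int ratr_int.
Qed.

Lemma jP_inj : injective jP.
Proof.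
apply: map_inj_poly; last exact: mulr0z.
by move=> x y /(congr1 val); rewrite !OKval_int => /intr_inj.
Qed.

Lemma tauP_jP p : tauP (jP p) = jP p.
Proof.
rewrite /= -map_poly_comp; apply: eq_map_poly => k /=; exact: rmorph_int.
Qed.

Lemma polyOK_valQ P : polyOK rs (valQ P).
Proof. by move=> i; rewrite coef_map /=; apply: OKvalK. Qed.

Lemma polyOK_lift Q : polyOK rs Q -> exists P, Q = valQ P.
Proof.
move=> HQ; exists (\poly_(i < size Q) (insubd (0 : OK rs) Q`_i)).
apply/polyP => i; rewrite coef_map coef_poly; case: ltnP => h; last first.
  by rewrite /= nth_default.
by rewrite /= insubdK //; apply/OKpredP.
Qed.

Lemma valQ_inj : injective valQ.
Proof. by apply: map_inj_poly; [apply: val_inj|]. Qed.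

End TauOK.

(** * Trace, norm and unique factorization in a cyclic cubic ring of integers *)

Section NormedOrder.
Variables (a b c e : int) (rs : seq algC) (tau : algC -> algC) (r1 r2 r3 : algC).
Hypothesis irr : irreducible_poly (cubicQ a%:~R b%:~R c%:~R).
Hypothesis R : cubic_roots a b c e rs r1 r2 r3.
Hypothesis aut : field_aut rs tau.
Hypotheses (t1 : tau r1 = r2) (t2 : tau r2 = r3) (t3 : tau r3 = r1).

Lemma tau_cubed z : inK rs z -> tau (tau (tau z)) = z.
Proof.
have [K1 K2 K3] := inK_root R.
by move=> /(cubic_generated irr R)[P ->]; rewrite !(aut_atr _ aut) ?t1 ?t2 ?t3.
Qed.

(** Newton's recurrence, with three consecutive sums carried along. Traces of polynomials in [r1]
    are thereby rational. *)
Lemma power_sum_rat n : r1 ^+ n + r2 ^+ n + r3 ^+ n \in Crat.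
Proof.
have [ea eb ec] := cubic_vieta R.
have Ci (k : int) : (k%:~R : algC) \in Crat by apply: rpred_int.
have [//] : [/\ r1 ^+ n + r2 ^+ n + r3 ^+ n \in Crat,
  r1 ^+ n.+1 + r2 ^+ n.+1 + r3 ^+ n.+1 \in Crat &
  r1 ^+ n.+2 + r2 ^+ n.+2 + r3 ^+ n.+2 \in Crat].
elim: n => [|n [H0 H1 H2]]; split=> //.
- by rewrite !expr0 !rpredD ?rpred1.
- have -> : r1 ^+ 1 + r2 ^+ 1 + r3 ^+ 1 = - a%:~R by rewrite ea; ring.
  by rewrite rpredN.
- have -> : r1 ^+ 2 + r2 ^+ 2 + r3 ^+ 2 = a%:~R ^+ 2 - b%:~R - b%:~R by rewrite ea eb; ring.
  by rewrite !rpredB ?rpredX.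
have -> : r1 ^+ n.+3 + r2 ^+ n.+3 + r3 ^+ n.+3 =
  - a%:~R * (r1 ^+ n.+2 + r2 ^+ n.+2 + r3 ^+ n.+2)
  - b%:~R * (r1 ^+ n.+1 + r2 ^+ n.+1 + r3 ^+ n.+1) - c%:~R * (r1 ^+ n + r2 ^+ n + r3 ^+ n).
  by rewrite ea eb ec !exprS; ring.
by rewrite !rpredB ?rpredM ?rpredN.
Qed.

Lemma trace_rat z : inK rs z -> z + tau z + tau (tau z) \in Crat.
Proof.
have [K1 K2 K3] := inK_root R.
move=> /(cubic_generated irr R)[P ->]; rewrite !(aut_atr _ aut) ?t1 ?t2 //.
rewrite /atr !horner_coef -!big_split /=; apply: rpred_sum => i _.
rewrite -!mulrDr rpredM ?power_sum_rat // coef_map /=.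
exact: Crat_rat.
Qed.

(** A fixed element is a third of its trace, hence rational, and a rational algebraic integer is an
    integer. *)
Lemma fixed_int (x : OK rs) : tauO aut x = x -> exists k : int, x = k%:~R.
Proof.
move=> fx; have [Kx Ax] := OKvalK x; have tx : tau (val x) = val x by rewrite -(val_tauO aut) fx.
have three0 : (3 : algC) != 0 by rewrite pnatr_eq0.
have Qx : val x \in Crat.
  have -> : val x = (val x + tau (val x) + tau (tau (val x))) / 3.
    by apply: (mulIf three0); rewrite divfK // !tx; ring.
  by rewrite rpredM ?trace_rat // rpredV rpred_nat.
have /intrP[k ek] := Cint_rat_Aint Qx Ax.
by exists k; apply: val_inj; rewrite OKval_int ek.
Qed.

Local Notation tO := (tauO aut).

Lemma tauO_cubed x : tO (tO (tO x)) = x.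
Proof. by apply: val_inj; rewrite !val_tauO tau_cubed //; case: (OKvalK x). Qed.

(** The norm is the image of an integer, which the floor extracts without a choice. *)
Definition normO (x : OK rs) : int := Num.floor (val (cnorm (tauO aut : {rmorphism OK rs -> OK rs}) x)).

Lemma normOE x : (normO x)%:~R = cnorm (tauO aut : {rmorphism OK rs -> OK rs}) x.
Proof.
have [k ek] := fixed_int (tau_cnorm (tau := tauO aut : {rmorphism OK rs -> OK rs}) tauO_cubed x).
by rewrite /normO ek OKval_int intrKfloor.
Qed.

Lemma OKint_inj : injective (intr : int -> OK rs).
Proof. by move=> x y /(congr1 val); rewrite !OKval_int => /intr_inj. Qed.

Lemma normOM x y : normO (x * y) = normO x * normO y.
Proof. by apply: OKint_inj; rewrite rmorphM /= !normOE cnormM. Qed.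

Lemma normO_eq0 x : (normO x == 0) = (x == 0).
Proof.
by rewrite -(inj_eq OKint_inj) normOE rmorph0 (cnorm_eq0 (tau := tauO aut : {rmorphism OK rs -> OK rs}) tauO_cubed).
Qed.

Lemma normO_unit x : `|normO x|%N = 1%N -> x \is a GRing.unit.
Proof.
move=> h; have nu : normO x \is a GRing.unit by case: (normO x) h => [[|[|]]|[|]].
have : cnorm (tauO aut : {rmorphism OK rs -> OK rs}) x \is a GRing.unit.
  by rewrite -normOE; apply: (rmorph_unit (intr : {rmorphism int -> OK rs})).
by rewrite /cnorm !unitrM => /andP[/andP[]].
Qed.

Hypothesis cn1 : class_number_one rs.

(** Class number one, applied to the ideal generated by [x] and [y]. *)
Lemma OK_bezout (x y : OK rs) : exists d u v, [/\ d = u * x + v * y, divides d x & divides d y].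
Proof.
pose I z := exists u v : OK rs, z = val (u * x + v * y).
have [|al [OKal HI]] := @cn1 I.
  split; first by move=> z [u [v ->]]; apply: OKvalK.
  split; first by exists 0, 0; rewrite !mul0r addr0 rmorph0.
  split.
    move=> z z' [u [v ->]] [u' [v' ->]]; exists (u + u'), (v + v').
    by rewrite -rmorphD; congr val; ring.
  move=> r z /OKlift[k <-] [u [v ->]]; exists (k * u), (k * v).
  by rewrite -rmorphM; congr val; ring.
have [d ed] := OKlift OKal.
have [u [v euv]] : I al.
  by apply/HI; exists 1; split; [split; [apply: inK1|apply: Aint1]|rewrite mulr1].
have dI z : I (val z) -> divides d z.
  move=> /HI[be [/OKlift[k ek] e']]; exists k; apply: val_inj.
  by rewrite rmorphM /= e' -ek -ed.
exists d, u, v; split.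
- by apply: val_inj; rewrite ed euv.
- by apply: dI; exists 1, 0; rewrite mul1r mul0r addr0.
- by apply: dI; exists 0, 1; rewrite mul1r mul0r add0r.
Qed.

Lemma ufd_OK : ufd (OK rs).
Proof.
apply: (@ufd_bezout _ (fun x => `|normO x|%N)); last exact: OK_bezout.
- move=> x y; rewrite mulf_eq0 negb_or -!normO_eq0 -!absz_gt0 => /andP[_ y0].
  by rewrite normOM abszM leq_pmulr.
- move=> x y; rewrite mulf_eq0 negb_or -!normO_eq0 -!absz_gt0 => /andP[x0 y0] yu.
  rewrite normOM abszM -[X in (X < _)%N]muln1 ltn_pmul2l // ltn_neqAle y0 andbT eq_sym.
  by apply: contra yu => /eqP; apply: normO_unit.
Qed.

Lemma tauP_cubed P : tauP aut (tauP aut (tauP aut P)) = P.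
Proof. by apply/polyP => i; rewrite !coef_map /= tauO_cubed. Qed.

Lemma tauP_fixed P : tauP aut P = P -> exists p, P = jP rs p.
Proof.
move=> fP; exists (\poly_(i < size P) Num.floor (val P`_i)).
apply/polyP => i; rewrite coef_map coef_poly.
have [k ek] : exists k : int, P`_i = k%:~R.
  by apply: fixed_int; rewrite -[in RHS]fP coef_map.
case: ltnP => h; last by rewrite nth_default // rmorph0.
by rewrite ek OKval_int intrKfloor.
Qed.

End NormedOrder.


(** * Halving in the cyclic case *)

Lemma primeZtP h : irreducible_elt h -> primeZt h.
Proof.
move=> [h0 hu hP]; split; first exact/eqP.
split; first by move/unitZtP; rewrite (negPf hu).
by move=> q r /hP[] /unitZtP; [left|right].
Qed.

Lemma pairwise_nassocP (A B : idomainType) (l : seq (B * A * 'I_4)) x0 i k :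
  pairwise_nassoc l -> (i < size l)%N -> (k < size l)%N -> i != k ->
  forall u, u \is a GRing.unit -> (nth x0 l i).1.1 <> u * (nth x0 l k).1.1.
Proof.
elim: l i k => // y l IH [|i] [|k] //= [H1 H2] lti ltk ne u uu.
- by apply: H1 => //; apply: mem_nth.
- move=> e; apply: (H1 _ (mem_nth x0 lti) u^-1); first by rewrite unitrV.
  by rewrite e mulKr.
- exact: IH.
Qed.

(* Halving a point: if [x - e_i = s_i^2] for the three roots [e_i] of the cubic, then
   the point [(x1, y1)] doubles to a point of abscissa [x]. *)
Lemma halving_identities (R : comPzRingType) (x s1 s2 s3 : R) :
  let e1 := x - s1 ^+ 2 in let e2 := x - s2 ^+ 2 in let e3 := x - s3 ^+ 2 in
  let A := - (e1 + e2 + e3) in let B := e1 * e2 + e1 * e3 + e2 * e3 in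
  let C := - (e1 * e2 * e3) in
  let x1 := x + (s1 * s2 + s1 * s3 + s2 * s3) in
  let y1 := (s1 + s2) * (s1 + s3) * (s2 + s3) in
  y1 ^+ 2 = x1 ^+ 3 + A * x1 ^+ 2 + B * x1 + C /\
  4 * y1 ^+ 2 * x = (x1 ^+ 2 - B) ^+ 2 - 8 * C * x1 - 4 * A * C.
Proof. by split; ring. Qed.

(** * Dictionary between polynomials over [OK rs] and over [algC] *)

Section Transfer.
Variables (rs : seq algC) (tau : algC -> algC) (aut : field_aut rs tau).
Local Notation A := {poly OK rs}.

Lemma unitOKt_lift (P : A) : unitOKt rs (valQ rs P) -> P \is a GRing.unit.
Proof.
move=> [_ [Q [/polyOK_lift[Q' ->] e]]].
have e1 : P * Q' = 1 by apply: (@valQ_inj rs); rewrite rmorphM e rmorph1.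
by apply: (@divides_unit _ P 1) (unitr1 _) _; exists Q'.
Qed.

Lemma unit_unitOKt (P : A) : P \is a GRing.unit -> unitOKt rs (valQ rs P).
Proof.
move=> Pu; split; first exact: polyOK_valQ.
exists (valQ rs P^-1); split; first exact: polyOK_valQ.
by rewrite -rmorphM divrr // rmorph1.
Qed.

Lemma prime_irredOKt (P : A) : prime_elt P -> irredOKt rs (valQ rs P).
Proof.
move=> [P0 Pu PP]; split; first exact: polyOK_valQ.
split; first by move=> e; case/eqP: P0; apply: (@valQ_inj rs); rewrite e rmorph0.
split; first by move/unitOKt_lift; rewrite (negPf Pu).
have K (Q' R' : A) : P = Q' * R' -> divides P Q' -> R' \is a GRing.unit.
  move=> e [k ek]; apply: (@divides_unit _ R' 1) (unitr1 _) _; exists k.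
  by apply: (mulfI P0); rewrite mulr1 {1}e ek; ring.
move=> Q R /polyOK_lift[Q' ->] /polyOK_lift[R' ->]; rewrite -rmorphM => /(@valQ_inj rs) e.
have [|d|d] := PP Q' R'; first by rewrite -e; apply: divides_refl.
- by right; apply/unit_unitOKt/(K Q').
- by left; apply/unit_unitOKt/(K R') => //; rewrite mulrC.
Qed.

Lemma associateOKt_lift (P Q : A) : associateOKt rs (valQ rs P) (valQ rs Q) -> associate P Q.
Proof.
move=> [u [uu e]]; have [uO _] := uu; have [u' eu] := polyOK_lift uO.
exists u'; first by apply: unitOKt_lift; rewrite -eu.
by apply: (@valQ_inj rs); rewrite rmorphM -eu.
Qed.

Lemma choose_factors_valQ (s : 'I_4) (P : A) :
  choose_factors tau s (valQ rs P) = valQ rs (choose_conj (tauP aut) s P).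
Proof.
rewrite /choose_factors /choose_conj (map_tau_valQ aut) (map_tau2_valQ aut).
by case: (val s) => [|[|[|k]]]; rewrite ?rmorph1 ?rmorphM.
Qed.

Lemma unit_polyC (P : A) : P \is a GRing.unit -> exists2 x : OK rs, P = x%:P & unitOK rs (val x).
Proof.
rewrite poly_unitE => /andP[/eqP s u].
exists P`_0; first by apply: size1_polyC; rewrite s.
split; first exact: OKvalK.
exists (val (P`_0)^-1); split; first exact: OKvalK.
by rewrite -rmorphM divrr // rmorph1.
Qed.

End Transfer.

Section HalvingCyclic.
Variables (a b c e : int) (rs : seq algC) (tau : algC -> algC) (r1 r2 r3 : algC).
Hypothesis irr : irreducible_poly (cubicQ a%:~R b%:~R c%:~R).
Hypothesis R : cubic_roots a b c e rs r1 r2 r3.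
Hypothesis aut : field_aut rs tau.
Hypotheses (t1 : tau r1 = r2) (t2 : tau r2 = r3) (t3 : tau r3 = r1).
Hypothesis cn1 : class_number_one rs.
Variables (g : {poly int}) (t0 : rat).
Hypothesis condB : forall (n : nat) (H : 'I_n -> {poly int}) (P : 'I_n -> {poly algC})
    (s : 'I_n -> 'I_4),
  (forall i, dvdZt (H i) (e%:P * g) /\ splits_as rs tau (H i) (P i)) ->
  (forall i j, i != j -> H i <> H j /\ H i <> - H j) ->
  let h := \prod_(i < n) choose_factors tau (s i) (P i) in
  (1 < size h)%N ->
  forall eps : algC, unitOK rs eps ->
  ~ exists z : algC, inK rs z /\ z ^+ 2 = eps * h.[ratr t0].

Local Notation A := {poly OK rs}.
Local Notation J := (jP rs).
Local Notation T := (tauP aut).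

Let ufdA : ufd A := ufd_poly (ufd_OK irr R aut t1 t2 t3 cn1).
Let T3 := tauP_cubed irr R aut t1 t2 t3.
Let Tfix (P : A) : T P = P -> exists p, P = J p.
Proof. exact: (tauP_fixed irr R t1 t2). Qed.

(** The list becomes a family as in (B): since the units of Z[t] are 1 and -1, non-associate norms
    are distinct up to sign. *)
Lemma prod_choices_small l eps z : (forall y, y \in l -> good_factor J T (e%:P * g) y) ->
  pairwise_nassoc l -> unitOK rs eps -> inK rs z ->
  z ^+ 2 = eps * evalO rs t0 (prod_choices T l) -> (size (prod_choices T l) <= 1)%N.
Proof.
move=> lP lN epsu Kz Ez; rewrite leqNgt; apply/negP => big.
pose y0 : {poly int} * A * 'I_4 := (0, 0, ord0).
pose yi (i : 'I_(size l)) := nth y0 l i.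
have eprod : \prod_(i < size l) choose_factors tau (yi i).2 (valQ rs (yi i).1.2) =
    valQ rs (prod_choices T l).
  rewrite /prod_choices (big_nth y0) big_mkord rmorph_prod.
  by apply: eq_bigr => i _; rewrite (choose_factors_valQ aut).
apply: (@condB (size l) (fun i => (yi i).1.1) (fun i => valQ rs (yi i).1.2) (fun i => (yi i).2)
   _ _ _ eps epsu).
- move=> i; have [ih pp na eh dG] := lP (yi i) (mem_nth y0 (ltn_ord i)).
  split=> //; split; first exact: primeZtP.
  split; first exact: prime_irredOKt.
  rewrite (map_tau_valQ aut) (map_tau2_valQ aut); split.
    left; rewrite -!rmorphM -/(cnorm T _) -eh /polyZC.
    rewrite -[valQ rs (J _)]/(map_poly _ (map_poly _ _)) -map_poly_comp.
    by apply: eq_map_poly => k /=; rewrite -[OKval _]/(val _) OKval_int.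
  by move/associateOKt_lift.
- move=> i k; rewrite -val_eqE => ne.
  have N := @pairwise_nassocP _ _ l y0 i k lN (ltn_ord i) (ltn_ord k) ne.
  split=> h; first by apply: (N 1); rewrite ?unitr1 // mul1r.
  by apply: (N (-1)); rewrite ?unitrN1 // mulN1r.
- by rewrite eprod size_map_inj_poly // ?rmorph0 //; apply: val_inj.
by exists z; split=> //; rewrite eprod.
Qed.

Lemma Aint_cubic_root : r1 \in Aint.
Proof.
pose P : {poly int} := 'X^3 + (a *: 'X^2 + (b *: 'X + c%:P)).
apply: (@root_monic_Aint (map_poly intr P)).
- rewrite /root -atr_int.
  have -> : map_poly intr P = cubicQ a%:~R b%:~R c%:~R.
    by rewrite /P /cubicQ !addrA !rmorphD /= !map_polyZ /= map_polyC !map_polyXn map_polyX.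
  by rewrite atr_cubic (rootsP R) subrr !mul0r.
- apply: monic_map; rewrite monicE lead_coefDl ?lead_coefXn // size_polyXn ltnS.
  apply: leq_trans (size_polyD _ _) _; rewrite geq_max; apply/andP; split.
    by apply: leq_trans (size_scale_leq _ _) _; rewrite size_polyXn.
  apply: leq_trans (size_polyD _ _) _; rewrite geq_max; apply/andP; split.
    by apply: leq_trans (size_scale_leq _ _) _; rewrite size_polyX.
  exact: leq_trans (size_polyC_leq1 _) _.
- by apply/polyOverP => i; rewrite coef_map /= intr_int.
Qed.

Lemma jP_C (k : int) : J k%:P = (k%:~R)%:P.
Proof. exact: map_polyC. Qed.

Lemma jPM p q : J (p * q) = J p * J q. Proof. exact: rmorphM. Qed.
Lemma jPD p q : J (p + q) = J p + J q. Proof. exact: rmorphD. Qed.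
Lemma jPB p q : J (p - q) = J p - J q. Proof. exact: rmorphB. Qed.
Lemma jPX p n : J (p ^+ n) = J p ^+ n. Proof. exact: rmorphXn. Qed.
Lemma jP_nat n : J n%:R = n%:R. Proof. exact: rmorph_nat. Qed.

Lemma jP_cubic (A B C x : {poly int}) :
  J (x ^+ 3 + A * x ^+ 2 + B * x + C) = J x ^+ 3 + J A * J x ^+ 2 + J B * J x + J C.
Proof. by rewrite !(jPD, jPX, jPM). Qed.

Lemma jP_dup (A B C x y p : {poly int}) : J (4 * y ^+ 2 * p) = 4 * J y ^+ 2 * J p /\
  J ((x ^+ 2 - B) ^+ 2 - 8 * C * x - 4 * A * C) =
  (J x ^+ 2 - J B) ^+ 2 - 8 * J C * J x - 4 * J A * J C.
Proof. by rewrite !(jPB, jPX, jPM, jP_nat). Qed.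

Lemma evalOM (P Q : A) : evalO rs t0 (P * Q) = evalO rs t0 P * evalO rs t0 Q.
Proof. exact: rmorphM. Qed.

Lemma evalOX (P : A) n : evalO rs t0 (P ^+ n) = evalO rs t0 P ^+ n.
Proof. exact: rmorphXn. Qed.

(** Each difference of roots divides [e], because [e] is up to sign the product of all three. *)
Lemma roots_in_OK : exists th1 th2 th3 : OK rs,
  [/\ tauO aut th1 = th2, tauO aut th2 = th3 & tauO aut th3 = th1] /\
  [/\ a%:~R = - (th1 + th2 + th3), b%:~R = th1 * th2 + th1 * th3 + th2 * th3,
      c%:~R = - (th1 * th2 * th3), divides (th1 - th2) e%:~R & divides (th1 - th3) e%:~R].
Proof.
have [K1 K2 K3] := inK_root R; have [ea eb ec] := cubic_vieta R.
have [th1 e1] : exists th1 : OK rs, val th1 = r1.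
  by apply: OKlift; split=> //; apply: Aint_cubic_root.
exists th1, (tauO aut th1), (tauO aut (tauO aut th1)).
have e2 : val (tauO aut th1) = r2 by rewrite val_tauO e1.
have e3 : val (tauO aut (tauO aut th1)) = r3 by rewrite val_tauO e2.
split; first by split=> //; apply: val_inj; rewrite val_tauO e3 t3 e1.
move: (tauO aut th1) (tauO aut (tauO aut th1)) e2 e3 => th2 th3 e2 e3.
have vM (x y : OK rs) : val (x * y) = val x * val y by apply: rmorphM.
have vD (x y : OK rs) : val (x + y) = val x + val y by apply: rmorphD.
have vN (x : OK rs) : val (- x) = - val x by apply: rmorphN.
have disc : (e%:~R : OK rs) ^+ 2 = ((th1 - th2) * (th1 - th3) * (th2 - th3)) ^+ 2.
  apply: val_inj; rewrite !expr2 !(vM, vD, vN) e1 e2 e3 OKval_int -!expr2.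
  by rewrite -(roots_disc R).
have [s es] : exists s, e%:~R = s * ((th1 - th2) * (th1 - th3) * (th2 - th3)).
  move/eqP: disc; rewrite eqf_sqr => /orP[] /eqP ->; first by exists 1; rewrite mul1r.
  by exists (-1); rewrite mulN1r.
split.
- by apply: val_inj; rewrite OKval_int !(vM, vD, vN) e1 e2 e3.
- by apply: val_inj; rewrite OKval_int !(vM, vD, vN) e1 e2 e3.
- by apply: val_inj; rewrite OKval_int !(vM, vD, vN) e1 e2 e3.
- by exists (s * (th1 - th3) * (th2 - th3)); rewrite es; ring.
- by exists (s * (th1 - th2) * (th2 - th3)); rewrite es; ring.
Qed.

(** [pi] divides [u - v] times [g q^2] and [u - v] times [p]. Unless it divides [u - v], and so [e],
    it divides [g], or else both [q] and [p], which have no common prime. *)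
Lemma common_prime_divides (p q : {poly int}) (u v : OK rs) (pi : A) :
  no_common_prime p q -> divides (u - v) e%:~R -> prime_elt pi ->
  divides pi (J p - u%:P * J (g * q ^+ 2)) -> divides pi (J p - v%:P * J (g * q ^+ 2)) ->
  divides pi (J (e%:P * g)).
Proof.
move=> nc [w ew] pp du dv; have [_ _ P] := pp; rewrite jPM jP_C.
have [dd|nd] := classic (divides pi (u - v)%:P).
  by apply: divides_mulr; apply: (divides_trans dd); exists w%:P; rewrite -polyCM ew.
have : divides pi ((u - v)%:P * J (g * q ^+ 2)).
  have -> : (u - v)%:P * J (g * q ^+ 2) =
      (J p - v%:P * J (g * q ^+ 2)) - (J p - u%:P * J (g * q ^+ 2)).
    by rewrite polyCB; ring.
  exact: divides_sub.
move=> /P[//|]; rewrite jPM jPX => /P[dg|/(prime_exp pp) dq]; first exact: divides_mull.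
have : divides pi ((u - v)%:P * J p).
  have -> : (u - v)%:P * J p =
      u%:P * (J p - v%:P * J (g * q ^+ 2)) - v%:P * (J p - u%:P * J (g * q ^+ 2)).
    by rewrite polyCB; ring.
  by apply: divides_sub; apply: divides_mull.
move=> /P[//|dp]; exfalso.
exact: (no_common_prime_lift T3 (@jP_inj rs) (tauP_jP aut) Tfix ufd_Zt nc pp dp dq).
Qed.

(** Condition (B) reduces [al] to a constant times a square. The value at [t0] shows that this
    constant is a square in [K], and its square root is integral, so it lies in [O_K]. *)
Lemma root_difference_square (p q z : {poly int}) (th1 th2 th3 : OK rs) :
  tauO aut th1 = th2 -> tauO aut th2 = th3 ->
  divides (th1 - th2) e%:~R -> divides (th1 - th3) e%:~R ->
  no_common_prime p q -> evalZt t0 q = 0 -> evalZt t0 p != 0 ->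
  evalZt t0 z ^+ 2 = evalZt t0 p ^+ 3 ->
  cnorm T (J p - th1%:P * J (g * q ^+ 2)) = J z ^+ 2 ->
  exists S, S ^+ 2 = J p - th1%:P * J (g * q ^+ 2).
Proof.
move=> th12 th23 d12 d13 nc evq evp evz En.
set al := J p - _ in En *.
have eval_al : evalO rs t0 al = ratr (evalZt t0 p).
  rewrite /al rmorphB (rmorphM (evalO rs t0) th1%:P) !evalO_jP rmorphM rmorphXn evq expr0n mulr0.
  by rewrite rmorph0 mulr0 subr0.
have al0 : al != 0.
  apply: contraNneq evp => al0; move/eqP: eval_al; rewrite al0 rmorph0 eq_sym.
  by rewrite fmorph_eq0.
have Tal (u u' : OK rs) : tauO aut u = u' ->
    T (J p - u%:P * J (g * q ^+ 2)) = J p - u'%:P * J (g * q ^+ 2).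
  by move=> <-; rewrite rmorphB (rmorphM T u%:P) !(tauP_jP aut) /= map_polyC.
have [|eps [l [r [epsu Ea lP lN]]]] :=
    @cnorm_square_factor _ _ J T ufdA T3 (@jP_inj rs) (tauP_jP aut) Tfix (e%:P * g) al (J z) al0 En.
  move=> pi pp pa; rewrite /al (Tal _ _ th12) (Tal _ _ th23) => -[pb|pb].
    exact: (common_prime_divides nc d12 pp pa pb).
  exact: (common_prime_divides nc d13 pp pa pb).
have [x0 ex0 ux0] := unit_polyC epsu.
have er0 : evalO rs t0 r != 0.
  apply: contraNneq evp => er0; move/eqP: eval_al.
  by rewrite Ea evalOM evalOX er0 expr0n mulr0 eq_sym fmorph_eq0.
(* At [t0] the value of [al] is [p = (z / p) ^+ 2], so [w ^+ 2] is the value of [al / r ^+ 2]. *)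
pose w := ratr (evalZt t0 z / evalZt t0 p) / evalO rs t0 r.
have Kw : inK rs w := inKM (inK_rat _) (inKV (inK_evalO _ _)).
have evx0 : evalO rs t0 x0%:P = val x0.
  by have := evalO_cons t0 0 x0; rewrite mul0r add0r rmorph0 mul0r add0r.
have Ew : w ^+ 2 = val x0 * evalO rs t0 (prod_choices T l).
  have r20 : evalO rs t0 r ^+ 2 != 0 by rewrite expf_neq0.
  have Eq : ratr (evalZt t0 z / evalZt t0 p) ^+ 2 = ratr (evalZt t0 p) :> algC.
    by rewrite -rmorphXn expr_div_n evz; congr ratr; field.
  apply: (mulIf r20); rewrite /w expr_div_n divfK // Eq.
  by rewrite -eval_al Ea ex0 (evalOM (_ * _)) (evalOM x0%:P) evalOX evx0.
have small := prod_choices_small lP lN ux0 Kw Ew.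
have ek := size1_polyC small; move: (_`_0) ek => k ek.
have evk : evalO rs t0 (prod_choices T l) = val k.
  by have := evalO_cons t0 0 k; rewrite ek mul0r add0r rmorph0 mul0r add0r.
have Ew' : w ^+ 2 = val (x0 * k) by rewrite Ew evk -rmorphM.
have [W eW] : exists W : OK rs, val W = w.
  by apply: OKlift; split=> //; apply: Aint_sqr; rewrite Ew'; case: (OKvalK (x0 * k)).
have EW : W ^+ 2 = x0 * k by apply: val_inj; rewrite -Ew' -eW rmorphXn.
by exists (W%:P * r); rewrite Ea exprMn -polyC_exp EW polyCM ex0 ek.
Qed.

Lemma halving_cyclic (p q z : {poly int}) :
  q != 0 -> no_common_prime p q -> evalZt t0 q = 0 -> evalZt t0 p != 0 ->
  let A := a%:P * g * q ^+ 2 in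
  let B := b%:P * g ^+ 2 * q ^+ 4 in
  let C := c%:P * g ^+ 3 * q ^+ 6 in
  z ^+ 2 = p ^+ 3 + A * p ^+ 2 + B * p + C ->
  exists p1 z1, [/\ evalZt t0 p1 != 0, z1 ^+ 2 = p1 ^+ 3 + A * p1 ^+ 2 + B * p1 + C &
    4 * z1 ^+ 2 * p = (p1 ^+ 2 - B) ^+ 2 - 8 * C * p1 - 4 * A * C].
Proof.
move=> q0 nc evq evp cA cB cC Ez.
have [th1 [th2 [th3 [[th12 th23 th31] [ea eb ec d12 d13]]]]] := roots_in_OK.
pose X := J p; pose W := J (g * q ^+ 2).
have EA : J cA = - (th1%:P * W + th2%:P * W + th3%:P * W).
  rewrite /cA -mulrA jPM -/W jP_C ea !(polyCN, polyCD); ring.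
have EB : J cB = th1%:P * W * (th2%:P * W) + th1%:P * W * (th3%:P * W) + th2%:P * W * (th3%:P * W).
  have -> : cB = b%:P * (g * q ^+ 2) ^+ 2 by rewrite /cB; ring.
  rewrite jPM jPX -/W jP_C eb !(polyCD, polyCM); ring.
have EC : J cC = - (th1%:P * W * (th2%:P * W) * (th3%:P * W)).
  have -> : cC = c%:P * (g * q ^+ 2) ^+ 3 by rewrite /cC; ring.
  rewrite jPM jPX -/W jP_C ec !(polyCN, polyCM); ring.
have Tal (u u' : OK rs) : tauO aut u = u' -> T (X - u%:P * W) = X - u'%:P * W.
  by move=> <-; rewrite rmorphB (rmorphM T u%:P) !(tauP_jP aut) /= map_polyC.
have En : cnorm T (X - th1%:P * W) = J z ^+ 2.
  rewrite /cnorm (Tal _ _ th12) (Tal _ _ th23) -jPX Ez.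
  by rewrite jP_cubic EA EB EC -/X; ring.
have evz : evalZt t0 z ^+ 2 = evalZt t0 p ^+ 3.
  have evl u v w : evalZt t0 u = 0 -> evalZt t0 (v + u * w) = evalZt t0 v.
    by move=> eu; rewrite rmorphD rmorphM eu mul0r addr0.
  have evA : evalZt t0 cA = 0 by rewrite /cA rmorphM rmorphXn evq expr0n mulr0.
  have evB : evalZt t0 cB = 0 by rewrite /cB rmorphM (rmorphXn _ _ q) evq expr0n mulr0.
  have evC : evalZt t0 cC = 0 by rewrite /cC rmorphM (rmorphXn _ _ q) evq expr0n mulr0.
  by rewrite -rmorphXn Ez rmorphD evC addr0 !evl // rmorphXn.
have [S1 ES1] := root_difference_square th12 th23 d12 d13 nc evq evp evz En.
rewrite -/X -/W in ES1.
(* With conjugate square roots, the symmetric expressions in the halving formula are fixed by [T]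
   and descend to Z[t]. *)
pose S2 := T S1; pose S3 := T S2.
have ES2 : S2 ^+ 2 = X - th2%:P * W by rewrite -rmorphXn ES1 (Tal _ _ th12).
have ES3 : S3 ^+ 2 = X - th3%:P * W by rewrite -rmorphXn ES2 (Tal _ _ th23).
have TS3 : T S3 = S1 by apply: T3.
have [p' ep'] : exists p', S1 * S2 + S1 * S3 + S2 * S3 = J p'.
  by apply: Tfix; rewrite !rmorphD !rmorphM /= -/S2 -/S3 TS3; ring.
have [z1 ez1] : exists z1, (S1 + S2) * (S1 + S3) * (S2 + S3) = J z1.
  by apply: Tfix; rewrite !rmorphM !rmorphD /= -/S2 -/S3 TS3; ring.
have [H1 H2] := halving_identities X S1 S2 S3; move: H1 H2.
have sub u : X - (X - u) = u by ring.
rewrite ES1 ES2 ES3 !sub -EA -EB -EC ez1 ep' -jPD => H1 H2.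
exists (p + p'), z1; split; last 1 first.
- apply: (@jP_inj rs).
  by rewrite (proj1 (jP_dup cA cB cC (p + p') z1 p)) (proj2 (jP_dup cA cB cC (p + p') z1 p)).
- have Kp : evalO rs t0 S1 ^+ 2 = ratr (evalZt t0 p).
    rewrite -rmorphXn ES1 rmorphB (rmorphM (evalO rs t0) th1%:P) !evalO_jP rmorphM rmorphXn evq expr0n mulr0.
    by rewrite rmorph0 mulr0 subr0.
  (* Up to sign the value of [S1] at [t0] is the rational number [z / p], so [S2] and [S3] share it,
     and the new numerator takes the value [4 p]. *)
  have tS : tau (evalO rs t0 S1) = evalO rs t0 S1.
    have : evalO rs t0 S1 ^+ 2 = ratr (evalZt t0 z / evalZt t0 p) ^+ 2.
      rewrite Kp -rmorphXn expr_div_n evz; congr ratr; by field.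
    move/eqP; rewrite eqf_sqr => /orP[] /eqP ->; first exact: aut_rat aut _.
    by rewrite (autN aut (inK_rat _)) (aut_rat aut).
  have e2 : evalO rs t0 S2 = evalO rs t0 S1 by rewrite evalO_tau.
  have e3 : evalO rs t0 S3 = evalO rs t0 S1 by rewrite evalO_tau e2.
  have : evalO rs t0 (J p') = ratr (3 * evalZt t0 p).
    have -> : ratr (3 * evalZt t0 p) = 3 * ratr (evalZt t0 p) :> algC by rewrite rmorphM /= ratr_nat.
    by rewrite -ep' !rmorphD !evalOM e2 e3 -Kp; ring.
  rewrite evalO_jP => /fmorph_inj ep1; rewrite rmorphD ep1.
  have -> : evalZt t0 p + 3 * evalZt t0 p = 4 * evalZt t0 p by ring.
  by rewrite mulf_neq0.
- by apply: (@jP_inj rs); rewrite jPX H1 jP_cubic.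
Qed.

End HalvingCyclic.

Lemma injective_cyclic_case (a b c : int) (g : {poly int}) (t0 : rat)
    (th1 th2 th3 : algC) (tau : algC -> algC) (e : int) :
  no_repeated_roots (cubicQ a%:~R b%:~R c%:~R) ->
  no_repeated_roots (cubicQ (a%:~R * (polyZQ g).[t0]) (b%:~R * (polyZQ g).[t0] ^+ 2)
                            (c%:~R * (polyZQ g).[t0] ^+ 3)) ->
  irreducible_poly (cubicQ a%:~R b%:~R c%:~R) ->
  map_poly ratr (cubicQ a%:~R b%:~R c%:~R) = ('X - th1%:P) * ('X - th2%:P) * ('X - th3%:P) ->
  gal_generator [:: th1; th2; th3] tau ->
  class_number_one [:: th1; th2; th3] ->
  e%:~R ^+ 2 = ((th1 - th2) * (th1 - th3) * (th2 - th3)) ^+ 2 ->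
  (forall (n : nat) (H : 'I_n -> {poly int}) (P : 'I_n -> {poly algC}) (s : 'I_n -> 'I_4),
     (forall i, dvdZt (H i) (e%:P * g) /\ splits_as [:: th1; th2; th3] tau (H i) (P i)) ->
     (forall i j, i != j -> H i <> H j /\ H i <> - H j) ->
     let h := \prod_(i < n) choose_factors tau (s i) (P i) in
     (1 < size h)%N ->
     forall eps : algC, unitOK [:: th1; th2; th3] eps ->
     ~ exists z : algC, inK [:: th1; th2; th3] z /\ z ^+ 2 = eps * h.[ratr t0]) ->
  sigma_injective a b c g t0.
Proof.
move=> sep sep0 irr Eth gen cn1 Ee condB.
have gt0 := curve_at_t0_nonzero sep0.
have ff (x : algC) : x ^+ 3 + a%:~R * x ^+ 2 + b%:~R * x + c%:~R = (x - th1) * (x - th2) * (x - th3).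
  by rewrite -atr_cubic /atr Eth !hornerE.
have neq (u v w : algC) : (forall x, x ^+ 3 + a%:~R * x ^+ 2 + b%:~R * x + c%:~R =
    (x - u) * (x - v) * (x - w)) -> u != v.
  move=> H; apply/eqP => uv; have [ea eb ec] := vieta_cubic H.
  have := @cubic_simple_rootC _ _ _ u sep; rewrite !ratr_int => /(_ _) /eqP; apply.
    by rewrite H subrr !mul0r.
  by rewrite ea eb uv; ring.
have R : cubic_roots a b c e [:: th1; th2; th3] th1 th2 th3.
  split=> //; split.
  - exact: neq ff.
  - by apply: (neq _ _ th2) => x; rewrite ff; ring.
  - by apply: (neq _ _ th1) => x; rewrite ff; ring.
(* The roots are renumbered along the orbit of [tau]. *)
have [r1 [r2 [r3 [R' [t1 t2 t3]]]]] := aut_cyclic irr gen R.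
apply: (injective_of_kernel sep0); apply: (kernel_trivial sep gt0) => p q z q0 nc evq evp.
exact: (halving_cyclic irr R' gen.1 t1 t2 t3 cn1 condB).
Qed.

Theorem theorem4p3 (a b c : int) (g : {poly int}) (t0 : rat) :
  no_repeated_roots (cubicQ a%:~R b%:~R c%:~R) ->
  (1 < size g)%N ->
  (* E_g(t0) is an elliptic curve *)
  no_repeated_roots (cubicQ (a%:~R * (polyZQ g).[t0]) (b%:~R * (polyZQ g).[t0] ^+ 2)
                            (c%:~R * (polyZQ g).[t0] ^+ 3)) ->
  (* (i) *)
  (forall (th th' : algC) (e d D : int),
     c = 0 ->
     irreducible_poly ('X^2 + a%:~R *: 'X + (b%:~R)%:P : {poly rat}) ->
     ('X^2 + a%:~R *: 'X + (b%:~R)%:P : {poly algC}) = ('X - th%:P) * ('X - th'%:P) ->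
     class_number_one [:: th; th'] ->
     a ^+ 2 - 4 * b = e ^+ 2 * d -> sqfreeZ d ->
     quad_field_disc [:: th; th'] D ->
     (* (A1) *)
     (forall h : {poly int}, (1 < size h)%N -> sqfreeZt h -> dvdZt h (b%:P * g) ->
        ~ is_square_Q (polyZQ h).[t0]) ->
     (* (A2) *)
     (forall h : {poly int}, (1 < size h)%N -> sqfreeZt h -> dvdZt h (e%:P * g) ->
        forall d' : int, sqfreeZ d' -> (d' %| D)%Z ->
        ~ is_square_Q (d'%:~R * (polyZQ h).[t0])) ->
     sigma_injective a b c g t0) /\
  (* (ii) *)
  (forall (th1 th2 th3 : algC) (tau : algC -> algC) (e : int),
     irreducible_poly (cubicQ a%:~R b%:~R c%:~R) ->
     map_poly ratr (cubicQ a%:~R b%:~R c%:~R) = ('X - th1%:P) * ('X - th2%:P) * ('X - th3%:P) ->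
     gal_generator [:: th1; th2; th3] tau ->
     class_number_one [:: th1; th2; th3] ->
     0 <= e ->
     e%:~R ^+ 2 = ((th1 - th2) * (th1 - th3) * (th2 - th3)) ^+ 2 ->
     (* (B) *)
     (forall (n : nat) (H : 'I_n -> {poly int}) (P : 'I_n -> {poly algC}) (s : 'I_n -> 'I_4),
        (forall i, dvdZt (H i) (e%:P * g) /\ splits_as [:: th1; th2; th3] tau (H i) (P i)) ->
        (forall i j, i != j -> H i <> H j /\ H i <> - H j) ->
        let h := \prod_(i < n) choose_factors tau (s i) (P i) in
        (1 < size h)%N ->
        forall eps : algC, unitOK [:: th1; th2; th3] eps ->
        ~ exists z : algC, inK [:: th1; th2; th3] z /\ z ^+ 2 = eps * h.[ratr t0]) ->
     sigma_injective a b c g t0).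
Proof.
move=> sep sg sep0; split.
  move=> th th' e d D c0 _ Eth _ Ed sfd disc A1 A2; subst c.
  exact: (injective_quadratic_case sep sg sep0 Eth Ed sfd disc A1 A2).
move=> th1 th2 th3 tau e irr Eth gen cn1 _ Ee condB.
exact: (injective_cyclic_case sep sep0 irr Eth gen cn1 Ee condB).
Qed.
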